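(* Let $\operatorname{Re}(w)>0$. For $b>0$ let $E_{2,b}(z)=\sum_{k=0}^{\infty}\frac{z^k}{\Gamma(2k+b)}$ be the two-variable Mittag-Leffler function. Then \begin{align*} \left.\frac{\partial^2}{\partial b^2}E_{2, b}(w^2)\right|_{b=1}=\log^{2}(w)\cosh(w)+2\int_{0}^{\infty}\frac{u\cos(u)\log(u)}{u^2+w^2}\, du. \end{align*}
   Context: $\log$ denotes the principal branch of the logarithm; the integral is an improper (convergent) integral at $\infty$. *)

(* Defs.v *)
From Stdlib Require Import Reals.
From Coquelicot Require Import Coquelicot.
Open Scope R_scope.

(** Euler's integral, improper at both ends; it converges for [0 < x],
    the only range in which it is used. *)
Definition Gamma (x : R) : R :=
  RInt_gen (fun t : R => Rpower t (x - 1) * exp (- t))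
    (at_right 0) (Rbar_locally p_infty).

Definition Cexp (z : C) : C :=
  (exp (Re z) * cos (Im z), exp (Re z) * sin (Im z)).

Definition Ccosh (z : C) : C := ((Cexp z + Cexp (- z)) / 2)%C.

(** Principal argument, with values in (-PI, PI] for [z <> 0]. *)
Definition Carg (z : C) : R :=
  if Rle_dec 0 (Im z) then acos (Re z / Cmod z) else - acos (Re z / Cmod z).

Definition Clog (z : C) : C := (ln (Cmod z), Carg z).

(** The sum of a series of complex numbers: [iota] returns the unique
    limit of the partial sums when they converge. *)
Definition CSeries (a : nat -> C) : C :=
  iota (T := C_R_CompleteNormedModule)
    (is_series (V := C_R_NormedModule) a).

Definition mittag_leffler (a b : R) (z : C) : C :=
  CSeries (fun k : nat => (Cpow z k / RtoC (Gamma (a * INR k + b)))%C).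

(** [f : R -> C] is differentiable near [x], and its derivative is
    differentiable at [x] with derivative [l]. *)
Definition is_derive2 (f : R -> C) (x : R) (l : C) : Prop :=
  exists f' : R -> C,
    locally x (fun y : R => is_derive (V := C_R_NormedModule) f y (f' y)) /\
    is_derive (V := C_R_NormedModule) f' x l.

(* Main.v *)
(* Write F(b) for the left-hand side.  Iterating the recursion b (b + 1) B(b) = w + w^2 B(b + 2) for
   B(b) = int_0^1 y^(b-1) sinh (w (1 - y)) dy gives F(b) = (1 + w B(b)) / Gamma(b), so that F''(1) is a
   combination of cosh w and of the integrals over (0, 1) of log^k y sinh (w (1 - y)).

   On the other side let kap(y) = w (sinh (w (1 - y)) 1_{y < 1} - cosh w e^(-w y)).  Then
   int_0^oo kap(y) (cos (y v) - 1) dy = 1 - w^2 cos v / (v^2 + w^2), and integrating against log v / v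
   over (0, r) and exchanging the integrals expresses the truncated integral of the theorem through
   int_0^r (cos (y v) - 1) (log v / v) dv, which by scaling is, as r -> oo, equal to
   g log y + (log y)^2 / 2 - (log r)^2 / 2 + c + o(1).  As int kap = -1, the divergent terms cancel.  The
   constant g is - Gamma'(1), by the same computation with 1 / v in place of log v / v and e^(-y) in
   place of kap.  The remaining integrals w int_0^oo e^(-w y) log^k y dy reduce to the derivatives of
   Gamma at 1 by rotating the half-line along w^s, 0 <= s <= 1; this produces the powers of log w.

   Integrals over (0, oo) are written on the whole line through y = e^x. *)

Require Import Defs.
From Stdlib Require Import Reals Lra Lia Factorial.
From Coquelicot Require Import Coquelicot.
Open Scope R_scope.

(** * Improper integrals over the real line *)

(** The subtracted exponential in kap has a reason: the cut sinh alone has cosine transform w^2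
    (cosh w - cos v) / (v^2 + w^2), and cosh w times w e^(-w y) has transform w^2 cosh w / (v^2 +
    w^2). The difference removes cosh w, leaving the numerator cos v of the theorem, and it is also
    what brings log w in. The obstacle is that the integral converges only conditionally, so the
    exchange cannot be justified by absolute convergence on the whole quadrant. Hence the truncation
    at r, the factor cos - 1 in place of cos, which makes the kernel integrable at v = 0, and error
    terms of size (y r)^(-1/2), valid for all y > 0, that can be integrated against kap before r
    tends to infinity. Termwise differentiation of the series in b would require bounds on the
    derivatives of 1 / Gamma along b + 2 k; in the closed form all b-derivatives fall on two
    integrals. The substitution y = e^x turns powers of log y into powers of x and decay at 0 and at
    infinity into one bound K e^(-e |x|). *)

Definition is_RInt_line (f : R -> R) (l : R) : Prop :=
  is_RInt_gen f (Rbar_locally m_infty) (Rbar_locally p_infty) l.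

(** Both G - F and G + F are nondecreasing by the mean value theorem. This takes the role of |int f|
    <= int g wherever a primitive of the majorant is at hand. *)
Lemma increment_bound (F G f g : R -> R) (a b : R) :
  a <= b ->
  (forall x, a <= x <= b -> is_derive F x (f x)) ->
  (forall x, a <= x <= b -> is_derive G x (g x)) ->
  (forall x, a <= x <= b -> Rabs (f x) <= g x) ->
  Rabs (F b - F a) <= G b - G a.
Proof.
intros Hab HF HG Hfg.
assert (Hmono : forall s, s = 1 \/ s = -1 -> 0 <= (G b - s * F b) - (G a - s * F a)).
{ intros s Hs.
  destruct (MVT_gen (fun x => G x - s * F x) a b (fun x => g x - s * f x)) as [c [Hc Heq]].
  - rewrite Rmin_left, Rmax_right by lra. intros x Hx.
    apply (is_derive_minus (V := R_NormedModule) G (fun x => s * F x)); [apply HG; lra|].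
    apply (is_derive_scal F x s), HF; lra.
  - rewrite Rmin_left, Rmax_right by lra. intros x Hx.
    apply continuity_pt_filterlim.
    apply (continuous_minus (V := R_NormedModule) G (fun x => s * F x)).
    + apply ex_derive_continuous. exists (g x). apply HG; lra.
    + apply (continuous_scal_r (V := R_NormedModule) s F).
      apply ex_derive_continuous. exists (f x). apply HF; lra.
  - rewrite Rmin_left, Rmax_right in Hc by lra. rewrite Heq.
    specialize (Hfg c Hc). apply Rabs_le_between in Hfg.
    apply Rmult_le_pos; [|lra]. destruct Hs as [-> | ->]; lra. }
apply Rabs_le_between.
generalize (Hmono 1 ltac:(auto)) (Hmono (-1) ltac:(auto)). lra.
Qed.

(** Cauchy's criterion gives the limit; letting y tend to infinity in the hypothesis turns [D] into
    a rate of convergence, which the asymptotics of the cosine primitives rely on. *)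
Lemma limit_of_tail (E D : R -> R) :
  (forall x y, 1 <= x <= y -> Rabs (E y - E x) <= D x) ->
  is_lim D p_infty 0 ->
  exists l : R, is_lim E p_infty l /\ forall x, 1 <= x -> Rabs (E x - l) <= D x.
Proof.
intros HE HD.
assert (Hl : exists l : R, filterlim E (Rbar_locally p_infty) (locally l)).
{ apply (proj1 (filterlim_locally_cauchy (U := R_CompleteSpace) (F := Rbar_locally p_infty) E)). intros eps.
  apply is_lim_spec in HD. destruct (HD (pos_div_2 eps)) as [M HM].
  exists (fun x => Rmax 1 M < x). split.
  - exists (Rmax 1 M). tauto.
  - assert (Hw : forall u v, Rmax 1 M < u -> u <= v -> Rabs (E v - E u) < eps).
    { intros u v Hu Huv.
      generalize (Rmax_l 1 M) (Rmax_r 1 M); intros.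
      specialize (HE u v ltac:(lra)). specialize (HM u ltac:(lra)).
      apply Rabs_lt_between in HM. simpl in HM. destruct eps; simpl in *. lra. }
    intros u v Hu Hv. change (Rabs (E v - E u) < eps).
    destruct (Rle_dec u v).
    + apply Hw; lra.
    + rewrite Rabs_minus_sym. apply Hw; lra. }
destruct Hl as [l Hl]. exists l. split; [exact Hl|].
intros x Hx.
assert (HL : is_lim (fun y => Rabs (E y - E x)) p_infty (Rabs (l - E x))).
{ apply (is_lim_comp_continuous (fun y => E y - E x) Rabs); [|apply continuous_Rabs].
  apply (is_lim_minus' E (fun _ => E x)); [exact Hl | apply is_lim_const]. }
rewrite Rabs_minus_sym.
apply (is_lim_le_loc (fun y => Rabs (E y - E x)) (fun _ => D x) p_infty (Rabs (l - E x)) (D x)).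
- exists x. intros y Hy. apply HE. lra.
- exact HL.
- apply is_lim_const.
Qed.

Lemma line_FTC (F f : R -> R) (a b : R) :
  (forall x, is_derive F x (f x)) -> (forall x, continuous f x) ->
  is_lim F m_infty a -> is_lim F p_infty b -> is_RInt_line f (b - a).
Proof.
intros HF Hf Ha Hb P HP.
assert (Hlim : filterlim (fun ab : R * R => F (snd ab) - F (fst ab))
   (filter_prod (Rbar_locally m_infty) (Rbar_locally p_infty)) (locally (b - a))).
{ apply (filterlim_comp_2 (G := locally b) (H := locally (- a))
    (fun ab : R * R => F (snd ab)) (fun ab : R * R => - F (fst ab)) Rplus).
  - apply filterlim_comp with (2 := Hb). apply filterlim_snd.
  - apply filterlim_comp with (2 := is_lim_opp _ _ _ Ha). apply filterlim_fst.
  - apply (filterlim_plus (V := R_NormedModule) b (- a)). }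
specialize (Hlim P HP).
revert Hlim. unfold filtermap, filtermapi. apply filter_imp. intros [x y] H. exists (F y - F x). split; [|exact H].
apply (is_RInt_derive (V := R_CompleteNormedModule)); auto.
Qed.

Lemma line_ext (f g : R -> R) (l : R) :
  (forall x, f x = g x) -> is_RInt_line f l -> is_RInt_line g l.
Proof.
intros H Hf. refine (is_RInt_gen_ext (V := R_NormedModule) f g l _ Hf).
apply filter_forall. auto.
Qed.

Lemma line_unique (f : R -> R) (l l' : R) : is_RInt_line f l -> is_RInt_line f l' -> l = l'.
Proof.
intros H H'. 
rewrite <- (is_RInt_gen_unique (V := R_CompleteNormedModule) f l H).
apply (is_RInt_gen_unique (V := R_CompleteNormedModule)). exact H'.
Qed.

Lemma line_plus (f g : R -> R) (l m : R) :
  is_RInt_line f l -> is_RInt_line g m -> is_RInt_line (fun x => f x + g x) (l + m).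
Proof. intros Hf Hg. exact (is_RInt_gen_plus (V := R_NormedModule) f g l m Hf Hg). Qed.

Lemma line_scal (k : R) (f : R -> R) (l : R) :
  is_RInt_line f l -> is_RInt_line (fun x => k * f x) (k * l).
Proof. intros H. apply (is_RInt_gen_scal (V := R_NormedModule) f k l H). Qed.

Lemma line_minus (f g : R -> R) (l m : R) :
  is_RInt_line f l -> is_RInt_line g m -> is_RInt_line (fun x => f x - g x) (l - m).
Proof. intros Hf Hg. exact (is_RInt_gen_minus (V := R_NormedModule) f g l m Hf Hg). Qed.

Lemma is_lim_exp_neg (e : R) : 0 < e -> is_lim (fun x => exp (- e * x)) p_infty 0.
Proof.
intros He.
apply (is_lim_comp exp (fun x => - e * x) p_infty 0 m_infty).
- apply is_lim_exp_m.
- replace m_infty with (Rbar_mult (- e) p_infty).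
  + apply (is_lim_scal_l (fun x => x) (- e) p_infty p_infty). apply is_lim_id.
  + simpl. destruct (Rle_dec 0 (- e)); [exfalso; lra|reflexivity].
- exists 0. intros; discriminate.
Qed.

Lemma is_lim_reflect (F : R -> R) (l : R) :
  is_lim (fun x => F (- x)) p_infty l -> is_lim F m_infty l.
Proof.
intros H.
apply (is_lim_ext (fun x => F (- - x))).
{ intros x. f_equal. ring. }
apply (is_lim_comp (fun x => F (- x)) (fun x => - x) m_infty l p_infty).
- exact H.
- apply (is_lim_opp (fun x => x) m_infty m_infty). apply is_lim_id.
- exists 0. intros; discriminate.
Qed.

Lemma exists_antiderivative (f : R -> R) :
  (forall x, continuous f x) -> forall x, is_derive (RInt f 0) x (f x).
Proof.
intros Hf x. apply (is_derive_RInt f (RInt f 0) 0 x); [|apply Hf].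
apply filter_forall. intros y. apply (RInt_correct (V := R_CompleteNormedModule)).
apply (ex_RInt_continuous (V := R_CompleteNormedModule)). auto.
Qed.

Lemma dominated_line_bound (f : R -> R) (K e : R) :
  0 < e -> (forall x, continuous f x) ->
  (forall x, Rabs (f x) <= K * exp (- e * Rabs x)) ->
  exists l, is_RInt_line f l /\ Rabs l <= 2 * K / e.
Proof.
intros He Hf Hb.
assert (HK : 0 <= K).
{ specialize (Hb 0). rewrite Rabs_R0, Rmult_0_r, exp_0 in Hb.
  generalize (Rabs_pos (f 0)). lra. }
assert (Hside : forall g : R -> R, (forall x, continuous g x) ->
  (forall x, 0 <= x -> Rabs (g x) <= K * exp (- e * x)) ->
  exists l : R, is_lim (RInt g 0) p_infty l /\ Rabs l <= K / e).
{ intros g Hg Hgb.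
  assert (Hinc : forall x y, 0 <= x <= y ->
    Rabs (RInt g 0 y - RInt g 0 x) <= K / e * exp (- e * x)).
  { intros x y Hxy.
    apply Rle_trans with (- K / e * exp (- e * y) - (- K / e * exp (- e * x))).
    - apply (increment_bound (RInt g 0) (fun x => - K / e * exp (- e * x)) g
        (fun x => K * exp (- e * x))); try lra.
      + intros; now apply exists_antiderivative.
      + intros z _. auto_derive; [trivial|field; lra].
      + intros; apply Hgb; lra.
    - assert (0 <= K / e * exp (- e * y)).
      { apply Rmult_le_pos; [apply Rdiv_le_0_compat; lra | left; apply exp_pos]. }
      unfold Rdiv in *. lra. }
  destruct (limit_of_tail (RInt g 0) (fun x => K / e * exp (- e * x))) as [l [Hl _]].
  - intros; apply Hinc; lra.
  - replace (Finite 0) with (Rbar_mult (K / e) 0) by (simpl; f_equal; ring).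
    apply is_lim_scal_l. now apply is_lim_exp_neg.
  - exists l. split; [exact Hl|].
    assert (HL : is_lim (fun y => Rabs (RInt g 0 y)) p_infty (Rabs l)).
    { exact (is_lim_comp_continuous _ Rabs _ _ Hl (continuous_Rabs l)). }
    apply (is_lim_le_loc (fun y => Rabs (RInt g 0 y)) (fun _ => K / e) p_infty (Rabs l) (K / e)).
    + exists 0. intros y Hy. generalize (Hinc 0 y ltac:(lra)).
      rewrite RInt_point, Rmult_0_r, exp_0, Rmult_1_r.
      change (zero : R_CompleteNormedModule) with 0. now rewrite Rminus_0_r.
    + exact HL.
    + apply is_lim_const. }
destruct (Hside f Hf) as [l1 [Hl1 Hb1]].
{ intros x Hx. specialize (Hb x). now rewrite (Rabs_pos_eq x Hx) in Hb. }
destruct (Hside (fun x => f (- x))) as [l2 [Hl2 Hb2]].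
{ intros x. apply (continuous_comp Ropp f); [|apply Hf].
  apply (continuous_opp (V := R_NormedModule) (fun x => x)). apply continuous_id. }
{ intros x Hx. specialize (Hb (- x)). now rewrite (Rabs_Ropp x), (Rabs_pos_eq x Hx) in Hb. }
exists (l1 - - l2). split.
- apply (line_FTC (RInt f 0)).
  + now apply exists_antiderivative.
  + exact Hf.
  + apply is_lim_reflect.
    apply (is_lim_ext (fun x => - RInt (fun x => f (- x)) 0 x)).
    * intros x.
      assert (H : is_RInt (fun y => - f (- y)) 0 x (RInt f 0 (- x))).
      { apply (is_RInt_comp_opp (V := R_NormedModule) f 0 x). rewrite Ropp_0.
        apply (RInt_correct (V := R_CompleteNormedModule)). apply (ex_RInt_continuous (V := R_CompleteNormedModule)). auto. }
      apply (is_RInt_opp (V := R_NormedModule)) in H.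
      apply (is_RInt_ext _ (fun y => f (- y))) in H.
      2:{ intros y _. change (- - f (- y) = f (- y)). ring. }
      rewrite (is_RInt_unique _ _ _ _ H). change (- - RInt f 0 (- x) = RInt f 0 (- x)). ring.
    * apply (is_lim_opp _ p_infty l2 Hl2).
  + exact Hl1.
- replace (2 * K / e) with (K / e + K / e) by (field; lra).
  replace (l1 - - l2) with (l1 + l2) by ring.
  apply Rle_trans with (1 := Rabs_triang _ _). lra.
Qed.

Lemma line_bound (f : R -> R) (K e l : R) :
  0 < e -> (forall x, continuous f x) ->
  (forall x, Rabs (f x) <= K * exp (- e * Rabs x)) ->
  is_RInt_line f l -> Rabs l <= 2 * K / e.
Proof.
intros He Hf Hb Hl.
destruct (dominated_line_bound f K e He Hf Hb) as [l' [Hl' Hb']].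
now rewrite (line_unique f l l' Hl Hl').
Qed.

Lemma is_derive_quadratic (I : R -> R) (s I1 d K : R) :
  0 < d -> (forall t, Rabs (t - s) <= d ->
    Rabs (I t - I s - (t - s) * I1) <= K * (t - s) ^ 2) ->
  is_derive I s I1.
Proof.
intros Hd H. apply is_derive_Reals. intros eps Heps.
assert (Hdel : 0 < Rmin d (eps / (Rabs K + 1))).
{ apply Rmin_pos; [lra|]. apply Rdiv_lt_0_compat; [lra|].
  generalize (Rabs_pos K); lra. }
exists (mkposreal _ Hdel). intros h Hh Hhd. simpl in Hhd.
assert (H1 : Rabs h < d) by (eapply Rlt_le_trans; [exact Hhd | apply Rmin_l]).
assert (H2 : Rabs h < eps / (Rabs K + 1)) by (eapply Rlt_le_trans; [exact Hhd | apply Rmin_r]).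
specialize (H (s + h)). replace (s + h - s) with h in H by ring.
specialize (H ltac:(lra)).
replace ((I (s + h) - I s) / h - I1) with ((I (s + h) - I s - h * I1) / h) by now field.
assert (Hh' : 0 < Rabs h) by now apply Rabs_pos_lt.
unfold Rdiv. rewrite Rabs_mult, Rabs_inv by exact Hh.
apply Rmult_lt_reg_r with (Rabs h); [exact Hh'|].
rewrite Rmult_assoc, Rinv_l, Rmult_1_r by lra.
apply Rle_lt_trans with (1 := H).
rewrite <- (pow2_abs h).
assert (HK : 0 < Rabs K + 1) by (generalize (Rabs_pos K); lra).
apply Rmult_lt_compat_r with (r := Rabs K + 1) in H2; [|lra].
unfold Rdiv in H2. rewrite Rmult_assoc, Rinv_l, Rmult_1_r in H2 by lra.
generalize (Rle_abs K). intros. nra.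
Qed.

(** Two applications of the mean value theorem bound the Taylor remainder of the integrand by K
    e^(-e |x|) (t - s)^2. Integrated over the line, this is the estimate of [is_derive_quadratic]: a
    dominated second derivative justifies differentiation under the integral. *)
Lemma line_deriv (f f1 f2 : R -> R -> R) (I : R -> R) (s I1 d K e : R) :
  0 < d -> 0 < e ->
  (forall t x, Rabs (t - s) <= d -> is_derive (fun u => f u x) t (f1 t x)) ->
  (forall t x, Rabs (t - s) <= d -> is_derive (fun u => f1 u x) t (f2 t x)) ->
  (forall t x, Rabs (t - s) <= d -> Rabs (f2 t x) <= K * exp (- e * Rabs x)) ->
  (forall t x, continuous (f t) x) -> (forall x, continuous (f1 s) x) ->
  (forall t, Rabs (t - s) <= d -> is_RInt_line (f t) (I t)) -> is_RInt_line (f1 s) I1 ->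
  is_derive I s I1.
Proof.
intros Hd He H1 H2 Hb Hc Hc1 HI HI1.
apply (is_derive_quadratic I s I1 d (2 * K / e) Hd). intros t Ht.
replace (2 * K / e * (t - s) ^ 2) with (2 * (K * (t - s) ^ 2) / e) by (field; lra).
assert (Hss : Rabs (s - s) <= d) by (rewrite Rminus_diag, Rabs_R0; lra).
apply (line_bound (fun x => f t x - f s x - (t - s) * f1 s x)).
- exact He.
- intros x. apply (continuous_minus (V := R_NormedModule) (fun x => f t x - f s x)).
  + now apply (continuous_minus (V := R_NormedModule) (f t)).
  + now apply (continuous_scal_r (V := R_NormedModule) (t - s) (f1 s)).
- intros x.
  destruct (MVT_cor4 (fun u => f u x) (fun u => f1 u x) s d) with (b := t) as [c [Hc1' Hc2]];
    [intros; now apply H1 | exact Ht |].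
  destruct (MVT_cor4 (fun u => f1 u x) (fun u => f2 u x) s d) with (b := c) as [z [Hz1 Hz2]];
    [intros; now apply H2 | lra |].
  rewrite Hc1'.
  replace (f1 c x * (t - s) - (t - s) * f1 s x) with ((f1 c x - f1 s x) * (t - s)) by ring.
  rewrite Hz1, !Rabs_mult, <- (pow2_abs (t - s)).
  specialize (Hb z x ltac:(lra)).
  apply Rle_trans with (K * exp (- e * Rabs x) * Rabs (t - s) * Rabs (t - s)); [|right; ring].
  apply Rmult_le_compat_r; [apply Rabs_pos|].
  apply Rmult_le_compat; try apply Rabs_pos; lra.
- apply line_minus.
  + apply line_minus; now apply HI.
  + now apply line_scal.
Qed.

(** * Domination by exponentials on the line *)

Lemma pow_le_fact_exp (y : R) (n : nat) : 0 <= y -> y ^ n <= INR (fact n) * exp y.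
Proof.
intros Hy. generalize (exp_ge_taylor y n Hy). intros H.
assert (Hn : y ^ n / INR (fact n) <= exp y).
{ apply Rle_trans with (2 := H). destruct n as [|n]; [simpl; lra|].
  rewrite tech5.
  assert (0 <= sum_f_R0 (fun k => y ^ k / INR (fact k)) n); [|lra].
  apply cond_pos_sum. intros k. apply Rdiv_le_0_compat; [now apply pow_le|apply INR_fact_lt_0]. }
apply Rmult_le_compat_l with (r := INR (fact n)) in Hn; [|apply pos_INR].
replace (INR (fact n) * (y ^ n / INR (fact n))) with (y ^ n) in Hn; [lra|].
field. apply INR_fact_neq_0.
Qed.

Lemma exp_pow (x : R) (n : nat) : exp x ^ n = exp (x * INR n).
Proof.
induction n as [|n IH].
- now rewrite Rmult_0_r, exp_0.
- rewrite S_INR. simpl pow. rewrite IH, <- exp_plus. f_equal. ring.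
Qed.

Lemma exp_le_compat (x y : R) : x <= y -> exp x <= exp y.
Proof. intros [H | ->]; [left; now apply exp_increasing | right; reflexivity]. Qed.

(** As x tends to +oo the factor exp (- m e^x) beats every e^(N x); as x tends to -oo the decay
    e^(b1 x) remains. Half of the rate b1 is spent on |x|^k. Uniformity in b is what differentiation
    in b requires. *)
Lemma pow_exp_domination (b1 b2 m : R) (k : nat) :
  0 < b1 -> 0 < m ->
  exists K e, 0 < K /\ 0 < e /\ forall b x, b1 <= b <= b2 ->
    exp (b * x) * Rabs x ^ k * exp (- m * exp x) <= K * exp (- e * Rabs x).
Proof.
intros Hb1 Hm.
(* N exceeds b + b1, so e^(b x) e^(b1 x) <= (e^x)^N for x >= 0. *)
destruct (INR_unbounded (b1 + b2)) as [N HN].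
(* The summand 1 serves x < 0, where the bound needs A >= 1. *)
set (A := INR (fact N) / m ^ N + 1).
assert (HmN : 0 < m ^ N) by now apply pow_lt.
assert (HA : 1 <= A).
{ unfold A. assert (0 <= INR (fact N) / m ^ N); [|lra].
  apply Rdiv_le_0_compat; [apply pos_INR|lra]. }
set (B := INR (fact k) / (b1 / 2) ^ k).
assert (HB : 0 < B).
{ apply Rdiv_lt_0_compat; [apply INR_fact_lt_0 | apply pow_lt; lra]. }
exists (A * B), (b1 / 2). split; [apply Rmult_lt_0_compat; lra|]. split; [lra|].
intros b x Hb.
assert (Hpow : Rabs x ^ k <= B * exp (b1 / 2 * Rabs x)).
{ generalize (pow_le_fact_exp (b1 / 2 * Rabs x) k
    (Rmult_le_pos (b1 / 2) _ ltac:(lra) (Rabs_pos x))).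
  rewrite Rpow_mult_distr. intros H.
  assert (H0 : 0 < (b1 / 2) ^ k) by (apply pow_lt; lra).
  apply Rmult_le_reg_l with (1 := H0). apply Rle_trans with (1 := H).
  right. unfold B. field. lra. }
assert (Hexp : exp (b * x) * exp (- m * exp x) <= A * exp (- b1 * Rabs x)).
{ destruct (Rle_dec 0 x) as [Hx|Hx].
  - rewrite (Rabs_pos_eq x Hx).
    apply Rmult_le_reg_r with (exp (b1 * x)); [apply exp_pos|].
    replace (A * exp (- b1 * x) * exp (b1 * x)) with A.
    2:{ rewrite Rmult_assoc, <- exp_plus. replace (- b1 * x + b1 * x) with 0 by ring.
        rewrite exp_0. ring. }
    generalize (pow_le_fact_exp (m * exp x) N
      (Rmult_le_pos m _ ltac:(lra) (Rlt_le _ _ (exp_pos x)))).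
    rewrite Rpow_mult_distr, exp_pow. intros H.
    assert (H1 : exp (b * x) * exp (b1 * x) <= exp (x * INR N)).
    { rewrite <- exp_plus. apply exp_le_compat.
      rewrite (Rmult_comm x (INR N)), <- Rmult_plus_distr_r. apply Rmult_le_compat_r; lra. }
    assert (H2 : exp (x * INR N) * exp (- m * exp x) <= A).
    { apply Rmult_le_reg_l with (1 := HmN).
      apply Rmult_le_reg_r with (exp (m * exp x)); [apply exp_pos|].
      replace (m ^ N * (exp (x * INR N) * exp (- m * exp x)) * exp (m * exp x))
        with (m ^ N * exp (x * INR N)).
      - apply Rle_trans with (1 := H). apply Rmult_le_compat_r; [left; apply exp_pos|].
        unfold A. replace (m ^ N * (INR (fact N) / m ^ N + 1)) with (INR (fact N) + m ^ N)
          by (field; lra). lra.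
      - rewrite !Rmult_assoc, <- exp_plus.
        replace (- m * exp x + m * exp x) with 0 by ring. rewrite exp_0. ring. }
    apply Rle_trans with (2 := H2).
    rewrite Rmult_assoc, (Rmult_comm (exp (- m * exp x))), <- Rmult_assoc.
    apply Rmult_le_compat_r; [left; apply exp_pos | exact H1].
  - rewrite (Rabs_left1 x) by lra.
    replace (- b1 * - x) with (b1 * x) by ring.
    assert (H1 : exp (b * x) <= exp (b1 * x)) by (apply exp_le_compat; nra).
    assert (H2 : exp (- m * exp x) <= 1).
    { rewrite <- exp_0. apply exp_le_compat. generalize (exp_pos x). nra. }
    generalize (exp_pos (b1 * x)) (exp_pos (b * x)) (exp_pos (- m * exp x)). intros.
    apply Rle_trans with (exp (b1 * x) * 1); [|nra].
    apply Rmult_le_compat; lra. }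
replace (exp (b * x) * Rabs x ^ k * exp (- m * exp x))
  with (exp (b * x) * exp (- m * exp x) * Rabs x ^ k) by ring.
replace (A * B * exp (- (b1 / 2) * Rabs x))
  with (A * exp (- b1 * Rabs x) * (B * exp (b1 / 2 * Rabs x))).
- apply Rmult_le_compat; try assumption.
  + apply Rmult_le_pos; left; apply exp_pos.
  + apply pow_le, Rabs_pos.
- replace (- (b1 / 2) * Rabs x) with (- b1 * Rabs x + b1 / 2 * Rabs x) by field.
  rewrite exp_plus. ring.
Qed.

(** * Mellin moments and the Gamma function *)

Lemma ex_derive_R_continuous (f : R -> R) (x : R) : ex_derive f x -> continuous f x.
Proof. exact (ex_derive_continuous (V := R_NormedModule) f x). Qed.

(** With y = e^x this is y^(b-1) log^k y phi(y) dy on (0, oo), the k-th b-derivative of the Mellin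
    integrand; the Jacobian e^x raises the power from b - 1 to b. *)
Definition moment (phi : R -> R) (k : nat) (b x : R) : R :=
  exp (b * x) * x ^ k * phi (exp x).

Definition Moment (phi : R -> R) (k : nat) (b : R) : R :=
  RInt_gen (moment phi k b) (Rbar_locally m_infty) (Rbar_locally p_infty).

Definition tame (phi : R -> R) : Prop :=
  (forall y, continuous phi y) /\
  exists C m, 0 < m /\ forall y, 0 <= y -> Rabs (phi y) <= C * exp (- m * y).

Lemma moment_continuous (phi : R -> R) (k : nat) (b x : R) :
  tame phi -> continuous (moment phi k b) x.
Proof.
intros [Hc _]. unfold moment.
apply (continuous_mult (K := R_AbsRing) (fun x => exp (b * x) * x ^ k) (fun x => phi (exp x))).
- apply ex_derive_R_continuous. auto_derive. trivial.
- apply (continuous_comp exp phi); [apply continuous_exp | apply Hc].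
Qed.

Lemma moment_bound (phi : R -> R) (k : nat) (b1 b2 : R) :
  tame phi -> 0 < b1 ->
  exists K e, 0 < e /\ forall b x, b1 <= b <= b2 ->
    Rabs (moment phi k b x) <= K * exp (- e * Rabs x).
Proof.
intros [Hc [C [m [Hm Hb]]]] Hb1.
destruct (pow_exp_domination b1 b2 m k Hb1 Hm) as [K [e [HK [He H]]]].
exists (C * K), e. split; [exact He|]. intros b x Hbb.
specialize (H b x Hbb). specialize (Hb (exp x) (Rlt_le _ _ (exp_pos x))).
unfold moment. rewrite !Rabs_mult, <- RPow_abs, (Rabs_pos_eq (exp (b * x))) by (left; apply exp_pos).
assert (HC : 0 <= C).
{ apply Rmult_le_reg_r with (exp (- m * exp x)); [apply exp_pos|].
  generalize (Rabs_pos (phi (exp x))). lra. }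
apply Rle_trans with (exp (b * x) * Rabs x ^ k * (C * exp (- m * exp x))).
- apply Rmult_le_compat_l; [|exact Hb].
  apply Rmult_le_pos; [left; apply exp_pos | apply pow_le, Rabs_pos].
- rewrite Rmult_assoc. apply Rmult_le_compat_l with (r := C) in H; [lra | exact HC].
Qed.

Lemma moment_line (phi : R -> R) (k : nat) (b : R) :
  tame phi -> 0 < b -> is_RInt_line (moment phi k b) (Moment phi k b).
Proof.
intros Ht Hb.
destruct (moment_bound phi k b b Ht Hb) as [K [e [He H]]].
destruct (dominated_line_bound (moment phi k b) K e He) as [l [Hl _]].
- intros; now apply moment_continuous.
- intros; apply H; lra.
- replace (Moment phi k b) with l; [exact Hl|].
  symmetry. apply (is_RInt_gen_unique (V := R_CompleteNormedModule)). exact Hl.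
Qed.

Lemma Moment_eq (phi : R -> R) (k : nat) (b l : R) :
  is_RInt_line (moment phi k b) l -> Moment phi k b = l.
Proof. intros H. apply (is_RInt_gen_unique (V := R_CompleteNormedModule)). exact H. Qed.

Lemma moment_derive (phi : R -> R) (k : nat) (b x : R) :
  is_derive (fun b => moment phi k b x) b (moment phi (S k) b x).
Proof.
unfold moment. auto_derive; [trivial|]. simpl. ring.
Qed.

Lemma is_derive_Moment (phi : R -> R) (k : nat) (b : R) :
  tame phi -> 0 < b -> is_derive (Moment phi k) b (Moment phi (S k) b).
Proof.
intros Ht Hb.
destruct (moment_bound phi (S (S k)) (b / 2) (2 * b) Ht ltac:(lra)) as [K [e [He H]]].
assert (Hnear : forall t, Rabs (t - b) <= b / 2 -> b / 2 <= t <= 2 * b).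
{ intros t Ht'. apply Rabs_le_between in Ht'. lra. }
apply (line_deriv (fun b => moment phi k b) (fun b => moment phi (S k) b)
  (fun b => moment phi (S (S k)) b) (Moment phi k) b _ (b / 2) K e).
- lra.
- exact He.
- intros; apply moment_derive.
- intros; apply moment_derive.
- intros; apply H; now apply Hnear.
- intros; now apply moment_continuous.
- intros; now apply moment_continuous.
- intros t Hn. apply moment_line; [exact Ht|]. specialize (Hnear t Hn). lra.
- now apply moment_line.
Qed.

Lemma tame_exp_neg : tame (fun y => exp (- y)).
Proof.
split.
- intros y. apply ex_derive_R_continuous. auto_derive. trivial.
- exists 1, 1. split; [lra|]. intros y _.
  rewrite Rabs_pos_eq by (left; apply exp_pos). right. rewrite Rmult_1_l. f_equal. ring.
Qed.

(** The substitution t = e^x on every compact interval; since ln carries the filters at 0+ and +oo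
    to those at -oo and +oo, the improper integrals correspond. *)
Lemma Gamma_Moment (b : R) : 0 < b -> Gamma b = Moment (fun y => exp (- y)) 0 b.
Proof.
intros Hb. unfold Gamma.
apply (is_RInt_gen_unique (V := R_CompleteNormedModule)
  (fun t => Rpower t (b - 1) * exp (- t)) (Moment (fun y => exp (- y)) 0 b)).
intros P HP.
destruct (moment_line (fun y => exp (- y)) 0 b tame_exp_neg Hb P HP) as [Q S HQ HS H].
exists (fun t => 0 < t /\ Q (ln t)) (fun t => 0 < t /\ S (ln t)).
- apply filter_and.
  + exists (mkposreal 1 Rlt_0_1). intros; assumption.
  + apply (is_lim_ln_0 Q HQ).
- apply filter_and.
  + exists 0. auto.
  + apply (is_lim_ln_p S HS).
- intros s t [Hs HQs] [Ht HSt].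
  destruct (H _ _ HQs HSt) as [y [Hy HPy]]. exists y. split; [|exact HPy].
  simpl in Hy |- *.
  assert (Hpos : forall x, Rmin s t <= x <= Rmax s t -> 0 < x).
  { intros x Hx. apply Rlt_le_trans with (2 := proj1 Hx). now apply Rmin_pos. }
  rewrite <- (is_RInt_unique (V := R_CompleteNormedModule) _ _ _ _ Hy).
  apply (is_RInt_ext (fun x => scal (/ x) (moment (fun y => exp (- y)) 0 b (ln x)))).
  + intros x Hx. specialize (Hpos x ltac:(lra)).
    change (/ x * (exp (b * ln x) * ln x ^ 0 * exp (- exp (ln x))) = exp ((b - 1) * ln x) * exp (- x)).
    rewrite (exp_ln x Hpos).
    replace ((b - 1) * ln x) with (b * ln x + - ln x) by ring.
    rewrite exp_plus, (exp_Ropp (ln x)), (exp_ln x Hpos). simpl. ring.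
  + apply (is_RInt_comp (V := R_CompleteNormedModule) (moment (fun y => exp (- y)) 0 b) ln Rinv).
    * intros x _. apply moment_continuous, tame_exp_neg.
    * intros x Hx. specialize (Hpos x Hx). split.
      -- auto_derive; [exact Hpos|]. field. lra.
      -- apply continuous_Rinv. lra.
Qed.

(** * Primitives in the variable e^x; recursion and positivity of Gamma *)

Lemma is_lim_exp_scal_m (b : R) : 0 < b -> is_lim (fun x => exp (b * x)) m_infty 0.
Proof.
intros Hb. apply is_lim_reflect.
apply (is_lim_ext (fun x => exp (- b * x))); [intros; f_equal; ring|].
now apply is_lim_exp_neg.
Qed.

Lemma is_lim_comp_exp_m (g : R -> R) :
  continuous g 0 -> is_lim (fun x => g (exp x)) m_infty (g 0).
Proof. intros Hg. apply (is_lim_comp_continuous exp g); [apply is_lim_exp_m | exact Hg]. Qed.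

Lemma is_lim_exp_mult_m (g : R -> R) (b : R) :
  0 < b -> continuous g 0 -> is_lim (fun x => exp (b * x) * g (exp x)) m_infty 0.
Proof.
intros Hb Hg.
replace (Finite 0) with (Finite (0 * g 0)) by (f_equal; ring).
apply (is_lim_mult (fun x => exp (b * x)) (fun x => g (exp x)) m_infty 0 (g 0)).
- now apply is_lim_exp_scal_m.
- now apply is_lim_comp_exp_m.
- exact I.
Qed.

(** A kernel cut at y = 1 has a corner at x = 0, so [F] is a primitive on the left only. The global
    primitive x -> int_0^x f + F 0 agrees with [F] there and is constant on the right. *)
Lemma line_cut (f F : R -> R) :
  (forall x, continuous f x) -> (forall x, x <= 0 -> is_derive F x (f x)) ->
  (forall x, 0 <= x -> f x = 0) -> is_lim F m_infty 0 -> is_RInt_line f (F 0).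
Proof.
intros Hc HF H0 Hl. replace (F 0) with (F 0 - 0) by ring.
apply (line_FTC (fun x => RInt f 0 x + F 0)).
- intros x. replace (f x) with (f x + 0) by ring.
  apply (is_derive_plus (V := R_NormedModule) (RInt f 0) (fun _ => F 0)).
  + now apply exists_antiderivative.
  + apply (is_derive_const (V := R_NormedModule)).
- exact Hc.
- apply (is_lim_ext_loc F); [|exact Hl].
  exists 0. intros x Hx.
  assert (H : is_RInt f 0 x (F x - F 0)).
  { apply (is_RInt_derive (V := R_CompleteNormedModule)).
    - rewrite Rmin_right, Rmax_left by lra. intros; apply HF; lra.
    - auto. }
  rewrite (is_RInt_unique (V := R_CompleteNormedModule) _ _ _ _ H). simpl. ring.
- apply (is_lim_ext_loc (fun _ => F 0)); [|apply is_lim_const].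
  exists 0. intros x Hx.
  rewrite (RInt_ext (V := R_CompleteNormedModule) f (fun _ => 0)).
  + rewrite (RInt_const (V := R_CompleteNormedModule)).
    unfold scal; simpl; unfold mult; simpl. ring.
  + rewrite Rmin_left, Rmax_right by lra. intros; apply H0; lra.
Qed.

(** Reduces an integral over the line to the limit of proper integrals over (0, Y), on which the
    order of integration can be exchanged. *)
Lemma line_exp_subst (h : R -> R) (l : R) :
  (forall y, continuous h y) -> is_lim (RInt h 0) p_infty l ->
  is_RInt_line (fun x => exp x * h (exp x)) l.
Proof.
intros Hc Hl. replace l with (l - RInt h 0 0).
2:{ rewrite (RInt_point (V := R_CompleteNormedModule)). apply Rminus_0_r. }
apply (line_FTC (fun x => RInt h 0 (exp x))).
- intros x.
  apply (is_derive_comp (V := R_NormedModule) (RInt h 0) exp x).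
  + now apply exists_antiderivative.
  + apply is_derive_exp.
- intros x. apply (continuous_mult (K := R_AbsRing) exp (fun x => h (exp x))).
  + apply continuous_exp.
  + apply (continuous_comp exp h); [apply continuous_exp | apply Hc].
- apply (is_lim_comp_exp_m (RInt h 0)).
  apply (ex_derive_continuous (V := R_NormedModule)). exists (h 0). now apply exists_antiderivative.
- apply (is_lim_comp (RInt h 0) exp p_infty l p_infty); [exact Hl | apply is_lim_exp_p |].
  exists 0. intros; discriminate.
Qed.

(** The function e^(b x) exp (- e^x) vanishes at both ends, so its derivative has integral zero:
    integration by parts in the exponential variable. *)
Lemma Gamma_succ (b : R) : 0 < b -> Gamma (b + 1) = b * Gamma b.
Proof.
intros Hb. rewrite !Gamma_Moment by lra.
set (phi := fun y => exp (- y)).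
assert (H : is_RInt_line (fun x => b * moment phi 0 b x - moment phi 0 (b + 1) x) (0 - 0)).
{ apply (line_FTC (moment phi 0 b)).
  - intros x. unfold moment, phi. auto_derive; [trivial|].
    replace ((b + 1) * x) with (b * x + x) by ring. rewrite exp_plus. simpl. ring.
  - intros x. apply (continuous_minus (V := R_NormedModule) (fun x => b * moment phi 0 b x)).
    + apply (continuous_scal_r (V := R_NormedModule) b). apply moment_continuous, tame_exp_neg.
    + apply moment_continuous, tame_exp_neg.
  - apply (is_lim_ext (fun x => exp (b * x) * phi (exp x))).
    { intros x. unfold moment. simpl. ring. }
    apply (is_lim_exp_mult_m phi b Hb), tame_exp_neg.
  - destruct (moment_bound phi 0 b b tame_exp_neg Hb) as [K [e [He HK]]].
    apply (is_lim_le_le_loc (fun x => - (K * exp (- e * x))) (fun x => K * exp (- e * x))).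
    + exists 0. intros x Hx. specialize (HK b x ltac:(lra)).
      rewrite (Rabs_pos_eq x) in HK by lra. now apply Rabs_le_between.
    + replace (Finite 0) with (Rbar_opp (Rbar_mult K 0)) by (simpl; f_equal; ring).
      apply is_lim_opp, is_lim_scal_l. now apply is_lim_exp_neg.
    + replace (Finite 0) with (Rbar_mult K 0) by (simpl; f_equal; ring).
      apply is_lim_scal_l. now apply is_lim_exp_neg. }
assert (H' : is_RInt_line (fun x => b * moment phi 0 b x - moment phi 0 (b + 1) x)
   (b * Moment phi 0 b - Moment phi 0 (b + 1))).
{ apply line_minus; [apply line_scal|]; apply moment_line; try apply tame_exp_neg; lra. }
generalize (line_unique _ _ _ H H'). lra.
Qed.

Lemma Gamma_1 : Gamma 1 = 1.
Proof.
rewrite Gamma_Moment by lra. apply Moment_eq.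
apply (line_ext (fun x => exp x * exp (- exp x))).
{ intros x. unfold moment. rewrite Rmult_1_l. simpl. ring. }
apply (line_exp_subst (fun y => exp (- y))); [apply tame_exp_neg|].
apply (is_lim_ext (fun y => 1 - exp (Ropp 1 * y))).
- intros y. symmetry. apply is_RInt_unique.
  replace (1 - exp (Ropp 1 * y)) with (minus (- exp (- y)) (- exp (- 0))).
  + apply (is_RInt_derive (V := R_CompleteNormedModule) (fun y => - exp (- y))).
    * intros; auto_derive; [trivial|ring].
    * intros; apply tame_exp_neg.
  + unfold minus, plus, opp; simpl. rewrite Ropp_0, exp_0.
    replace (Ropp 1 * y) with (- y) by ring. ring.
- replace (Finite 1) with (Finite (1 - 0)) by (f_equal; ring).
  apply is_lim_minus'; [apply is_lim_const | apply (is_lim_exp_neg 1); lra].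
Qed.

(** Serves strict positivity: [Gamma_pos] bounds the Gamma integral below by its part over [0, 1],
    where a positive continuous integrand has a positive integral. *)
Lemma line_ge_RInt (f : R -> R) (l : R) :
  (forall x, continuous f x) -> (forall x, 0 <= f x) -> is_RInt_line f l -> RInt f 0 1 <= l.
Proof.
intros Hc Hf Hl. apply Rnot_lt_le. intros Hlt.
destruct (Hl (fun y => y < RInt f 0 1)) as [Q S [M HQ] [N HS] H].
{ apply (open_lt (RInt f 0 1) l Hlt). }
set (a := Rmin M 0 - 1). set (b := Rmax N 1 + 1).
generalize (Rmin_l M 0) (Rmin_r M 0) (Rmax_l N 1) (Rmax_r N 1). intros.
destruct (H a b) as [y [Hy Hlt']]; [apply HQ; unfold a; lra | apply HS; unfold b; lra |].
simpl in Hy. apply (is_RInt_unique (V := R_CompleteNormedModule)) in Hy.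
assert (Hex : forall u v, ex_RInt f u v).
{ intros. apply (ex_RInt_continuous (V := R_CompleteNormedModule)). auto. }
assert (Hnn : forall u v, u <= v -> 0 <= RInt f u v).
{ intros u v Huv. apply RInt_ge_0; auto. }
generalize (RInt_Chasles (V := R_CompleteNormedModule) f a 0 1 (Hex _ _) (Hex _ _))
  (RInt_Chasles (V := R_CompleteNormedModule) f a 1 b (Hex _ _) (Hex _ _))
  (Hnn a 0 ltac:(unfold a; lra)) (Hnn 1 b ltac:(unfold b; lra)).
unfold plus; simpl. lra.
Qed.

Lemma Gamma_pos (b : R) : 0 < b -> 0 < Gamma b.
Proof.
intros Hb. rewrite Gamma_Moment by exact Hb.
set (f := moment (fun y => exp (- y)) 0 b).
assert (Hpos : forall x, 0 < f x).
{ intros x. unfold f, moment. rewrite Rmult_1_r. apply Rmult_lt_0_compat; apply exp_pos. }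
apply Rlt_le_trans with (RInt f 0 1).
- apply RInt_gt_0; [lra | auto |]. intros; apply moment_continuous, tame_exp_neg.
- apply line_ge_RInt.
  + intros; apply moment_continuous, tame_exp_neg.
  + intros; left; auto.
  + apply moment_line; [apply tame_exp_neg | exact Hb].
Qed.

(** * Complex-valued functions of a real variable *)

(** Derivatives, continuity and integrals of complex functions are taken componentwise, so that the
    real lemmas apply to each part; [is_derive_C] and [filterlim_C] return to the normed space C. *)
Definition cderive (f : R -> C) (x : R) (l : C) : Prop :=
  is_derive (fun x => Re (f x)) x (Re l) /\ is_derive (fun x => Im (f x)) x (Im l).

Definition ccontinuous (f : R -> C) (x : R) : Prop :=
  continuous (fun x => Re (f x)) x /\ continuous (fun x => Im (f x)) x.

Definition is_CInt_line (f : R -> C) (l : C) : Prop :=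
  is_RInt_line (fun x => Re (f x)) (Re l) /\ is_RInt_line (fun x => Im (f x)) (Im l).

Lemma C_ext (z z' : C) : Re z = Re z' -> Im z = Im z' -> z = z'.
Proof. destruct z, z'. simpl. now intros -> ->. Qed.

Lemma cderive_eq (f : R -> C) (x : R) (l l' : C) : l = l' -> cderive f x l -> cderive f x l'.
Proof. now intros ->. Qed.

Lemma cderive_const (c : C) (x : R) : cderive (fun _ => c) x 0.
Proof. split; apply (is_derive_const (V := R_NormedModule)). Qed.

Lemma cderive_plus (f g : R -> C) (x : R) (l m : C) :
  cderive f x l -> cderive g x m -> cderive (fun x => f x + g x)%C x (l + m)%C.
Proof. intros [H1 H2] [H3 H4]. split; now apply (is_derive_plus (V := R_NormedModule)). Qed.

Lemma cderive_minus (f g : R -> C) (x : R) (l m : C) :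
  cderive f x l -> cderive g x m -> cderive (fun x => f x - g x)%C x (l - m)%C.
Proof. intros [H1 H2] [H3 H4]. split; now apply (is_derive_minus (V := R_NormedModule)). Qed.

Lemma cderive_mult (f g : R -> C) (x : R) (l m : C) :
  cderive f x l -> cderive g x m -> cderive (fun x => f x * g x)%C x (l * g x + f x * m)%C.
Proof.
intros [H1 H2] [H3 H4].
assert (Hm : forall a b : R -> R, forall a' b' : R, is_derive a x a' -> is_derive b x b' ->
  is_derive (fun x => a x * b x) x (a' * b x + a x * b')).
{ intros. apply (is_derive_mult a b x a' b'); try assumption. intros; apply Rmult_comm. }
split.
- replace (Re (l * g x + f x * m)%C) with
   (Re l * Re (g x) + Re (f x) * Re m - (Im l * Im (g x) + Im (f x) * Im m)) by (simpl; unfold Re, Im; ring).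
  apply (is_derive_minus (V := R_NormedModule) (fun x => Re (f x) * Re (g x)) (fun x => Im (f x) * Im (g x))); auto.
- replace (Im (l * g x + f x * m)%C) with
   (Re l * Im (g x) + Re (f x) * Im m + (Im l * Re (g x) + Im (f x) * Re m)) by (simpl; unfold Re, Im; ring).
  apply (is_derive_plus (V := R_NormedModule) (fun x => Re (f x) * Im (g x)) (fun x => Im (f x) * Re (g x))); auto.
Qed.

Lemma cderive_real (f : R -> R) (x l : R) :
  is_derive f x l -> cderive (fun x => RtoC (f x)) x l.
Proof.
intros H. split.
- change (is_derive (fun x => f x) x l). exact H.
- change (is_derive (fun _ : R => 0) x 0). apply (is_derive_const (V := R_NormedModule) 0).
Qed.

Lemma cderive_scal (c : C) (f : R -> C) (x : R) (l : C) :
  cderive f x l -> cderive (fun x => c * f x)%C x (c * l)%C.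
Proof.
intros H. apply (cderive_eq _ _ (0 * f x + c * l)%C); [ring|].
apply (cderive_mult (fun _ => c)); [apply cderive_const | exact H].
Qed.

Lemma cderive_Cexp (f : R -> C) (x : R) (l : C) :
  cderive f x l -> cderive (fun x => Cexp (f x)) x (l * Cexp (f x))%C.
Proof.
intros [H1 H2].
set (u := fun x => Re (f x)) in *. set (v := fun x => Im (f x)) in *.
assert (Hu : ex_derive u x) by (now exists (Re l)).
assert (Hv : ex_derive v x) by (now exists (Im l)).
assert (Eu : Derive (fun y => u y) x = Re l) by (now apply is_derive_unique).
assert (Ev : Derive (fun y => v y) x = Im l) by (now apply is_derive_unique).
split; simpl.
- change (is_derive (fun x => exp (u x) * cos (v x)) x (fst l * (exp (u x) * cos (v x)) - snd l * (exp (u x) * sin (v x)))).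
  auto_derive; [auto|]. rewrite Eu, Ev. unfold Re, Im. ring.
- change (is_derive (fun x => exp (u x) * sin (v x)) x (fst l * (exp (u x) * sin (v x)) + snd l * (exp (u x) * cos (v x)))).
  auto_derive; [auto|]. rewrite Eu, Ev. unfold Re, Im. ring.
Qed.

Lemma cderive_continuous (f : R -> C) (x : R) (l : C) : cderive f x l -> ccontinuous f x.
Proof.
intros [H1 H2]. split; apply ex_derive_R_continuous; eexists; eassumption.
Qed.

Lemma ccontinuous_plus (f g : R -> C) (x : R) :
  ccontinuous f x -> ccontinuous g x -> ccontinuous (fun x => f x + g x)%C x.
Proof. intros [H1 H2] [H3 H4]. split; now apply (continuous_plus (V := R_NormedModule)). Qed.

Lemma ccontinuous_minus (f g : R -> C) (x : R) :
  ccontinuous f x -> ccontinuous g x -> ccontinuous (fun x => f x - g x)%C x.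
Proof. intros [H1 H2] [H3 H4]. split; now apply (continuous_minus (V := R_NormedModule)). Qed.

Lemma ccontinuous_const (c : C) (x : R) : ccontinuous (fun _ => c) x.
Proof. split; apply continuous_const. Qed.

Lemma ccontinuous_mult (f g : R -> C) (x : R) :
  ccontinuous f x -> ccontinuous g x -> ccontinuous (fun x => f x * g x)%C x.
Proof.
intros [H1 H2] [H3 H4]. split; simpl.
- apply (continuous_minus (V := R_NormedModule) (fun x => Re (f x) * Re (g x)) (fun x => Im (f x) * Im (g x)));
  now apply (continuous_mult (K := R_AbsRing)).
- apply (continuous_plus (V := R_NormedModule) (fun x => Re (f x) * Im (g x)) (fun x => Im (f x) * Re (g x)));
  now apply (continuous_mult (K := R_AbsRing)).
Qed.

Lemma ccontinuous_real (f : R -> R) (x : R) :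
  continuous f x -> ccontinuous (fun x => RtoC (f x)) x.
Proof.
intros H. split.
- change (continuous (fun x => f x) x). exact H.
- change (continuous (fun _ : R => 0) x). apply continuous_const.
Qed.

Lemma ccontinuous_comp (f : R -> C) (g : R -> R) (x : R) :
  continuous g x -> ccontinuous f (g x) -> ccontinuous (fun x => f (g x)) x.
Proof.
intros Hg [H1 H2].
split; [apply (continuous_comp g (fun y => Re (f y))) | apply (continuous_comp g (fun y => Im (f y)))]; assumption.
Qed.

Lemma Cexp_plus (z z' : C) : Cexp (z + z') = (Cexp z * Cexp z')%C.
Proof.
apply C_ext; simpl; unfold Re, Im; simpl; rewrite exp_plus, ?cos_plus, ?sin_plus; ring.
Qed.

Lemma Cexp_0 : Cexp 0 = 1.
Proof. apply C_ext; simpl; rewrite exp_0, ?cos_0, ?sin_0; ring. Qed.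

Lemma Cexp_real (x : R) : Cexp x = exp x.
Proof. apply C_ext; simpl; rewrite ?cos_0, ?sin_0; ring. Qed.

Lemma Cmod_Cexp (z : C) : Cmod (Cexp z) = exp (Re z).
Proof.
unfold Cmod, Cexp; simpl.
replace (exp (Re z) * cos (Im z) * (exp (Re z) * cos (Im z) * 1) +
  exp (Re z) * sin (Im z) * (exp (Re z) * sin (Im z) * 1)) with (exp (Re z) * exp (Re z)).
- apply sqrt_square. left; apply exp_pos.
- generalize (sin2_cos2 (Im z)). unfold Rsqr. intros H.
  transitivity (exp (Re z) * exp (Re z) * (sin (Im z) * sin (Im z) + cos (Im z) * cos (Im z))); [rewrite H|]; ring.
Qed.

Lemma Re_le_Cmod (z : C) : Rabs (Re z) <= Cmod z.
Proof.
apply Rle_trans with (2 := Rmax_Cmod z). apply Rmax_l.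
Qed.

Lemma Im_le_Cmod (z : C) : Rabs (Im z) <= Cmod z.
Proof.
apply Rle_trans with (2 := Rmax_Cmod z). apply Rmax_r.
Qed.

Lemma cline_ext (f g : R -> C) (l : C) : (forall x, f x = g x) -> is_CInt_line f l -> is_CInt_line g l.
Proof.
intros H [H1 H2].
split; [apply (line_ext (fun x => Re (f x))) | apply (line_ext (fun x => Im (f x)))]; auto;
intros; now rewrite H.
Qed.

Lemma cline_unique (f : R -> C) (l l' : C) : is_CInt_line f l -> is_CInt_line f l' -> l = l'.
Proof. intros [H1 H2] [H3 H4]. apply C_ext; eapply line_unique; eassumption. Qed.

Lemma cline_minus (f g : R -> C) (l m : C) :
  is_CInt_line f l -> is_CInt_line g m -> is_CInt_line (fun x => f x - g x)%C (l - m)%C.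
Proof. intros [H1 H2] [H3 H4]. split; now apply line_minus. Qed.

Lemma cline_scal (c : C) (f : R -> C) (l : C) :
  is_CInt_line f l -> is_CInt_line (fun x => c * f x)%C (c * l)%C.
Proof.
intros [H1 H2]. split; simpl.
- apply (line_minus (fun x => Re c * Re (f x)) (fun x => Im c * Im (f x))); now apply line_scal.
- apply (line_plus (fun x => Re c * Im (f x)) (fun x => Im c * Re (f x))); now apply line_scal.
Qed.

(** * Moments of complex-valued functions *)

Definition cmoment (phi : R -> C) (k : nat) (b x : R) : C :=
  (RtoC (exp (b * x) * x ^ k) * phi (exp x))%C.

Definition CMoment (phi : R -> C) (k : nat) (b : R) : C :=
  (Moment (fun y => Re (phi y)) k b, Moment (fun y => Im (phi y)) k b).

Definition ctame (phi : R -> C) : Prop :=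
  tame (fun y => Re (phi y)) /\ tame (fun y => Im (phi y)).

Lemma ctame_of_Cmod (phi : R -> C) (c m : R) :
  0 < m -> (forall y, ccontinuous phi y) ->
  (forall y, 0 <= y -> Cmod (phi y) <= c * exp (- m * y)) -> ctame phi.
Proof.
intros Hm Hc Hb.
split; (split; [intros y; destruct (Hc y); assumption | exists c, m; split; [exact Hm|]]); intros y Hy.
- apply Rle_trans with (1 := Re_le_Cmod _). now apply Hb.
- apply Rle_trans with (1 := Im_le_Cmod _). now apply Hb.
Qed.

Lemma Re_cmoment (phi : R -> C) (k : nat) (b x : R) :
  Re (cmoment phi k b x) = moment (fun y => Re (phi y)) k b x.
Proof. unfold cmoment, moment. simpl. unfold Re, Im. ring. Qed.

Lemma Im_cmoment (phi : R -> C) (k : nat) (b x : R) :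
  Im (cmoment phi k b x) = moment (fun y => Im (phi y)) k b x.
Proof. unfold cmoment, moment. simpl. unfold Re, Im. ring. Qed.

Lemma cmoment_line (phi : R -> C) (k : nat) (b : R) :
  ctame phi -> 0 < b -> is_CInt_line (cmoment phi k b) (CMoment phi k b).
Proof.
intros [H1 H2] Hb. split; simpl.
- apply (line_ext (moment (fun y => Re (phi y)) k b)); [intros; symmetry; apply Re_cmoment|].
  now apply moment_line.
- apply (line_ext (moment (fun y => Im (phi y)) k b)); [intros; symmetry; apply Im_cmoment|].
  now apply moment_line.
Qed.

Lemma cderive_CMoment (phi : R -> C) (k : nat) (b : R) :
  ctame phi -> 0 < b -> cderive (CMoment phi k) b (CMoment phi (S k) b).
Proof. intros [H1 H2] Hb. split; now apply is_derive_Moment. Qed.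

Lemma cline_cut (f F : R -> C) :
  (forall x, ccontinuous f x) -> (forall x, x <= 0 -> cderive F x (f x)) ->
  (forall x, 0 <= x -> f x = 0) ->
  is_lim (fun x => Re (F x)) m_infty 0 -> is_lim (fun x => Im (F x)) m_infty 0 -> is_CInt_line f (F 0).
Proof.
intros Hc HF H0 H1 H2.
split.
- apply (line_cut (fun x => Re (f x)) (fun x => Re (F x))); [| | | exact H1]; intros x.
  + exact (proj1 (Hc x)).
  + intros Hx. exact (proj1 (HF x Hx)).
  + intros Hx. now rewrite H0.
- apply (line_cut (fun x => Im (f x)) (fun x => Im (F x))); [| | | exact H2]; intros x.
  + exact (proj2 (Hc x)).
  + intros Hx. exact (proj2 (HF x Hx)).
  + intros Hx. now rewrite H0.
Qed.

(** * Second derivative of the Mittag-Leffler function *)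

Lemma filterlim_C {T : Type} (F : (T -> Prop) -> Prop) {FF : Filter F} (f : T -> C) (l : C) :
  filterlim (fun t => Re (f t)) F (locally (Re l)) ->
  filterlim (fun t => Im (f t)) F (locally (Im l)) ->
  filterlim f F (locally (T := C_R_NormedModule) l).
Proof.
intros H1 H2 P [eps HP]. unfold filtermap.
apply (filter_imp (fun t => ball (Re l) eps (Re (f t)) /\ ball (Im l) eps (Im (f t)))).
- intros t [Hr Hi]. apply HP. split; assumption.
- apply filter_and.
  + exact (H1 _ (locally_ball (Re l) eps)).
  + exact (H2 _ (locally_ball (Im l) eps)).
Qed.

Lemma is_derive_C (f : R -> C) (x : R) (l : C) :
  cderive f x l -> is_derive (V := C_R_NormedModule) f x l.
Proof.
intros [H1 H2].
apply (is_derive_ext (V := C_R_NormedModule)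
  (fun x => plus (scal (Re (f x)) ((1, 0) : C_R_NormedModule)) (scal (Im (f x)) ((0, 1) : C_R_NormedModule)))).
{ intros t. apply C_ext; simpl; unfold plus, scal; simpl; unfold mult; simpl; ring. }
replace l with (plus (scal (Re l) ((1, 0) : C_R_NormedModule)) (scal (Im l) ((0, 1) : C_R_NormedModule))).
2:{ apply C_ext; simpl; unfold plus, scal; simpl; unfold mult; simpl; ring. }
apply (is_derive_plus (V := C_R_NormedModule)).
- apply (is_derive_scal_l (V := C_R_NormedModule) (fun x => Re (f x))). exact H1.
- apply (is_derive_scal_l (V := C_R_NormedModule) (fun x => Im (f x))). exact H2.
Qed.

(** * Hyperbolic functions and the cut hyperbolic sine *)

Definition Csinh (z : C) : C := ((Cexp z - Cexp (- z)) / 2)%C.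

Lemma C2_neq_0 : RtoC 2 <> RtoC 0.
Proof. intros H. apply RtoC_inj in H. lra. Qed.

Lemma cderive_opp (f : R -> C) (x : R) (l : C) :
  cderive f x l -> cderive (fun x => - f x)%C x (- l)%C.
Proof. intros [H1 H2]. split; now apply (is_derive_opp (V := R_NormedModule)). Qed.

Lemma cderive_Csinh (f : R -> C) (x : R) (l : C) :
  cderive f x l -> cderive (fun x => Csinh (f x)) x (l * Ccosh (f x))%C.
Proof.
intros H. unfold Csinh, Ccosh.
apply (cderive_eq _ _ ((l * Cexp (f x) - - l * Cexp (- f x)) * / 2 + (Cexp (f x) - Cexp (- f x)) * 0)%C).
{ field. }
apply (cderive_mult (fun x => Cexp (f x) - Cexp (- f x))%C (fun _ => / 2)%C); [|apply cderive_const].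
apply cderive_minus; apply cderive_Cexp; [exact H | now apply cderive_opp].
Qed.

Lemma cderive_Ccosh (f : R -> C) (x : R) (l : C) :
  cderive f x l -> cderive (fun x => Ccosh (f x)) x (l * Csinh (f x))%C.
Proof.
intros H. unfold Csinh, Ccosh.
apply (cderive_eq _ _ ((l * Cexp (f x) + - l * Cexp (- f x)) * / 2 + (Cexp (f x) + Cexp (- f x)) * 0)%C).
{ field. }
apply (cderive_mult (fun x => Cexp (f x) + Cexp (- f x))%C (fun _ => / 2)%C); [|apply cderive_const].
apply cderive_plus; apply cderive_Cexp; [exact H | now apply cderive_opp].
Qed.

Lemma Csinh_0 : Csinh 0 = 0.
Proof. unfold Csinh. replace (- 0)%C with (RtoC 0) by ring. field. Qed.

Lemma Ccosh_0 : Ccosh 0 = 1.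
Proof.
unfold Ccosh. replace (- 0)%C with (RtoC 0) by ring. rewrite Cexp_0.
field.
Qed.

Lemma Cmod_Csinh (z : C) : Cmod (Csinh z) <= exp (Rabs (Re z)).
Proof.
unfold Csinh. rewrite Cmod_div by apply C2_neq_0. rewrite Cmod_R, (Rabs_pos_eq 2) by lra.
apply Rmult_le_reg_r with 2; [lra|]. unfold Rdiv. rewrite Rmult_assoc, Rinv_l, Rmult_1_r by lra.
apply Rle_trans with (1 := Cmod_triangle _ _). rewrite Cmod_opp, !Cmod_Cexp.
generalize (exp_le_compat (Re z) (Rabs (Re z)) (Rle_abs _)).
assert (H : Re (- z) <= Rabs (Re z)).
{ rewrite <- Rabs_Ropp. apply Rle_abs. }
generalize (exp_le_compat _ _ H). lra.
Qed.

(** The function sinh (w (1 - y)) for y < 1, extended by sinh 0 = 0. Clamping with [Rmin] makes it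
    continuous on the whole line, as [tame] demands. *)
Definition sinh_cut (w : C) (y : R) : C := Csinh (w * RtoC (1 - Rmin y 1)).

Lemma continuous_Rmin_1 (y : R) : continuous (fun y => Rmin y 1) y.
Proof.
apply (continuous_ext (fun y => (y + 1 - Rabs (y - 1)) / 2)).
- intros t. unfold Rmin, Rabs. destruct (Rle_dec t 1), (Rcase_abs (t - 1)); lra.
- apply (continuous_mult (K := R_AbsRing) (fun y => y + 1 - Rabs (y - 1)) (fun _ => / 2)).
  + apply (continuous_minus (V := R_NormedModule) (fun y => y + 1)).
    * apply ex_derive_R_continuous. auto_derive. trivial.
    * apply continuous_Rabs_comp. apply ex_derive_R_continuous. auto_derive. trivial.
  + apply continuous_const.
Qed.

Lemma cderive_affine (w : C) (y : R) : cderive (fun y => w * RtoC (1 - y))%C y (- w)%C.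
Proof.
apply (cderive_eq _ _ (w * RtoC (Ropp 1))%C).
{ rewrite RtoC_opp. ring. }
apply cderive_scal, cderive_real. auto_derive; [trivial|ring].
Qed.

Lemma sinh_cut_continuous (w : C) (y : R) : ccontinuous (sinh_cut w) y.
Proof.
apply (ccontinuous_comp (fun y => Csinh (w * RtoC (1 - y))) (fun y => Rmin y 1)).
- apply continuous_Rmin_1.
- eapply cderive_continuous. apply cderive_Csinh, cderive_affine.
Qed.

Lemma sinh_cut_ge_1 (w : C) (y : R) : 1 <= y -> sinh_cut w y = 0.
Proof.
intros Hy. unfold sinh_cut. rewrite Rmin_right by lra.
rewrite Rminus_diag, Cmult_0_r. apply Csinh_0.
Qed.

Lemma sinh_cut_le_1 (w : C) (y : R) : y <= 1 -> sinh_cut w y = Csinh (w * RtoC (1 - y)).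
Proof. intros Hy. unfold sinh_cut. now rewrite Rmin_left by lra. Qed.

Lemma ctame_sinh_cut (w : C) : ctame (sinh_cut w).
Proof.
apply (ctame_of_Cmod _ (exp (Rabs (Re w) + 1)) 1); [lra | apply sinh_cut_continuous |].
intros y Hy. destruct (Rle_dec 1 y) as [H|H].
- rewrite sinh_cut_ge_1, Cmod_0 by exact H. apply Rmult_le_pos; left; apply exp_pos.
- rewrite sinh_cut_le_1 by lra. apply Rle_trans with (1 := Cmod_Csinh _).
  rewrite <- exp_plus. apply exp_le_compat.
  replace (Re (w * RtoC (1 - y))) with (Re w * (1 - y)) by (simpl; unfold Re; ring).
  rewrite Rabs_mult, (Rabs_pos_eq (1 - y)) by lra.
  generalize (Rabs_pos (Re w)). nra.
Qed.

Lemma cmoment_continuous (phi : R -> C) (k : nat) (b x : R) :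
  ctame phi -> ccontinuous (cmoment phi k b) x.
Proof.
intros [H1 H2]. split.
- apply (continuous_ext (moment (fun y => Re (phi y)) k b)); [intros; symmetry; apply Re_cmoment|].
  now apply moment_continuous.
- apply (continuous_ext (moment (fun y => Im (phi y)) k b)); [intros; symmetry; apply Im_cmoment|].
  now apply moment_continuous.
Qed.

Lemma ccontinuous_scal (c : C) (f : R -> C) (x : R) :
  ccontinuous f x -> ccontinuous (fun x => c * f x)%C x.
Proof. intros H. apply (ccontinuous_mult (fun _ => c)); [apply ccontinuous_const | exact H]. Qed.

(** Two integrations by parts condensed into one primitive y^b G(y), with G(y) = (b + 1) sinh (w (1
    - y)) + w y cosh (w (1 - y)). It vanishes at y = 0 because b > 0, and at y = 1 it equals w. *)
Lemma CMoment_sinh_cut_rec (w : C) (b : R) : 0 < b ->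
  (RtoC (b * (b + 1)) * CMoment (sinh_cut w) 0 b
   = w + w ^ 2 * CMoment (sinh_cut w) 0 (b + 2))%C.
Proof.
intros Hb.
set (f := fun x => (RtoC (b * (b + 1)) * cmoment (sinh_cut w) 0 b x
  - w ^ 2 * cmoment (sinh_cut w) 0 (b + 2) x)%C).
set (G := fun y => (RtoC (b + 1) * Csinh (w * RtoC (1 - y)) + RtoC y * (w * Ccosh (w * RtoC (1 - y))))%C).
set (F := fun x => (RtoC (exp (b * x)) * G (exp x))%C).
assert (HG : forall y, cderive G y (- (RtoC b * (w * Ccosh (w * RtoC (1 - y))))
    - RtoC y * (w ^ 2 * Csinh (w * RtoC (1 - y))))%C).
{ intros y.
  apply (cderive_eq _ _ (RtoC (b + 1) * (- w * Ccosh (w * RtoC (1 - y))) +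
    (RtoC 1 * (w * Ccosh (w * RtoC (1 - y))) + RtoC y * (w * (- w * Csinh (w * RtoC (1 - y))))))%C).
  { rewrite RtoC_plus. ring. }
  apply cderive_plus.
  - apply cderive_scal, cderive_Csinh, cderive_affine.
  - apply (cderive_mult RtoC).
    + apply (cderive_real (fun y => y)). apply (is_derive_id (K := R_AbsRing)).
    + apply cderive_scal, cderive_Ccosh, cderive_affine. }
assert (H1 : is_CInt_line f (F 0)).
{ apply cline_cut.
  - intros x. unfold f. apply ccontinuous_minus; apply ccontinuous_scal, cmoment_continuous, ctame_sinh_cut.
  - intros x Hx.
    assert (HGe : cderive (fun x => G (exp x)) x (RtoC (exp x) * (- (RtoC b * (w * Ccosh (w * RtoC (1 - exp x))))
      - RtoC (exp x) * (w ^ 2 * Csinh (w * RtoC (1 - exp x)))))%C).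
    { destruct (HG (exp x)) as [Hr Hi]. split.
      - refine (eq_rect _ (is_derive (fun x => Re (G (exp x))) x)
          (is_derive_comp (V := R_NormedModule) (fun y => Re (G y)) exp x _ _ Hr (is_derive_exp x)) _ _).
        unfold scal; simpl; unfold mult; simpl. unfold Re, Im. ring.
      - refine (eq_rect _ (is_derive (fun x => Im (G (exp x))) x)
          (is_derive_comp (V := R_NormedModule) (fun y => Im (G y)) exp x _ _ Hi (is_derive_exp x)) _ _).
        unfold scal; simpl; unfold mult; simpl. unfold Re, Im. ring. }
    apply (cderive_eq _ _ (RtoC (b * exp (b * x)) * G (exp x) +
      RtoC (exp (b * x)) * (RtoC (exp x) * (- (RtoC b * (w * Ccosh (w * RtoC (1 - exp x))))
      - RtoC (exp x) * (w ^ 2 * Csinh (w * RtoC (1 - exp x))))))%C).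
    { assert (Hle : exp x <= 1) by (rewrite <- exp_0; now apply exp_le_compat).
      unfold f, G, cmoment. rewrite sinh_cut_le_1 by exact Hle.
      replace ((b + 2) * x) with (b * x + x + x) by ring.
      rewrite !exp_plus. simpl pow. rewrite !RtoC_mult, !RtoC_plus. ring. }
    apply (cderive_mult (fun x => RtoC (exp (b * x))) (fun x => G (exp x))); [|exact HGe].
    apply (cderive_real (fun x => exp (b * x))). auto_derive; [trivial|ring].
  - intros x Hx. unfold f, cmoment.
    rewrite sinh_cut_ge_1 by (rewrite <- exp_0; now apply exp_le_compat). ring.
  - apply (is_lim_ext (fun x => exp (b * x) * Re (G (exp x)))).
    { intros x. unfold F. simpl. unfold Re. ring. }
    apply (is_lim_exp_mult_m (fun y => Re (G y)) b Hb). apply (cderive_continuous _ _ _ (HG 0)).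
  - apply (is_lim_ext (fun x => exp (b * x) * Im (G (exp x)))).
    { intros x. unfold F. simpl. unfold Im. ring. }
    apply (is_lim_exp_mult_m (fun y => Im (G y)) b Hb). apply (cderive_continuous _ _ _ (HG 0)). }
assert (H2 : is_CInt_line f (RtoC (b * (b + 1)) * CMoment (sinh_cut w) 0 b
   - w ^ 2 * CMoment (sinh_cut w) 0 (b + 2))%C).
{ apply cline_minus; apply cline_scal, cmoment_line; try apply ctame_sinh_cut; lra. }
generalize (cline_unique _ _ _ H1 H2). unfold F, G.
rewrite Rmult_0_r, exp_0, Rminus_diag, Cmult_0_r, Csinh_0, Ccosh_0. intros H.
replace w with (1 * (RtoC (b + 1) * 0 + 1 * (w * 1)))%C at 2 by ring.
rewrite H. ring.
Qed.

(** The primitive is cosh w - cosh (w (1 - y)). Hence 1 + w B(1) = cosh w, and later the total mass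
    -1 of kap. *)
Lemma CMoment_sinh_cut_1 (w : C) : (w * CMoment (sinh_cut w) 0 1 = Ccosh w - 1)%C.
Proof.
set (F := fun x => (Ccosh w - Ccosh (w * RtoC (1 - exp x)))%C).
assert (HF : forall x, cderive F x (0 - - (w * RtoC (exp x)) * Csinh (w * RtoC (1 - exp x)))%C).
{ intros x. apply cderive_minus; [apply cderive_const|].
  apply cderive_Ccosh.
  apply (cderive_eq _ _ (w * RtoC (- exp x))%C); [rewrite RtoC_opp; ring|].
  apply cderive_scal, (cderive_real (fun x => 1 - exp x)). auto_derive; [trivial|ring]. }
assert (HFc : forall y, ccontinuous (fun y => (Ccosh w - Ccosh (w * RtoC (1 - y)))%C) y).
{ intros y. apply ccontinuous_minus; [apply ccontinuous_const|].
  eapply cderive_continuous. apply cderive_Ccosh, cderive_affine. }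
assert (H0 : (Ccosh w - Ccosh (w * RtoC (1 - 0)) = 0)%C).
{ rewrite Rminus_0_r, Cmult_1_r. ring. }
assert (H1 : is_CInt_line (fun x => (w * cmoment (sinh_cut w) 0 1 x)%C) (F 0)).
{ apply cline_cut.
  - intros x. apply ccontinuous_scal, cmoment_continuous, ctame_sinh_cut.
  - intros x Hx. refine (cderive_eq _ _ _ _ _ (HF x)).
    unfold cmoment. rewrite sinh_cut_le_1.
    + rewrite Rmult_1_l. simpl pow. rewrite RtoC_mult. ring.
    + rewrite <- exp_0; now apply exp_le_compat.
  - intros x Hx. unfold cmoment. rewrite sinh_cut_ge_1; [ring|].
    rewrite <- exp_0; now apply exp_le_compat.
  - generalize (is_lim_comp_exp_m _ (proj1 (HFc 0))). now rewrite H0.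
  - generalize (is_lim_comp_exp_m _ (proj2 (HFc 0))). now rewrite H0. }
rewrite <- (cline_unique _ _ _ H1 (cline_scal w _ _ (cmoment_line _ 0 1 (ctame_sinh_cut w) Rlt_0_1))).
unfold F. now rewrite exp_0, Rminus_diag, Cmult_0_r, Ccosh_0.
Qed.

(** For y <= 1 and b >= 1 one has y^b <= y, so the integrand at b = 1 dominates all others. The
    remainders of the series need a bound uniform along b + 2 n. *)
Lemma Moment_bounded (phi : R -> R) :
  tame phi -> (forall y, 1 <= y -> phi y = 0) ->
  exists K, forall b, 1 <= b -> Rabs (Moment phi 0 b) <= K.
Proof.
intros Ht H0.
destruct (moment_bound phi 0 1 1 Ht Rlt_0_1) as [K [e [He H]]].
exists (2 * K / e). intros b Hb.
apply (line_bound (moment phi 0 b) K e).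
- exact He.
- intros; now apply moment_continuous.
- intros x. apply Rle_trans with (2 := H 1 x ltac:(lra)).
  unfold moment. destruct (Rle_dec 0 x) as [Hx|Hx].
  + rewrite (H0 (exp x)) by (rewrite <- exp_0; now apply exp_le_compat).
    rewrite !Rmult_0_r. lra.
  + rewrite !Rabs_mult, !(Rabs_pos_eq (exp _)) by (left; apply exp_pos).
    apply Rmult_le_compat_r; [apply Rabs_pos|].
    apply Rmult_le_compat_r; [apply Rabs_pos|].
    apply exp_le_compat. nra.
- apply moment_line; [exact Ht | lra].
Qed.

(** * Closed form of the Mittag-Leffler series *)

Definition ml_closed (w : C) (b : R) : C :=
  (RtoC (/ Gamma b) * (1 + w * CMoment (sinh_cut w) 0 b))%C.

Lemma Gamma_add_2 (b : R) : 0 < b -> Gamma (b + 2) = b * (b + 1) * Gamma b.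
Proof.
intros Hb. replace (b + 2) with (b + 1 + 1) by ring.
rewrite !Gamma_succ by lra. ring.
Qed.

(** The factor b (b + 1) in the recursion of the moment is Gamma (b + 2) / Gamma b, so division by
    [Gamma] splits off exactly one term of the series. *)
Lemma ml_closed_rec (w : C) (b : R) : 0 < b ->
  (ml_closed w b = RtoC (/ Gamma b) + w ^ 2 * ml_closed w (b + 2))%C.
Proof.
intros Hb. unfold ml_closed. generalize (CMoment_sinh_cut_rec w b Hb).
set (B0 := CMoment (sinh_cut w) 0 b). set (B2 := CMoment (sinh_cut w) 0 (b + 2)). intros H.
rewrite Gamma_add_2 by exact Hb. generalize (Gamma_pos b Hb). intros HG.
assert (Hn : RtoC (b * (b + 1)) <> 0).
{ intros E. apply RtoC_inj in E. nra. }
assert (HB : B0 = (RtoC (/ (b * (b + 1))) * (w + w ^ 2 * B2))%C).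
{ rewrite <- H, RtoC_inv by nra. field. exact Hn. }
rewrite HB, (Rinv_mult (b * (b + 1)) (Gamma b)), (RtoC_mult (/ (b * (b + 1)))). ring.
Qed.

(** Passing from n to n + 1 divides by x (x + 1) >= b (n + 1), where x = b + 2 n; the quotient is
    therefore dominated by (c / b)^n / (n! Gamma b). *)
Lemma pow_div_Gamma_lim (c b : R) : 0 <= c -> 0 < b ->
  is_lim_seq (fun n => c ^ n / Gamma (b + 2 * INR n)) 0.
Proof.
intros Hc Hb.
assert (Hpos : forall n, 0 < b + 2 * INR n) by (intros n; generalize (pos_INR n); lra).
apply (is_lim_seq_le_le (fun _ => 0) _ (fun n => / Gamma b * ((c / b) ^ n / INR (fact n)))).
- intros n. split.
  + apply Rdiv_le_0_compat; [now apply pow_le | apply Gamma_pos, Hpos].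
  + induction n as [|n IH].
    * simpl. rewrite Rmult_0_r, Rplus_0_r. right. field. apply Rgt_not_eq, Gamma_pos, Hb.
    * rewrite S_INR. replace (b + 2 * (INR n + 1)) with (b + 2 * INR n + 2) by ring.
      rewrite Gamma_add_2 by apply Hpos.
      set (x := b + 2 * INR n) in *.
      assert (Hx : b * INR (S n) <= x * (x + 1)).
      { rewrite S_INR. generalize (pos_INR n). unfold x. nra. }
      assert (HS : 0 < INR (S n)) by (apply lt_0_INR; lia).
      assert (Hx0 : 0 < x) by apply Hpos.
      replace (c ^ S n / (x * (x + 1) * Gamma x)) with (c ^ n / Gamma x * (c / (x * (x + 1)))).
      2:{ simpl. field. generalize (Gamma_pos x Hx0). intros. split; lra. }
      replace (/ Gamma b * ((c / b) ^ S n / INR (fact (S n))))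
        with (/ Gamma b * ((c / b) ^ n / INR (fact n)) * (c / (b * INR (S n)))).
      2:{ rewrite fact_simpl, mult_INR. simpl pow. field.
          generalize (INR_fact_neq_0 n) (Gamma_pos b Hb). intros. repeat split; lra. }
      apply Rmult_le_compat.
      -- apply Rdiv_le_0_compat; [now apply pow_le | now apply Gamma_pos].
      -- apply Rdiv_le_0_compat; [exact Hc | nra].
      -- exact IH.
      -- apply Rmult_le_compat_l; [exact Hc|]. apply Rinv_le_contravar; [nra | exact Hx].
- apply is_lim_seq_const.
- replace (Finite 0) with (Rbar_mult (/ Gamma b) 0) by (simpl; f_equal; ring).
  apply is_lim_seq_scal_l. apply is_lim_seq_Reals. apply cv_speed_pow_fact.
Qed.

Lemma ml_closed_partial_sum (w : C) (b : R) (n : nat) : 0 < b ->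
  (ml_closed w b = sum_n (G := C_AbelianGroup) (fun k => (w ^ 2) ^ k / RtoC (Gamma (2 * INR k + b))) n
    + (w ^ 2) ^ S n * ml_closed w (b + 2 * INR (S n)))%C.
Proof.
intros Hb. induction n as [|n IH].
- rewrite sum_O. simpl INR. rewrite Rmult_0_r, Rplus_0_l, Rmult_1_r.
  rewrite (ml_closed_rec w b Hb) at 1. rewrite RtoC_inv by (apply Rgt_not_eq, Gamma_pos, Hb).
  simpl. unfold Cdiv. ring.
- rewrite sum_Sn. change plus with Cplus. rewrite IH at 1.
  assert (Hp : 0 < b + 2 * INR (S n)) by (generalize (pos_INR (S n)); lra).
  rewrite (ml_closed_rec w _ Hp).
  rewrite (S_INR (S n)). replace (b + 2 * (INR (S n) + 1)) with (b + 2 * INR (S n) + 2) by ring.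
  replace (2 * INR (S n) + b) with (b + 2 * INR (S n)) by ring.
  rewrite RtoC_inv by (apply Rgt_not_eq, Gamma_pos, Hp).
  simpl (_ ^ S (S n))%C. unfold Cdiv. simpl. ring.
Qed.

Lemma Cmod_le_parts (z : C) (a b : R) : Rabs (Re z) <= a -> Rabs (Im z) <= b -> Cmod z <= a + b.
Proof.
intros Ha Hb.
replace z with (RtoC (Re z) + Ci * RtoC (Im z))%C.
- apply Rle_trans with (1 := Cmod_triangle _ _).
  rewrite Cmod_mult, Cmod_Ci, !Cmod_R. lra.
- destruct z. apply C_ext; simpl; unfold Re, Im; simpl; ring.
Qed.

Lemma ml_closed_bounded (w : C) : exists K, 0 <= K /\ forall b, 1 <= b -> Cmod (ml_closed w b) <= K / Gamma b.
Proof.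
destruct (ctame_sinh_cut w) as [H1 H2].
destruct (Moment_bounded _ H1) as [K1 HK1].
{ intros y Hy. now rewrite sinh_cut_ge_1. }
destruct (Moment_bounded _ H2) as [K2 HK2].
{ intros y Hy. now rewrite sinh_cut_ge_1. }
assert (HK : forall b, 1 <= b -> Cmod (CMoment (sinh_cut w) 0 b) <= K1 + K2).
{ intros b Hb. apply Cmod_le_parts; [now apply HK1 | now apply HK2]. }
exists (1 + Cmod w * (K1 + K2)). split.
- specialize (HK 1 ltac:(lra)). generalize (Cmod_ge_0 w) (Cmod_ge_0 (CMoment (sinh_cut w) 0 1)). nra.
- intros b Hb. unfold ml_closed. generalize (Gamma_pos b ltac:(lra)). intros HG.
  rewrite Cmod_mult, Cmod_R, Rabs_pos_eq by (left; now apply Rinv_0_lt_compat).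
  unfold Rdiv. rewrite Rmult_comm. apply Rmult_le_compat_r; [left; now apply Rinv_0_lt_compat|].
  apply Rle_trans with (1 := Cmod_triangle _ _). rewrite Cmod_mult, Cmod_1.
  specialize (HK b Hb). generalize (Cmod_ge_0 w). nra.
Qed.

(** After n + 1 terms the remainder is (w^2)^(n+1) times the closed form at b + 2 (n + 1), and the
    bound K / Gamma drives it to 0; [iota] then returns the limit. *)
Lemma mittag_leffler_closed (w : C) (b : R) : 0 < b -> mittag_leffler 2 b (w ^ 2)%C = ml_closed w b.
Proof.
intros Hb. unfold mittag_leffler, CSeries.
apply (iota_filterlim_locally (V := C_R_CompleteNormedModule)).
destruct (ml_closed_bounded w) as [K [HK HML]].
set (a := fun k : nat => ((w ^ 2) ^ k / RtoC (Gamma (2 * INR k + b)))%C).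
set (r := fun n : nat => ((w ^ 2) ^ S n * ml_closed w (b + 2 * INR (S n)))%C).
assert (Hs : forall n, sum_n (G := C_AbelianGroup) a n = (ml_closed w b - r n)%C).
{ intros n. assert (Hsub : forall s x y : C, x = (s + y)%C -> s = (x - y)%C) by (intros s x y ->; ring).
  apply Hsub. now apply ml_closed_partial_sum. }
assert (Hr : is_lim_seq (fun n => Cmod (r n)) 0).
{ apply (is_lim_seq_le_le (fun _ => 0) _ (fun n => K * (Cmod (w ^ 2) ^ S n / Gamma (b + 2 * INR (S n))))).
  - intros n. split; [apply Cmod_ge_0|]. unfold r. rewrite Cmod_mult, Cmod_pow.
    (* At least one step of length 2 has been made, so the argument lies in the range of [HML] for
       every b > 0. *)
    assert (Hn : 1 <= b + 2 * INR (S n)) by (rewrite S_INR; generalize (pos_INR n); lra).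
    specialize (HML _ Hn).
    apply Rmult_le_compat_l with (r := Cmod (w ^ 2) ^ S n) in HML; [|apply pow_le, Cmod_ge_0].
    apply Rle_trans with (1 := HML). right. unfold Rdiv. ring.
  - apply is_lim_seq_const.
  - replace (Finite 0) with (Rbar_mult K 0) by (simpl; f_equal; ring).
    apply is_lim_seq_scal_l.
    apply (is_lim_seq_incr_1 (fun n => Cmod (w ^ 2) ^ n / Gamma (b + 2 * INR n))).
    apply pow_div_Gamma_lim; [apply Cmod_ge_0 | exact Hb]. }
assert (Hpart : forall p : C -> R, (forall z, Rabs (p z) <= Cmod z) ->
  is_lim_seq (fun n => p (r n)) 0).
{ intros p Hp. apply (is_lim_seq_abs_0 (fun n => p (r n))).
  apply (is_lim_seq_le_le (fun _ => 0) _ (fun n => Cmod (r n))).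
  - intros n. split; [apply Rabs_pos | apply Hp].
  - apply is_lim_seq_const.
  - exact Hr. }
apply (filterlim_ext (fun n => (ml_closed w b - r n)%C)).
{ intros n. symmetry. apply Hs. }
apply (filterlim_C eventually).
- apply (is_lim_seq_ext (fun n => Re (ml_closed w b) - Re (r n)) _ (Re (ml_closed w b))).
  { intros n. reflexivity. }
  replace (Finite (Re (ml_closed w b))) with (Finite (Re (ml_closed w b) - 0)) by (f_equal; ring).
  apply is_lim_seq_minus'; [apply is_lim_seq_const | apply (Hpart Re), Re_le_Cmod].
- apply (is_lim_seq_ext (fun n => Im (ml_closed w b) - Im (r n)) _ (Im (ml_closed w b))).
  { intros n. reflexivity. }
  replace (Finite (Im (ml_closed w b))) with (Finite (Im (ml_closed w b) - 0)) by (f_equal; ring).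
  apply is_lim_seq_minus'; [apply is_lim_seq_const | apply (Hpart Im), Im_le_Cmod].
Qed.

(** The k-th derivative of [Gamma] on b > 0; in particular [GammaD 1 1] is Gamma'(1), minus Euler's
    constant. *)
Definition GammaD (k : nat) : R -> R := Moment (fun y => exp (- y)) k.

(** The Leibniz rule for 1 / Gamma times 1 + w B. At 1 the factor 1 / Gamma has value 1, first
    derivative - Gamma'(1) and second derivative 2 Gamma'(1)^2 - Gamma''(1), while 1 + w B(1) = cosh
    w. *)
Lemma is_derive2_mittag_leffler (w : C) :
  is_derive2 (fun b => mittag_leffler 2 b (w ^ 2)%C) 1
    (RtoC (2 * GammaD 1 1 ^ 2 - GammaD 2 1) * Ccosh w
     - RtoC (2 * GammaD 1 1) * (w * CMoment (sinh_cut w) 1 1)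
     + w * CMoment (sinh_cut w) 2 1)%C.
Proof.
set (B := CMoment (sinh_cut w)).
assert (HD : forall k b, 0 < b -> is_derive (GammaD k) b (GammaD (S k) b)).
{ intros. apply is_derive_Moment; [apply tame_exp_neg | assumption]. }
assert (HP : forall b, 0 < b -> 0 < GammaD 0 b).
{ intros b Hb. unfold GammaD. rewrite <- Gamma_Moment by exact Hb. now apply Gamma_pos. }
assert (HB : forall k b, 0 < b -> cderive (fun b => w * B k b)%C b (w * B (S k) b)%C).
{ intros k b Hb. apply cderive_scal. apply cderive_CMoment; [apply ctame_sinh_cut | exact Hb]. }
set (g1 := fun b => - GammaD 1 b / GammaD 0 b ^ 2).
assert (Hg : forall b, 0 < b -> is_derive (fun b => / GammaD 0 b) b (g1 b)).
{ intros b Hb. apply is_derive_inv; [now apply HD | apply Rgt_not_eq, HP, Hb]. }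
assert (Hg1 : is_derive g1 1 (2 * GammaD 1 1 ^ 2 - GammaD 2 1)).
{ unfold g1.
  assert (H0 := HD 0%nat 1 Rlt_0_1). assert (H1 := HD 1%nat 1 Rlt_0_1).
  assert (E : GammaD 0 1 = 1).
  { unfold GammaD. rewrite <- Gamma_Moment by lra. apply Gamma_1. }
  auto_derive.
  - repeat split; [eexists; exact H1 | eexists; exact H0 | rewrite E; lra].
  - replace (Derive (fun x => GammaD 0 x) 1) with (GammaD 1 1) by (symmetry; apply is_derive_unique, H0).
    replace (Derive (fun x => GammaD 1 x) 1) with (GammaD 2 1) by (symmetry; apply is_derive_unique, H1).
    rewrite E. field. }
assert (Hf : forall b, 0 < b -> cderive (ml_closed w) b
  (RtoC (g1 b) * (1 + w * B 0%nat b) + RtoC (/ GammaD 0 b) * (w * B 1%nat b))%C).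
{ intros b Hb.
  assert (H : cderive (fun b => RtoC (/ GammaD 0 b) * (1 + w * B 0%nat b))%C b
    (RtoC (g1 b) * (1 + w * B 0%nat b) + RtoC (/ GammaD 0 b) * (w * B 1%nat b))%C).
  { apply (cderive_mult (fun b => RtoC (/ GammaD 0 b)) (fun b => 1 + w * B 0%nat b)%C).
    - apply (cderive_real (fun b => / GammaD 0 b)). now apply Hg.
    - apply (cderive_eq _ _ (0 + w * B 1%nat b)%C); [ring|].
      apply cderive_plus; [apply cderive_const | now apply HB]. }
  destruct H as [H1 H2].
  split; (eapply is_derive_ext_loc; [|eassumption]);
  exists (mkposreal b Hb); intros y Hy; apply Rabs_lt_between in Hy; simpl in Hy;
  unfold minus, plus, opp in Hy; simpl in Hy; unfold ml_closed, GammaD; rewrite Gamma_Moment by lra; reflexivity. }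
exists (fun b => RtoC (g1 b) * (1 + w * B 0%nat b) + RtoC (/ GammaD 0 b) * (w * B 1%nat b))%C.
split.
- exists (mkposreal 1 Rlt_0_1). intros b Hb.
  assert (Hb0 : 0 < b).
  { apply Rabs_lt_between in Hb; simpl in Hb; unfold minus, plus, opp in Hb; simpl in Hb. lra. }
  apply (is_derive_ext_loc (V := C_R_NormedModule) (ml_closed w)).
  + exists (mkposreal b Hb0). intros c Hc. symmetry. apply mittag_leffler_closed.
    apply Rabs_lt_between in Hc; simpl in Hc; unfold minus, plus, opp in Hc; simpl in Hc. lra.
  + apply is_derive_C. now apply Hf.
- apply is_derive_C.
  refine (cderive_eq _ _ _ _ _ (cderive_plus _ _ _ _ _
    (cderive_mult _ _ _ _ _ (cderive_real _ _ _ Hg1)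
      (cderive_plus _ _ _ _ _ (cderive_const 1 1) (HB 0%nat 1 Rlt_0_1)))
    (cderive_mult _ _ _ _ _ (cderive_real _ _ _ (Hg 1 Rlt_0_1)) (HB 1%nat 1 Rlt_0_1)))).
  assert (E : GammaD 0 1 = 1).
  { unfold GammaD. rewrite <- Gamma_Moment by lra. apply Gamma_1. }
  unfold B at 1. rewrite CMoment_sinh_cut_1. unfold g1. rewrite E.
  replace (- GammaD 1 1 / 1 ^ 2) with (- GammaD 1 1) by field. rewrite Rinv_1.
  rewrite (RtoC_mult 2 (GammaD 1 1)), RtoC_opp. ring.
Qed.

(** * Asymptotics of cosine primitives *)

Lemma Rabs_sin_le (x : R) : Rabs (sin x) <= Rabs x.
Proof.
assert (Hp : forall y, 0 < y -> Rabs (sin y) <= y).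
{ intros y Hy. apply Rabs_le_between. split; [|left; now apply sin_lt_x].
  destruct (Rle_dec y PI) as [H|H].
  - generalize (sin_ge_0 y ltac:(lra) H). lra.
  - generalize (SIN_bound y) PI2_3_2. intros. unfold PI2 in *. lra. }
destruct (Rtotal_order x 0) as [H|[H|H]].
- rewrite <- (Rabs_Ropp (sin x)), <- sin_neg, <- (Rabs_Ropp x), (Rabs_pos_eq (- x)) by lra. apply Hp; lra.
- subst. rewrite sin_0. lra.
- rewrite (Rabs_pos_eq x) by lra. now apply Hp.
Qed.

Lemma Rabs_cos_minus_1_le (x : R) : Rabs (cos x - 1) <= x ^ 2 / 2.
Proof.
replace (cos x - 1) with (- (2 * sin (x / 2) * sin (x / 2))).
2:{ replace x with (2 * (x / 2)) at 3 by field. rewrite cos_2a_sin. ring. }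
rewrite Rabs_Ropp, !Rabs_mult, (Rabs_pos_eq 2) by lra.
generalize (Rabs_sin_le (x / 2)) (Rabs_pos (sin (x / 2))). intros.
rewrite Rmult_assoc.
apply Rle_trans with (2 * (Rabs (x / 2) * Rabs (x / 2))).
- apply Rmult_le_compat_l; [lra|]. apply Rmult_le_compat; lra.
- rewrite <- Rabs_mult, Rabs_pos_eq by nra. lra.
Qed.

(** Admits both m = 1 and m = ln: since (cos (y v) - 1) / v is O(v), only v m(v) has to be
    continuous at 0. *)
Definition weight (m : R -> R) : Prop :=
  (forall v, v <> 0 -> continuous m v) /\ continuous (fun v => v * m v) 0.

Definition cos_kernel (m : R -> R) (y v : R) : R := (cos (y * v) - 1) / v * m v.

(** Division by zero is harmless here: the numerator vanishes, and for a [weight] the value 0 is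
    also the limit of the kernel. *)
Lemma cos_kernel_0 (m : R -> R) (y : R) : cos_kernel m y 0 = 0.
Proof. unfold cos_kernel. rewrite Rmult_0_r, cos_0, Rminus_diag. unfold Rdiv. ring. Qed.

Lemma cos_kernel_bound (m : R -> R) (y v : R) :
  Rabs (cos_kernel m y v) <= y ^ 2 * Rabs (v * m v).
Proof.
destruct (Req_dec v 0) as [->|Hv].
- rewrite cos_kernel_0, Rabs_R0. apply Rmult_le_pos; [apply pow2_ge_0 | apply Rabs_pos].
- unfold cos_kernel, Rdiv. rewrite !Rabs_mult, Rabs_inv.
  assert (Hav : 0 < Rabs v) by now apply Rabs_pos_lt.
  rewrite <- Rmult_assoc. apply Rmult_le_compat_r; [apply Rabs_pos|].
  apply Rmult_le_reg_r with (1 := Hav). rewrite Rmult_assoc, Rinv_l, Rmult_1_r by lra.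
  apply Rle_trans with (1 := Rabs_cos_minus_1_le _).
  rewrite Rmult_assoc, <- Rabs_mult, Rabs_pos_eq by nra.
  rewrite Rpow_mult_distr. nra.
Qed.

(** Joint continuity is what the exchange of integrals rests on. Away from v = 0 it follows by
    composition; at v = 0 the kernel is squeezed. *)
Lemma cos_kernel_continuity_2d (m phi : R -> R) (y v : R) :
  weight m -> (forall y, continuous phi y) ->
  continuity_2d_pt (fun y v => phi y * cos_kernel m y v) y v.
Proof.
intros [Hm Hm0] Hphi.
assert (Hphi2 : continuity_2d_pt (fun y _ => phi y) y v).
{ apply (continuity_1d_2d_pt_comp phi (fun y _ => y)).
  - apply continuity_pt_filterlim, Hphi.
  - apply continuity_2d_pt_id1. }
destruct (Req_dec v 0) as [->|Hv].
2:{ apply continuity_2d_pt_mult; [exact Hphi2|]. unfold cos_kernel.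
  apply continuity_2d_pt_mult; [apply continuity_2d_pt_mult|].
  + apply continuity_2d_pt_minus; [|apply continuity_2d_pt_const].
    apply (continuity_1d_2d_pt_comp cos (fun y v => y * v)).
    * apply continuity_cos.
    * apply continuity_2d_pt_mult; [apply continuity_2d_pt_id1 | apply continuity_2d_pt_id2].
  + apply continuity_2d_pt_inv; [apply continuity_2d_pt_id2 | exact Hv].
  + apply (continuity_1d_2d_pt_comp m (fun _ v => v)).
    * apply continuity_pt_filterlim, Hm, Hv.
    * apply continuity_2d_pt_id2. }
(* In absolute value this dominates the kernel; it is continuous and vanishes at v = 0, so its
   modulus of continuity there serves for both. *)
assert (HG : continuity_2d_pt (fun y v => phi y * (y * y * (v * m v))) y 0).
  { apply continuity_2d_pt_mult; [exact Hphi2|].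
    apply continuity_2d_pt_mult.
    - apply continuity_2d_pt_mult; apply continuity_2d_pt_id1.
    - apply (continuity_1d_2d_pt_comp (fun v => v * m v) (fun _ v => v)).
      + apply continuity_pt_filterlim, Hm0.
      + apply continuity_2d_pt_id2. }
  intros eps. destruct (HG eps) as [d Hd]. exists d. intros u w Hu Hw.
  specialize (Hd u w Hu Hw). rewrite cos_kernel_0, Rmult_0_r, Rminus_0_r.
  apply Rle_lt_trans with (2 := Hd).
  replace (phi u * (u * u * (w * m w)) - phi y * (y * y * (0 * m 0)))
    with (phi u * (u ^ 2 * (w * m w))) by ring.
  rewrite !Rabs_mult. apply Rmult_le_compat_l; [apply Rabs_pos|].
  rewrite <- Rabs_mult, (Rabs_pos_eq (u ^ 2)) by apply pow2_ge_0.
  apply cos_kernel_bound.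
Qed.

Lemma continuous_const_1 (y : R) : continuous (fun _ : R => 1) y.
Proof. apply continuous_const. Qed.

Lemma continuity_2d_snd (f : R -> R -> R) (y v : R) :
  continuity_2d_pt f y v -> continuous (f y) v.
Proof.
intros H. apply continuity_pt_filterlim. 
intros eps Heps. destruct (H (mkposreal eps Heps)) as [d Hd].
exists d. split; [apply cond_pos|]. intros w [_ Hw]. simpl in Hw |- *. unfold R_dist in *.
apply Hd; [rewrite Rminus_diag, Rabs_R0; apply cond_pos | exact Hw].
Qed.

Lemma continuity_2d_fst (f : R -> R -> R) (y v : R) :
  continuity_2d_pt f y v -> continuous (fun y => f y v) y.
Proof.
intros H. apply continuity_pt_filterlim. 
intros eps Heps. destruct (H (mkposreal eps Heps)) as [d Hd].
exists d. split; [apply cond_pos|]. intros w [_ Hw]. simpl in Hw |- *. unfold R_dist in *.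
apply Hd; [exact Hw | rewrite Rminus_diag, Rabs_R0; apply cond_pos].
Qed.

Lemma cos_kernel_continuous (m : R -> R) (y v : R) :
  weight m -> continuous (cos_kernel m y) v.
Proof.
intros Hm. apply (continuous_ext (fun v => 1 * cos_kernel m y v)); [intros; apply Rmult_1_l|].
apply (continuity_2d_snd (fun y v => 1 * cos_kernel m y v)).
apply (cos_kernel_continuity_2d m (fun _ => 1)); [exact Hm | apply continuous_const_1].
Qed.

Lemma ex_RInt_cos_kernel (m : R -> R) (y a b : R) : weight m -> ex_RInt (cos_kernel m y) a b.
Proof.
intros Hm. apply (ex_RInt_continuous (V := R_CompleteNormedModule)).
intros; now apply cos_kernel_continuous.
Qed.

Lemma weight_1 : weight (fun _ => 1).
Proof.
split.
- intros; apply continuous_const.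
- apply ex_derive_R_continuous. auto_derive. trivial.
Qed.

Lemma ln_abs_le (v : R) : 0 < v <= 1 -> Rabs (ln v) <= 2 * exp (- (1 / 2) * ln v).
Proof.
intros Hv.
assert (Hl : ln v <= 0) by (rewrite <- ln_1; apply ln_le; lra).
rewrite Rabs_left1 by exact Hl.
generalize (pow_le_fact_exp (- (1 / 2) * ln v) 1 ltac:(lra)). simpl. lra.
Qed.

Lemma ln_nonpos (v : R) : v <= 0 -> ln v = 0.
Proof. intros Hv. unfold ln. destruct (Rlt_dec 0 v); [exfalso; lra | reflexivity]. Qed.

Lemma exp_half_ln_sq (v : R) : 0 < v -> exp (1 / 2 * ln v) * exp (1 / 2 * ln v) = v.
Proof.
intros Hv. rewrite <- exp_plus. replace (1 / 2 * ln v + 1 / 2 * ln v) with (ln v) by field.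
now apply exp_ln.
Qed.

Lemma mult_ln_abs_le (v : R) : 0 < v <= 1 -> Rabs (v * ln v) <= 2 * exp (1 / 2 * ln v).
Proof.
intros Hv. rewrite Rabs_mult, Rabs_pos_eq by lra.
generalize (ln_abs_le v Hv). intros H.
apply Rmult_le_compat_l with (r := v) in H; [|lra].
apply Rle_trans with (1 := H). right.
rewrite <- (exp_half_ln_sq v) at 1 by lra.
replace (- (1 / 2) * ln v) with (- (1 / 2 * ln v)) by ring.
rewrite exp_Ropp. field. apply Rgt_not_eq, exp_pos.
Qed.

Lemma weight_ln : weight ln.
Proof.
split.
{ intros v Hv. destruct (Rlt_dec 0 v) as [H|H]; [now apply continuous_ln|].
  (* To the left of 0 the function [ln] is constantly 0 by convention. *)
  apply (continuous_ext_loc _ (fun _ => 0)); [|apply continuous_const].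
  assert (Hv' : 0 < - v) by lra. exists (mkposreal _ Hv'). intros u Hu. symmetry. apply ln_nonpos.
  apply Rabs_lt_between in Hu; simpl in Hu; unfold minus, plus, opp in Hu; simpl in Hu. lra. }
apply continuity_pt_filterlim. intros eps Heps.
(* As |v ln v| <= 2 v^(1/2) on (0, 1], a radius of (eps / 4)^2 keeps it below eps. *)
assert (H4 : 0 < (eps / 4) ^ 2) by (apply pow_lt; lra).
generalize (Rmin_l 1 ((eps / 4) ^ 2)) (Rmin_r 1 ((eps / 4) ^ 2)) (Rmin_pos _ _ Rlt_0_1 H4).
set (d := Rmin 1 ((eps / 4) ^ 2)). intros Hd1 Hd2 Hd.
exists d. split; [exact Hd|].
intros v [_ Hv]. simpl in Hv |- *. unfold R_dist in *.
rewrite Rminus_0_r in Hv. rewrite Rmult_0_l, Rminus_0_r.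
destruct (Rle_dec v 0) as [H|H].
- rewrite ln_nonpos, Rmult_0_r, Rabs_R0 by exact H. exact Heps.
- rewrite Rabs_pos_eq in Hv by lra.
  apply Rle_lt_trans with (1 := mult_ln_abs_le v ltac:(lra)).
  generalize (exp_half_ln_sq v ltac:(lra)) (exp_pos (1 / 2 * ln v)). intros. nra.
Qed.

(** For m = 1 this is - Cin, where Cin x = int_0^x (1 - cos t) / t dt; the classical Cin x = gamma +
    log x - Ci x explains the asymptotics sought below. *)
Definition cos_prim (m : R -> R) (x : R) : R := RInt (cos_kernel m 1) 0 x.

Definition cos_transform (m : R -> R) (r y : R) : R := RInt (cos_kernel m y) 0 r.

Lemma cos_transform_1 (r y : R) : 0 <= r -> 0 < y ->
  cos_transform (fun _ => 1) r y = cos_prim (fun _ => 1) (y * r).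
Proof.
intros Hr Hy. unfold cos_prim, cos_transform.
replace (RInt (cos_kernel (fun _ => 1) 1) 0 (y * r))
  with (RInt (cos_kernel (fun _ => 1) 1) (y * 0 + 0) (y * r + 0)) by (f_equal; ring).
rewrite <- (RInt_comp_lin (V := R_CompleteNormedModule) (cos_kernel (fun _ => 1) 1) y 0 0 r).
- apply RInt_ext. rewrite Rmin_left, Rmax_right by lra. intros v Hv.
  unfold cos_kernel, scal; simpl; unfold mult; simpl. rewrite Rplus_0_r, Rmult_1_l. field. lra.
- apply ex_RInt_cos_kernel, weight_1.
Qed.

(** Scaling v -> y v, where log (y v) = log y + log v produces the additional term. Asymptotics in r
    thus reduce to those of two functions of one variable. *)
Lemma cos_transform_ln (r y : R) : 0 <= r -> 0 < y ->
  cos_transform ln r y = cos_prim ln (y * r) - ln y * cos_prim (fun _ => 1) (y * r).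
Proof.
intros Hr Hy. rewrite <- cos_transform_1 by assumption.
assert (H : cos_prim ln (y * r) = cos_transform ln r y + ln y * cos_transform (fun _ => 1) r y); [|lra].
unfold cos_prim, cos_transform.
assert (He : forall m, weight m -> ex_RInt (cos_kernel m y) 0 r).
{ intros m Hm. now apply ex_RInt_cos_kernel. }
transitivity (RInt (fun v => plus (cos_kernel ln y v) (scal (ln y) (cos_kernel (fun _ => 1) y v))) 0 r).
- replace (RInt (cos_kernel ln 1) 0 (y * r))
    with (RInt (cos_kernel ln 1) (y * 0 + 0) (y * r + 0)) by (f_equal; ring).
  rewrite <- (RInt_comp_lin (V := R_CompleteNormedModule) (cos_kernel ln 1) y 0 0 r).
  + apply RInt_ext. rewrite Rmin_left, Rmax_right by lra. intros v Hv.
    unfold cos_kernel, scal, plus; simpl; unfold mult; simpl.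
    rewrite Rplus_0_r, Rmult_1_l, ln_mult by lra. field. lra.
  + apply ex_RInt_cos_kernel, weight_ln.
- rewrite (RInt_plus (V := R_CompleteNormedModule)).
  + rewrite (RInt_scal (V := R_CompleteNormedModule)); [reflexivity|]. apply He, weight_1.
  + apply He, weight_ln.
  + apply (ex_RInt_scal (V := R_CompleteNormedModule)). apply He, weight_1.
Qed.

Lemma is_derive_cos_prim (m : R -> R) (x : R) :
  weight m -> is_derive (cos_prim m) x (cos_kernel m 1 x).
Proof.
intros Hm. apply (exists_antiderivative (cos_kernel m 1)). intros; now apply cos_kernel_continuous.
Qed.

Lemma cos_prim_small (m : R -> R) (x : R) :
  weight m -> (forall v, 0 < v <= 1 -> Rabs (v * m v) <= 2) -> 0 < x <= 1 ->
  Rabs (cos_prim m x) <= 2.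
Proof.
intros Hm Hb Hx. unfold cos_prim.
apply Rle_trans with ((x - 0) * 2).
- apply abs_RInt_le_const; [lra | |].
  + now apply ex_RInt_cos_kernel.
  + intros v Hv. apply Rle_trans with (1 := cos_kernel_bound m 1 v).
    destruct (Req_dec v 0) as [->|Hv0].
    * rewrite Rmult_0_l, Rabs_R0. lra.
    * generalize (Hb v ltac:(lra)). lra.
- lra.
Qed.

Lemma is_lim_inv_p : is_lim (fun x => / x) p_infty 0.
Proof.
apply (is_lim_inv (fun x => x) p_infty p_infty); [apply is_lim_id | discriminate].
Qed.

Lemma is_lim_ln_div : is_lim (fun x => ln x / x) p_infty 0.
Proof. apply is_lim_div_ln_p. Qed.

Lemma exp_half_le (x : R) : 1 <= x -> / x <= exp (- (1 / 2) * ln x) /\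
  ln x / x <= 2 * exp (- (1 / 2) * ln x).
Proof.
intros Hx.
assert (Hl : 0 <= ln x) by (rewrite <- ln_1; apply ln_le; lra).
assert (Hi : / x = exp (- ln x)) by (rewrite exp_Ropp, exp_ln; lra).
split.
- rewrite Hi. apply exp_le_compat. lra.
- change (ln x / x) with (ln x * / x). rewrite Hi.
  replace (- ln x) with (- (1 / 2) * ln x + - (1 / 2 * ln x)) by field.
  generalize (pow_le_fact_exp (1 / 2 * ln x) 1 ltac:(lra)). simpl. intros H.
  rewrite exp_plus, (exp_Ropp (1 / 2 * ln x)).
  set (s := exp (- (1 / 2) * ln x)). assert (Hs : 0 < s) by apply exp_pos.
  set (t := exp (1 / 2 * ln x)) in *. assert (Ht : 0 < t) by apply exp_pos.
  apply Rmult_le_reg_r with (1 := Ht).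
  replace (ln x * (s * / t) * t) with (ln x * s) by (field; lra). nra.
Qed.

(* [exp (- (1 / 2) * ln x)] stands for [x ^ (-1/2)]: a decay rate valid on all of (0, oo),
   near 0 as well as at infinity. *)
Definition cos_prim_1_asymptotic (g K : R) : Prop := forall x, 0 < x ->
  Rabs (cos_prim (fun _ => 1) x + ln x + g) <= K * exp (- (1 / 2) * ln x).

Definition cos_prim_ln_asymptotic (c K : R) : Prop := forall x, 0 < x ->
  Rabs (cos_prim ln x + ln x ^ 2 / 2 - c) <= K * exp (- (1 / 2) * ln x).

(** Subtracting sin x / x integrates cos t / t by parts: the derivative left over, sin x / x^2, has
    a tail of at most 1 / x. For x < 1 crude bounds suffice, as x^(-1/2) >= 1 and |log x| <= 2
    x^(-1/2). *)
Lemma ex_cos_prim_1_asymptotic : exists g K, cos_prim_1_asymptotic g K.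
Proof.
set (E := fun x => cos_prim (fun _ => 1) x + ln x - sin x / x).
assert (HE : forall x, 0 < x -> is_derive E x (sin x / x ^ 2)).
{ intros x Hx.
  replace (sin x / x ^ 2) with (cos_kernel (fun _ => 1) 1 x + (/ x - (cos x * x - sin x) / x ^ 2)).
  2:{ unfold cos_kernel. rewrite Rmult_1_l. field. lra. }
  apply (is_derive_ext (fun x => plus (cos_prim (fun _ => 1) x) (ln x - sin x / x))).
  { intros t. unfold plus, E; simpl. ring. }
  apply (is_derive_plus (V := R_NormedModule)).
  - apply is_derive_cos_prim, weight_1.
  - auto_derive; [split; lra|]. field. lra. }
destruct (limit_of_tail E Rinv) as [l [_ Hl]].
- intros x y Hxy. apply Rle_trans with (- / y - - / x).
  + apply (increment_bound E (fun x => - / x) (fun x => sin x / x ^ 2) (fun x => / x ^ 2)); [lra | | |].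
    * intros; apply HE; lra.
    * intros; auto_derive; [lra | field; lra].
    * intros z Hz. unfold Rdiv. rewrite Rabs_mult, (Rabs_pos_eq (/ z ^ 2)).
      -- generalize (SIN_bound z). intros Hs. assert (Rabs (sin z) <= 1) by (apply Rabs_le_between; lra).
         assert (0 < / z ^ 2) by (apply Rinv_0_lt_compat, pow_lt; lra). nra.
      -- left. apply Rinv_0_lt_compat, pow_lt; lra.
  + assert (0 < / y) by (apply Rinv_0_lt_compat; lra). lra.
- exact is_lim_inv_p.
- exists (- l), (4 + Rabs l). intros x Hx.
  destruct (Rle_dec 1 x) as [H1|H1].
  + destruct (exp_half_le x H1) as [Hi _].
    replace (cos_prim (fun _ => 1) x + ln x + - l) with (E x - l + sin x * / x) by (unfold E, Rdiv; ring).
    apply Rle_trans with (1 := Rabs_triang _ _).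
    rewrite Rabs_mult, (Rabs_pos_eq (/ x)) by (left; apply Rinv_0_lt_compat; lra).
    assert (Hs : Rabs (sin x) <= 1) by (apply Rabs_le_between, SIN_bound).
    specialize (Hl x H1).
    assert (0 < / x) by (apply Rinv_0_lt_compat; lra). generalize (Rabs_pos l). nra.
  + generalize (ln_abs_le x ltac:(lra)).
    assert (Hc : Rabs (cos_prim (fun _ => 1) x) <= 2).
    { apply cos_prim_small; [apply weight_1 | | lra]. intros v Hv. rewrite Rmult_1_r, Rabs_pos_eq; lra. }
    assert (Hs : 1 <= exp (- (1 / 2) * ln x)).
    { rewrite <- exp_0 at 1. apply exp_le_compat.
      assert (ln x <= 0) by (rewrite <- ln_1; apply ln_le; lra). lra. }
    intros. apply Rle_trans with (1 := Rabs_triang _ _). rewrite Rabs_Ropp.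
    generalize (Rabs_triang (cos_prim (fun _ => 1) x) (ln x)) (Rabs_pos l). nra.
Qed.

(** The same integration by parts with a factor log t; the derivative left over is sin x (log x - 1)
    / x^2. *)
Lemma ex_cos_prim_ln_asymptotic : exists c K, cos_prim_ln_asymptotic c K.
Proof.
set (E := fun x => cos_prim ln x + ln x ^ 2 / 2 - sin x * ln x / x).
assert (HE : forall x, 0 < x -> is_derive E x (sin x * (ln x - 1) / x ^ 2)).
{ intros x Hx.
  replace (sin x * (ln x - 1) / x ^ 2) with
    (cos_kernel ln 1 x + (ln x / x - ((cos x * ln x + sin x / x) * x - sin x * ln x) / x ^ 2)).
  2:{ unfold cos_kernel. rewrite Rmult_1_l. field. lra. }
  apply (is_derive_ext (fun x => plus (cos_prim ln x) (ln x ^ 2 / 2 - sin x * ln x / x))).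
  { intros t. unfold plus, E; simpl. ring. }
  apply (is_derive_plus (V := R_NormedModule)).
  - apply is_derive_cos_prim, weight_ln.
  - auto_derive; [repeat split; lra|]. field. lra. }
assert (Hln : forall z, 1 <= z -> 0 <= ln z) by (intros; rewrite <- ln_1; apply ln_le; lra).
(* The tail bound is the integral of (1 + log t) / t^2 over (x, oo). *)
destruct (limit_of_tail E (fun x => (2 + ln x) / x)) as [l [_ Hl]].
- intros x y Hxy. apply Rle_trans with (- ((2 + ln y) / y) - - ((2 + ln x) / x)).
  + apply (increment_bound E (fun x => - ((2 + ln x) / x)) (fun x => sin x * (ln x - 1) / x ^ 2)
      (fun x => (1 + ln x) / x ^ 2)); [lra | | |].
    * intros; apply HE; lra.
    * intros; auto_derive; [split; lra | field; lra].
    * intros z Hz. specialize (Hln z ltac:(lra)).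
      assert (0 < / z ^ 2) by (apply Rinv_0_lt_compat, pow_lt; lra).
      unfold Rdiv. rewrite !Rabs_mult, (Rabs_pos_eq (/ z ^ 2)) by lra.
      apply Rmult_le_compat_r; [lra|].
      assert (Rabs (sin z) <= 1) by (apply Rabs_le_between, SIN_bound).
      assert (Rabs (ln z - 1) <= 1 + ln z) by (apply Rabs_le_between; lra).
      generalize (Rabs_pos (sin z)) (Rabs_pos (ln z - 1)). nra.
  + assert (0 <= (2 + ln y) / y); [|lra].
    specialize (Hln y ltac:(lra)). apply Rdiv_le_0_compat; lra.
- apply (is_lim_ext_loc (fun x => 2 * / x + ln x / x)).
  { exists 0. intros x Hx. field. lra. }
  replace (Finite 0) with (Finite (2 * 0 + 0)) by (f_equal; ring).
  apply is_lim_plus'; [|exact is_lim_ln_div].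
  apply (is_lim_scal_l Rinv 2 p_infty 0). exact is_lim_inv_p.
- exists l, (10 + Rabs l). intros x Hx.
  destruct (Rle_dec 1 x) as [H1|H1].
  + destruct (exp_half_le x H1) as [Hi Hi2].
    replace (cos_prim ln x + ln x ^ 2 / 2 - l) with (E x - l + sin x * (ln x / x)) by (unfold E, Rdiv; ring).
    apply Rle_trans with (1 := Rabs_triang _ _).
    assert (Hp : 0 <= ln x / x) by (apply Rdiv_le_0_compat; [now apply Hln | lra]).
    rewrite Rabs_mult, (Rabs_pos_eq (ln x / x) Hp).
    assert (Hs : Rabs (sin x) <= 1) by (apply Rabs_le_between, SIN_bound).
    specialize (Hl x H1).
    replace ((2 + ln x) / x) with (2 * / x + ln x / x) in Hl by (field; lra).
    generalize (Rabs_pos l) (exp_pos (- (1 / 2) * ln x)). nra.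
  + assert (Hc : Rabs (cos_prim ln x) <= 2).
    { apply cos_prim_small; [apply weight_ln | | lra]. intros v Hv.
      apply Rle_trans with (1 := mult_ln_abs_le v Hv).
      assert (exp (1 / 2 * ln v) <= 1); [|lra].
      apply Rle_trans with (exp 0); [|rewrite exp_0; lra]. apply exp_le_compat.
      assert (ln v <= 0) by (rewrite <- ln_1; apply ln_le; lra). lra. }
    assert (Hl0 : ln x <= 0) by (rewrite <- ln_1; apply ln_le; lra).
    assert (Hs : 1 <= exp (- (1 / 2) * ln x)).
    { rewrite <- exp_0 at 1. apply exp_le_compat. lra. }
    generalize (pow_le_fact_exp (- (1 / 2) * ln x) 2 ltac:(lra)). simpl fact. simpl INR.
    intros Hsq.
    assert (Hsq' : Rabs (ln x ^ 2 / 2) <= 4 * exp (- (1 / 2) * ln x)).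
    { rewrite Rabs_pos_eq; nra. }
    apply Rle_trans with (1 := Rabs_triang _ _). rewrite Rabs_Ropp.
    generalize (Rabs_triang (cos_prim ln x) (ln x ^ 2 / 2)) (Rabs_pos l). nra.
Qed.

(** * Cosine transforms *)

Lemma RInt_continuous_param (f : R -> R -> R) (c d y : R) :
  c <= d -> (forall y v, continuity_2d_pt f y v) -> continuous (fun y => RInt (f y) c d) y.
Proof.
intros Hcd Hf. apply continuity_pt_filterlim. intros eps Heps.
assert (Hex : forall u, ex_RInt (f u) c d).
{ intros u. apply (ex_RInt_continuous (V := R_CompleteNormedModule)).
  intros v _. now apply continuity_2d_snd. }
assert (He : 0 < eps / (d - c + 1)) by (apply Rdiv_lt_0_compat; lra).
destruct (uniform_continuity_2d f (y - 1) (y + 1) c d (fun u v _ _ => Hf u v) (mkposreal _ He)) as [del Hdel].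
exists (Rmin 1 del). split; [apply Rmin_pos; [lra | apply cond_pos]|].
intros u [_ Hu]. simpl in Hu |- *. unfold R_dist in *.
assert (Hu1 : Rabs (u - y) < 1) by (eapply Rlt_le_trans; [exact Hu | apply Rmin_l]).
assert (Hu2 : Rabs (u - y) < del) by (eapply Rlt_le_trans; [exact Hu | apply Rmin_r]).
apply Rabs_lt_between in Hu1.
assert (Heq : RInt (f u) c d - RInt (f y) c d = RInt (fun v => f u v - f y v) c d).
{ symmetry. apply (RInt_minus (V := R_CompleteNormedModule) (f u) (f y)); apply Hex. }
rewrite Heq.
apply Rle_lt_trans with ((d - c) * (eps / (d - c + 1))).
- apply abs_RInt_le_const; [exact Hcd | |].
  + apply (ex_RInt_minus (V := R_CompleteNormedModule) (f u) (f y)); apply Hex.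
  + intros v Hv. left. apply (Hdel y v u v); try lra.
    rewrite Rminus_diag, Rabs_R0. apply cond_pos.
- apply Rmult_lt_reg_r with (d - c + 1); [lra|].
  replace ((d - c) * (eps / (d - c + 1)) * (d - c + 1)) with ((d - c) * eps) by (field; lra). nra.
Qed.

(** With F(y, v) the primitive of f in y from a, the function y -> int_c^d F(y, v) dv vanishes at a
    and, by differentiation under the integral, has derivative int_c^d f(y, v) dv. *)
Lemma RInt_Fubini (f : R -> R -> R) (a b c d : R) :
  c <= d -> (forall y v, continuity_2d_pt f y v) ->
  RInt (fun y => RInt (f y) c d) a b = RInt (fun v => RInt (fun y => f y v) a b) c d.
Proof.
intros Hcd Hf.
set (F := fun y v => RInt (fun z => f z v) a y).
assert (Hex : forall y v, is_derive (fun z => F z v) y (f y v)).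
{ intros y v. apply (is_derive_RInt (V := R_NormedModule) (fun z => f z v) (fun z => F z v) a y).
  - apply filter_forall. intros z. apply (RInt_correct (V := R_CompleteNormedModule)).
    apply (ex_RInt_continuous (V := R_CompleteNormedModule)).
    intros t _. apply (continuity_2d_fst f), Hf.
  - apply (continuity_2d_fst f), Hf. }
assert (HD : forall y, is_derive (fun y => RInt (F y) c d) y (RInt (f y) c d)).
{ intros y.
  replace (RInt (f y) c d) with (RInt (fun t => Derive (fun u => F u t) y) c d).
  2:{ apply RInt_ext. intros v _. apply is_derive_unique, Hex. }
  apply (is_derive_RInt_param F c d y).
  - apply filter_forall. intros u t _. eexists. apply Hex.
  - intros t _. apply (continuity_2d_pt_ext f); [|apply Hf].
    intros u v. symmetry. apply is_derive_unique, Hex.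
  - apply filter_forall. intros u. apply (ex_RInt_continuous (V := R_CompleteNormedModule)).
    (* [RInt_continuous_param] expects ordered bounds, so an interval traversed backwards is
       reversed with a sign. *)
    intros v _. destruct (Rle_dec a u) as [H|H].
    + apply (RInt_continuous_param (fun v z => f z v) a u v H).
      intros y' v'. intros eps. destruct (Hf v' y' eps) as [del Hdel]. exists del. intros; now apply Hdel.
    + apply (continuous_ext (fun v => - RInt (fun z => f z v) u a)).
      { intros t. apply (opp_RInt_swap (V := R_CompleteNormedModule)).
        apply (ex_RInt_continuous (V := R_CompleteNormedModule)).
        intros s _. apply (continuity_2d_fst f), Hf. }
      apply (continuous_opp (V := R_NormedModule)).
      apply (RInt_continuous_param (fun v z => f z v) u a v); [lra|].
      intros y' v'. intros eps. destruct (Hf v' y' eps) as [del Hdel]. exists del. intros; now apply Hdel. }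
assert (H : is_RInt (fun y => RInt (f y) c d) a b (RInt (F b) c d - RInt (F a) c d)).
{ apply (is_RInt_derive (V := R_CompleteNormedModule) (fun y => RInt (F y) c d)).
  - intros; apply HD.
  - intros; now apply RInt_continuous_param. }
rewrite (is_RInt_unique (V := R_CompleteNormedModule) _ _ _ _ H).
replace (RInt (F a) c d) with 0; [apply Rminus_0_r|].
rewrite (RInt_ext (V := R_CompleteNormedModule) (F a) (fun _ => 0)).
- rewrite (RInt_const (V := R_CompleteNormedModule)). unfold scal; simpl; unfold mult; simpl. ring.
- intros v _. unfold F. apply (RInt_point (V := R_CompleteNormedModule)).
Qed.

Lemma cos_transform_mult (m phi : R -> R) (r y : R) : weight m ->
  phi y * cos_transform m r y = RInt (fun v => phi y * cos_kernel m y v) 0 r.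
Proof.
intros Hm. symmetry. apply (RInt_scal (V := R_CompleteNormedModule) (cos_kernel m y)).
now apply ex_RInt_cos_kernel.
Qed.

Lemma continuous_cos_transform (m phi : R -> R) (r y : R) :
  weight m -> 0 <= r -> (forall y, continuous phi y) ->
  continuous (fun y => phi y * cos_transform m r y) y.
Proof.
intros Hm Hr Hphi.
apply (continuous_ext (fun y => RInt (fun v => phi y * cos_kernel m y v) 0 r)).
{ intros z. symmetry. now apply cos_transform_mult. }
apply (RInt_continuous_param (fun y v => phi y * cos_kernel m y v)); [exact Hr|].
intros; now apply cos_kernel_continuity_2d.
Qed.

Lemma continuous_weight_mult (m : R -> R) (v : R) :
  weight m -> continuous (fun v => v * m v) v.
Proof.
intros [H1 H2]. destruct (Req_dec v 0) as [->|Hv]; [exact H2|].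
apply (continuous_mult (K := R_AbsRing) (fun v => v) m); [apply continuous_id | now apply H1].
Qed.

(** The integrals over (0, Y) and (0, r) are exchanged, and then Y tends to infinity; [psi] is the
    limit of the inner integral. The factor v^2 in the error is essential: multiplied by m(v) / v it
    leaves v m(v), which is integrable on (0, r). *)
Lemma line_cos_transform (m phi psi eta : R -> R) (r : R) :
  weight m -> 0 <= r -> (forall y, continuous phi y) ->
  (forall Y v, 1 <= Y -> 0 <= v ->
    Rabs (RInt (fun y => phi y * (cos (y * v) - 1)) 0 Y - psi v) <= v ^ 2 * eta Y) ->
  is_lim eta p_infty 0 ->
  ex_RInt (fun v => psi v / v * m v) 0 r ->
  is_RInt_line (fun x => exp x * (phi (exp x) * cos_transform m r (exp x))) (RInt (fun v => psi v / v * m v) 0 r).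
Proof.
intros Hm Hr Hphi Hb Heta Hex.
apply (line_exp_subst (fun y => phi y * cos_transform m r y)).
{ intros; now apply continuous_cos_transform. }
set (h := fun y => phi y * cos_transform m r y).
set (M := RInt (fun v => Rabs (v * m v)) 0 r).
assert (HexM : ex_RInt (fun v => Rabs (v * m v)) 0 r).
{ apply (ex_RInt_continuous (V := R_CompleteNormedModule)). intros v _.
  apply continuous_Rabs_comp. now apply continuous_weight_mult. }
assert (Hdiff : forall Y, 1 <= Y -> Rabs (RInt h 0 Y - RInt (fun v => psi v / v * m v) 0 r) <= M * eta Y).
{ intros Y HY.
  assert (Hker : forall v y, continuous (fun y => phi y * cos_kernel m y v) y).
  { intros v y. apply (continuity_2d_fst (fun y v => phi y * cos_kernel m y v)).
    now apply cos_kernel_continuity_2d. }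
  assert (E : RInt h 0 Y = RInt (fun v => RInt (fun y => phi y * cos_kernel m y v) 0 Y) 0 r).
  { rewrite <- RInt_Fubini; [|exact Hr | intros; now apply cos_kernel_continuity_2d].
    apply RInt_ext. intros y _. now apply cos_transform_mult. }
  assert (Hex1 : ex_RInt (fun v => RInt (fun y => phi y * cos_kernel m y v) 0 Y) 0 r).
  { apply (ex_RInt_continuous (V := R_CompleteNormedModule)). intros v _.
    apply (RInt_continuous_param (fun v y => phi y * cos_kernel m y v) 0 Y v); [lra|].
    intros y' v'. intros eps.
    destruct (cos_kernel_continuity_2d m phi v' y' Hm Hphi eps) as [del Hdel].
    exists del. intros; now apply Hdel. }
  rewrite E.
  assert (Em : RInt (fun v => RInt (fun y => phi y * cos_kernel m y v) 0 Y) 0 r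
     - RInt (fun v => psi v / v * m v) 0 r =
     RInt (fun v => RInt (fun y => phi y * cos_kernel m y v) 0 Y - psi v / v * m v) 0 r).
  { symmetry. apply (RInt_minus (V := R_CompleteNormedModule)); assumption. }
  rewrite Em.
  replace (M * eta Y) with (RInt (fun v => eta Y * Rabs (v * m v)) 0 r).
  2:{ rewrite (Rmult_comm M). apply (RInt_scal (V := R_CompleteNormedModule)). exact HexM. }
  apply (norm_RInt_le (V := R_NormedModule) (fun v => RInt (fun y => phi y * cos_kernel m y v) 0 Y - psi v / v * m v)
    (fun v => eta Y * Rabs (v * m v)) 0 r); [exact Hr | | |].
  - intros v Hv. change (Rabs (RInt (fun y => phi y * cos_kernel m y v) 0 Y - psi v / v * m v) <= eta Y * Rabs (v * m v)).
    assert (Ev : RInt (fun y => phi y * cos_kernel m y v) 0 Y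
      = m v / v * RInt (fun y => phi y * (cos (y * v) - 1)) 0 Y).
    { transitivity (RInt (V := R_CompleteNormedModule)
        (fun y => scal (m v / v) (phi y * (cos (y * v) - 1))) 0 Y).
      - apply RInt_ext. intros y _. unfold cos_kernel, scal; simpl; unfold mult; simpl. unfold Rdiv. ring.
      - apply (RInt_scal (V := R_CompleteNormedModule)).
        apply (ex_RInt_continuous (V := R_CompleteNormedModule)). intros z _.
        apply (continuous_mult (K := R_AbsRing) phi (fun y => cos (y * v) - 1)); [apply Hphi|].
        apply ex_derive_R_continuous. auto_derive. trivial. }
    rewrite Ev.
    replace (m v / v * RInt (fun y => phi y * (cos (y * v) - 1)) 0 Y - psi v / v * m v)
      with (m v / v * (RInt (fun y => phi y * (cos (y * v) - 1)) 0 Y - psi v)) by (unfold Rdiv; ring).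
    rewrite Rabs_mult.
    specialize (Hb Y v HY (proj1 Hv)).
    (* At v = 0 the hypothesis forces the difference to be 0, whatever value m 0 / 0 has. *)
    destruct (Req_dec v 0) as [->|Hv0].
    + replace (0 ^ 2 * eta Y) with 0 in Hb by ring.
      rewrite Rmult_0_l, Rabs_R0, Rmult_0_r. generalize (Rabs_pos (m 0 / 0)). nra.
    + apply Rle_trans with (Rabs (m v / v) * (v ^ 2 * eta Y)).
      * apply Rmult_le_compat_l; [apply Rabs_pos | exact Hb].
      * right. unfold Rdiv. rewrite !Rabs_mult, Rabs_inv, (Rabs_pos_eq v) by lra. field. lra.
  - apply (RInt_correct (V := R_CompleteNormedModule)).
    apply (ex_RInt_minus (V := R_CompleteNormedModule)); assumption.
  - apply (RInt_correct (V := R_CompleteNormedModule)).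
    apply (ex_RInt_scal (V := R_CompleteNormedModule)). exact HexM. }
apply (is_lim_ext_loc (fun Y => RInt (fun v => psi v / v * m v) 0 r +
   (RInt h 0 Y - RInt (fun v => psi v / v * m v) 0 r))).
{ exists 0. intros; ring. }
set (L := RInt (fun v => psi v / v * m v) 0 r) in *.
replace (Finite L) with (Finite (L + 0)) by (f_equal; ring).
apply is_lim_plus'; [apply is_lim_const|].
apply (is_lim_le_le_loc (fun Y => - (M * eta Y)) (fun Y => M * eta Y)).
- exists 1. intros Y HY. apply Rabs_le_between. apply Hdiff. lra.
- replace (Finite 0) with (Rbar_opp (Rbar_mult M 0)) by (simpl; f_equal; ring).
  apply is_lim_opp, is_lim_scal_l, Heta.
- replace (Finite 0) with (Rbar_mult M 0) by (simpl; f_equal; ring).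
  apply is_lim_scal_l, Heta.
Qed.

(** An error of order (y r)^(-1/2), possibly with a factor |log y|, replaces the first moment of phi
    by the one of exponent b = 1/2, which still converges. The parameter [s] stands for r^(-1/2). *)
Lemma tame_half_bound (phi : R -> R) (K0 K1 : R) :
  tame phi -> 0 <= K0 -> 0 <= K1 ->
  exists K e, 0 < e /\ forall err s x, Rabs err <= (K0 + K1 * Rabs x) * (exp (- (1 / 2) * x) * s) -> 0 <= s ->
    Rabs (exp x * (phi (exp x) * err)) <= K * s * exp (- e * Rabs x).
Proof.
intros Ht HK0 HK1.
destruct (moment_bound phi 0 (1 / 2) (1 / 2) Ht ltac:(lra)) as [M0 [e0 [He0 H0]]].
destruct (moment_bound phi 1 (1 / 2) (1 / 2) Ht ltac:(lra)) as [M1 [e1 [He1 H1]]].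
exists (K0 * Rabs M0 + K1 * Rabs M1), (Rmin e0 e1). split; [now apply Rmin_pos|].
intros err s x Herr Hs.
specialize (H0 (1 / 2) x ltac:(lra)). specialize (H1 (1 / 2) x ltac:(lra)).
set (E := exp (- Rmin e0 e1 * Rabs x)).
assert (HE : forall M e', Rmin e0 e1 <= e' -> M * exp (- e' * Rabs x) <= Rabs M * E).
{ intros M e' He'. apply Rle_trans with (Rabs M * exp (- e' * Rabs x)).
  - apply Rmult_le_compat_r; [left; apply exp_pos | apply Rle_abs].
  - apply Rmult_le_compat_l; [apply Rabs_pos|]. apply exp_le_compat.
    generalize (Rabs_pos x). nra. }
apply Rle_trans with (2 := HE M0 e0 (Rmin_l _ _)) in H0.
apply Rle_trans with (2 := HE M1 e1 (Rmin_r _ _)) in H1.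
assert (Hp0 : Rabs (moment phi 0 (1 / 2) x) = exp (1 / 2 * x) * Rabs (phi (exp x))).
{ unfold moment. rewrite Rmult_1_r, Rabs_mult, Rabs_pos_eq; [reflexivity | left; apply exp_pos]. }
assert (Hp1 : Rabs (moment phi 1 (1 / 2) x) = exp (1 / 2 * x) * Rabs (phi (exp x)) * Rabs x).
{ unfold moment. rewrite pow_1, !Rabs_mult, (Rabs_pos_eq (exp _)); [ring | left; apply exp_pos]. }
rewrite Hp0 in H0. rewrite Hp1 in H1.
rewrite !Rabs_mult, (Rabs_pos_eq (exp x)) by (left; apply exp_pos).
assert (Hx : exp x = exp (1 / 2 * x) * exp (1 / 2 * x)).
{ rewrite <- exp_plus. f_equal. field. }
assert (Hxm : exp (1 / 2 * x) * exp (- (1 / 2) * x) = 1).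
{ rewrite <- exp_plus. rewrite <- exp_0. f_equal. rewrite exp_0. field. }
set (a := exp (1 / 2 * x)) in *. set (b := exp (- (1 / 2) * x)) in *. set (p := Rabs (phi (exp x))) in *.
assert (Ha : 0 < a) by apply exp_pos. assert (Hp : 0 <= p) by apply Rabs_pos.
rewrite Hx.
apply Rle_trans with (a * a * (p * ((K0 + K1 * Rabs x) * (b * s)))).
- apply Rmult_le_compat_l; [nra|]. apply Rmult_le_compat_l; [exact Hp | exact Herr].
- replace (a * a * (p * ((K0 + K1 * Rabs x) * (b * s)))) with ((a * b) * (K0 * (a * p) + K1 * (a * p * Rabs x)) * s) by ring.
  rewrite Hxm, Rmult_1_l.
  replace ((K0 * Rabs M0 + K1 * Rabs M1) * s * E) with ((K0 * (Rabs M0 * E) + K1 * (Rabs M1 * E)) * s) by ring.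
  apply Rmult_le_compat_r; [exact Hs|].
  apply Rplus_le_compat; apply Rmult_le_compat_l; assumption.
Qed.

Lemma continuous_exp_mult (h : R -> R) (x : R) :
  (forall y, continuous h y) -> continuous (fun x => exp x * h (exp x)) x.
Proof.
intros Hh. apply (continuous_mult (K := R_AbsRing) exp (fun x => h (exp x))); [apply continuous_exp|].
apply (continuous_comp exp h); [apply continuous_exp | apply Hh].
Qed.

Lemma asymptotic_1_nonneg (g Kg : R) : cos_prim_1_asymptotic g Kg -> 0 <= Kg.
Proof.
intros Hg. generalize (Hg 1 Rlt_0_1). rewrite ln_1, Rmult_0_r, exp_0.
intros H. eapply Rle_trans; [apply Rabs_pos|]. rewrite Rmult_1_r in H. exact H.
Qed.

Lemma asymptotic_ln_nonneg (c Kc : R) : cos_prim_ln_asymptotic c Kc -> 0 <= Kc.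
Proof.
intros Hc. generalize (Hc 1 Rlt_0_1). rewrite ln_1, Rmult_0_r, exp_0.
intros H. eapply Rle_trans; [apply Rabs_pos|]. rewrite Rmult_1_r in H. exact H.
Qed.

(** By scaling, the transform at y is the primitive at y r, that is - log y - log r - g up to O((y
    r)^(-1/2)); integration against phi produces the moments. *)
Lemma cos_transform_1_limit (g Kg : R) (phi : R -> R) :
  cos_prim_1_asymptotic g Kg -> tame phi ->
  exists K, forall r L, 0 < r ->
    is_RInt_line (fun x => exp x * (phi (exp x) * cos_transform (fun _ => 1) r (exp x))) L ->
    Rabs (L - (- (Moment phi 1 1 + (ln r + g) * Moment phi 0 1))) <= K * exp (- (1 / 2) * ln r).
Proof.
intros Hg Ht.
destruct (tame_half_bound phi Kg 0 Ht (asymptotic_1_nonneg g Kg Hg) (Rle_refl 0)) as [K [e [He H]]].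
exists (2 * K / e). intros r L Hr HL.
replace (2 * K / e * exp (- (1 / 2) * ln r)) with (2 * (K * exp (- (1 / 2) * ln r)) / e) by (field; lra).
set (M := fun x => - (moment phi 1 1 x + (ln r + g) * moment phi 0 1 x)).
assert (HM : is_RInt_line M (- (Moment phi 1 1 + (ln r + g) * Moment phi 0 1))).
{ apply (line_ext (fun x => -1 * (moment phi 1 1 x + (ln r + g) * moment phi 0 1 x))); [intros; unfold M; ring|].
  replace (- (Moment phi 1 1 + (ln r + g) * Moment phi 0 1))
    with (-1 * (Moment phi 1 1 + (ln r + g) * Moment phi 0 1)) by ring.
  apply line_scal, line_plus; [|apply line_scal]; apply moment_line; try exact Ht; lra. }
apply (line_bound (fun x => exp x * (phi (exp x) * cos_transform (fun _ => 1) r (exp x)) - M x) _ e).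
- exact He.
- intros x. apply (continuous_minus (V := R_NormedModule) (fun x => exp x * (phi (exp x) * cos_transform (fun _ => 1) r (exp x)))).
  + apply (continuous_exp_mult (fun y => phi y * cos_transform (fun _ => 1) r y)).
    intros y. apply continuous_cos_transform; [apply weight_1 | lra | apply Ht].
  + apply (continuous_opp (V := R_NormedModule) (fun x => moment phi 1 1 x + (ln r + g) * moment phi 0 1 x)).
    apply (continuous_plus (V := R_NormedModule)); [now apply moment_continuous|].
    apply (continuous_scal_r (V := R_NormedModule) (ln r + g)). now apply moment_continuous.
- intros x.
  set (err := cos_prim (fun _ => 1) (exp x * r) + (x + ln r) + g).
  replace (exp x * (phi (exp x) * cos_transform (fun _ => 1) r (exp x)) - M x)
    with (exp x * (phi (exp x) * err)).
  2:{ unfold M, moment, err. rewrite cos_transform_1 by (try apply exp_pos; lra).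
      rewrite Rmult_1_l, pow_1. simpl pow. ring. }
  apply H; [|left; apply exp_pos].
  assert (Hxr : 0 < exp x * r) by (apply Rmult_lt_0_compat; [apply exp_pos | exact Hr]).
  generalize (Hg (exp x * r) Hxr). rewrite ln_mult, ln_exp by (try apply exp_pos; exact Hr).
  fold err. rewrite Rmult_0_l, Rplus_0_r, Rmult_plus_distr_l, exp_plus. tauto.
- now apply line_minus.
Qed.

(** Inserting both asymptotics at y r gives - (log y + log r)^2 / 2 + c + log y (log y + log r + g).
    The mixed terms log y log r cancel, leaving g log y + (log y)^2 / 2 + c - (log r)^2 / 2. *)
Lemma cos_transform_ln_limit (g c Kg Kc : R) (phi : R -> R) :
  cos_prim_1_asymptotic g Kg -> cos_prim_ln_asymptotic c Kc -> tame phi ->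
  exists K, forall r L, 0 < r ->
    is_RInt_line (fun x => exp x * (phi (exp x) * cos_transform ln r (exp x))) L ->
    Rabs (L - (g * Moment phi 1 1 + / 2 * Moment phi 2 1 + (c - ln r ^ 2 / 2) * Moment phi 0 1))
      <= K * exp (- (1 / 2) * ln r).
Proof.
intros Hg Hc Ht.
destruct (tame_half_bound phi Kc Kg Ht (asymptotic_ln_nonneg c Kc Hc) (asymptotic_1_nonneg g Kg Hg)) as [K [e [He H]]].
exists (2 * K / e). intros r L Hr HL.
replace (2 * K / e * exp (- (1 / 2) * ln r)) with (2 * (K * exp (- (1 / 2) * ln r)) / e) by (field; lra).
set (M := fun x => g * moment phi 1 1 x + / 2 * moment phi 2 1 x + (c - ln r ^ 2 / 2) * moment phi 0 1 x).
assert (HM : is_RInt_line M (g * Moment phi 1 1 + / 2 * Moment phi 2 1 + (c - ln r ^ 2 / 2) * Moment phi 0 1)).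
{ apply line_plus; [apply line_plus|]; apply line_scal, moment_line; try exact Ht; lra. }
apply (line_bound (fun x => exp x * (phi (exp x) * cos_transform ln r (exp x)) - M x) _ e).
- exact He.
- intros x. apply (continuous_minus (V := R_NormedModule) (fun x => exp x * (phi (exp x) * cos_transform ln r (exp x)))).
  + apply (continuous_exp_mult (fun y => phi y * cos_transform ln r y)).
    intros y. apply continuous_cos_transform; [apply weight_ln | lra | apply Ht].
  + assert (Hs : forall k a, continuous (fun x => a * moment phi k 1 x) x).
    { intros k a. apply (continuous_scal_r (V := R_NormedModule) a). now apply moment_continuous. }
    apply (continuous_plus (V := R_NormedModule) (fun x => g * moment phi 1 1 x + / 2 * moment phi 2 1 x)); [|apply Hs].
    apply (continuous_plus (V := R_NormedModule) (fun x => g * moment phi 1 1 x)); apply Hs.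
- intros x.
  set (e1 := cos_prim (fun _ => 1) (exp x * r) + (x + ln r) + g).
  set (e2 := cos_prim ln (exp x * r) + (x + ln r) ^ 2 / 2 - c).
  replace (exp x * (phi (exp x) * cos_transform ln r (exp x)) - M x)
    (* Here x = log y multiplies the error of the first asymptotic, which accounts for the term K1
       |x| of [tame_half_bound]. *)
    with (exp x * (phi (exp x) * (e2 - x * e1))).
  2:{ unfold M, moment, e1, e2. rewrite cos_transform_ln, ln_exp by (try apply exp_pos; lra).
      rewrite Rmult_1_l. simpl pow. field. }
  apply H; [|left; apply exp_pos].
  assert (Hxr : 0 < exp x * r) by (apply Rmult_lt_0_compat; [apply exp_pos | exact Hr]).
  generalize (Hg (exp x * r) Hxr) (Hc (exp x * r) Hxr).
  rewrite ln_mult, ln_exp by (try apply exp_pos; exact Hr).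
  fold e1 e2. rewrite Rmult_plus_distr_l, exp_plus.
  set (q := exp (- (1 / 2) * x) * exp (- (1 / 2) * ln r)).
  intros H1 H2. apply Rle_trans with (1 := Rabs_triang _ _). rewrite Rabs_Ropp, Rabs_mult.
  apply Rmult_le_compat_l with (r := Rabs x) in H1; [|apply Rabs_pos]. lra.
- now apply line_minus.
Qed.

(** * Rotation of the Gamma integral *)

Lemma cderive_zero_const (f : R -> C) (s : R) :
  0 <= s -> (forall t, 0 <= t <= s -> cderive f t 0) -> f s = f 0.
Proof.
intros Hs Hf.
assert (Hp : forall p : R -> R, (forall t, 0 <= t <= s -> is_derive p t 0) -> p s = p 0).
{ intros p Hp. 
  assert (H : Rabs (p s - p 0) <= 0 - 0).
  { apply (increment_bound p (fun _ => 0) (fun _ => 0) (fun _ => 0)); [exact Hs | exact Hp | |].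
    - intros; apply (is_derive_const (V := R_NormedModule)).
    - intros; rewrite Rabs_R0; lra. }
  generalize (Rabs_pos (p s - p 0)). intros.
  assert (E : Rabs (p s - p 0) = 0) by lra. apply Rabs_eq_0 in E. lra. }
apply C_ext; [apply (Hp (fun t => Re (f t))) | apply (Hp (fun t => Im (f t)))]; intros; now apply Hf.
Qed.

(** With l = log w, the number u = e^(x + s l) runs over the ray through w^s, and the exponential
    factor is u e^(-u). The power stays x^k = (log u - s l)^k, so s = 1 yields w y e^(-w y) log^k
    y. *)
Definition rotated (k : nat) (l : C) (s x : R) : C :=
  (RtoC (x ^ k) * Cexp (RtoC x + RtoC s * l - Cexp (RtoC x + RtoC s * l)))%C.

Definition Rotated (k : nat) (l : C) (s : R) : C :=
  (RInt_gen (fun x => Re (rotated k l s x)) (Rbar_locally m_infty) (Rbar_locally p_infty),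
   RInt_gen (fun x => Im (rotated k l s x)) (Rbar_locally m_infty) (Rbar_locally p_infty)).

Definition rotated1 (k : nat) (l : C) (s x : R) : C :=
  (l * (1 - Cexp (RtoC x + RtoC s * l)) * rotated k l s x)%C.

Definition rotated2 (k : nat) (l : C) (s x : R) : C :=
  (l ^ 2 * ((1 - Cexp (RtoC x + RtoC s * l)) ^ 2 - Cexp (RtoC x + RtoC s * l)) * rotated k l s x)%C.

Lemma cderive_rotated (k : nat) (l : C) (s x : R) :
  cderive (fun s => rotated k l s x) s (rotated1 k l s x).
Proof.
unfold rotated1, rotated.
assert (H : cderive (fun s => RtoC x + RtoC s * l)%C s l).
{ apply (cderive_eq _ _ (0 + (1 * l + RtoC s * 0))%C); [ring|].
  apply cderive_plus; [apply cderive_const|].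
  apply (cderive_mult RtoC (fun _ => l)); [|apply cderive_const].
  apply (cderive_real (fun y => y)). apply (is_derive_id (K := R_AbsRing)). }
set (z := (RtoC x + RtoC s * l)%C) in *.
apply (cderive_eq _ _ (RtoC (x ^ k) * ((l - l * Cexp z) * Cexp (z - Cexp z)))%C); [ring|].
apply cderive_scal, cderive_Cexp, cderive_minus; [exact H | now apply cderive_Cexp].
Qed.

Lemma cderive_rotated1 (k : nat) (l : C) (s x : R) :
  cderive (fun s => rotated1 k l s x) s (rotated2 k l s x).
Proof.
assert (H : cderive (fun s => RtoC x + RtoC s * l)%C s l).
{ apply (cderive_eq _ _ (0 + (1 * l + RtoC s * 0))%C); [ring|].
  apply cderive_plus; [apply cderive_const|].
  apply (cderive_mult RtoC (fun _ => l)); [|apply cderive_const].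
  apply (cderive_real (fun y => y)). apply (is_derive_id (K := R_AbsRing)). }
unfold rotated1 at 1.
apply (cderive_eq _ _ ((l * (0 - l * Cexp (RtoC x + RtoC s * l))) * rotated k l s x
  + (l * (1 - Cexp (RtoC x + RtoC s * l))) * rotated1 k l s x)%C).
{ unfold rotated2, rotated1. ring. }
apply (cderive_mult (fun s => l * (1 - Cexp (RtoC x + RtoC s * l)))%C (fun s => rotated k l s x)); [|apply cderive_rotated].
apply cderive_scal, cderive_minus; [apply cderive_const | now apply cderive_Cexp].
Qed.

Lemma cderive_rotated_x (k : nat) (l : C) (s x : R) :
  cderive (rotated k l s) x
    (RtoC (INR k * x ^ pred k) * Cexp (RtoC x + RtoC s * l - Cexp (RtoC x + RtoC s * l))
     + (1 - Cexp (RtoC x + RtoC s * l)) * rotated k l s x)%C.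
Proof.
assert (H : cderive (fun x => RtoC x + RtoC s * l)%C x 1).
{ apply (cderive_eq _ _ (1 + 0)%C); [ring|].
  apply cderive_plus; [|apply cderive_const].
  apply (cderive_real (fun y => y)). apply (is_derive_id (K := R_AbsRing)). }
set (z := (RtoC x + RtoC s * l)%C) in *.
apply (cderive_eq _ _ (RtoC (INR k * x ^ pred k) * Cexp (z - Cexp z)
   + RtoC (x ^ k) * ((1 - 1 * Cexp z) * Cexp (z - Cexp z)))%C).
{ unfold rotated. fold z. ring. }
apply (cderive_mult (fun x => RtoC (x ^ k)) (fun x => Cexp (RtoC x + RtoC s * l - Cexp (RtoC x + RtoC s * l)))).
- apply (cderive_real (fun x => x ^ k)). auto_derive; [trivial|ring].
- apply cderive_Cexp, cderive_minus; [exact H | now apply cderive_Cexp].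
Qed.

Lemma rotated_continuous (k : nat) (l : C) (s x : R) : ccontinuous (rotated k l s) x.
Proof. eapply cderive_continuous. apply cderive_rotated_x. Qed.

Lemma rotated1_continuous (k : nat) (l : C) (s x : R) : ccontinuous (rotated1 k l s) x.
Proof.
apply (ccontinuous_mult (fun x => l * (1 - Cexp (RtoC x + RtoC s * l)))%C); [|apply rotated_continuous].
apply ccontinuous_scal, ccontinuous_minus; [apply ccontinuous_const|].
apply (cderive_continuous _ _ (1 * Cexp (RtoC x + RtoC s * l))).
apply cderive_Cexp. apply (cderive_eq _ _ (1 + 0)%C); [ring|].
apply cderive_plus; [|apply cderive_const].
apply (cderive_real (fun y => y)). apply (is_derive_id (K := R_AbsRing)).
Qed.

(** On the ray, Re e^z = e^(Re z) cos (s Im l) is at least c0 e^(Re z), because |s Im l| stays away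
    from PI / 2. The margin [d] beyond |s| = 1 leaves room for the derivative at the endpoint s =
    1. *)
Lemma rotated_domination (k : nat) (l : C) : Rabs (Im l) < PI / 2 ->
  exists K e d, 0 < e /\ 0 < d /\ forall s x, Rabs s <= 1 + d ->
    Cmod (rotated k l s x) <= K * exp (- e * Rabs x) /\
    Cmod (rotated2 k l s x) <= K * exp (- e * Rabs x).
Proof.
intros Hl.
set (be := Rabs (Im l)) in *.
assert (Hbe : 0 <= be) by apply Rabs_pos.
(* This choice makes be d at most half of the gap PI / 2 - be. *)
set (d := (PI / 2 - be) / (2 * (be + 1))).
assert (Hd : 0 < d) by (apply Rdiv_lt_0_compat; lra).
assert (Hbd : be * (1 + d) < PI / 2).
{ assert (E : d * (2 * (be + 1)) = PI / 2 - be) by (unfold d; field; lra). nra. }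
set (c0 := cos (be * (1 + d))).
assert (Hbd0 : 0 <= be * (1 + d)) by (apply Rmult_le_pos; lra).
assert (Hc0 : 0 < c0) by (apply cos_gt_0; [|exact Hbd]; generalize PI_RGT_0; lra).
set (a := exp (Rabs (Re l) * (1 + d))).
set (m := c0 / a).
assert (Ha : 1 <= a).
{ unfold a. rewrite <- exp_0 at 1. apply exp_le_compat. apply Rmult_le_pos; [apply Rabs_pos | lra]. }
assert (Hm : 0 < m) by (apply Rdiv_lt_0_compat; lra).
(* The range from 1 to 3 covers e^x, e^(2 x) and e^(3 x): the extra factor of [rotated2] is
   quadratic in e^z. *)
destruct (pow_exp_domination 1 3 m k Rlt_0_1 Hm) as [K [e [HK [He HD]]]].
(* The coefficients of (1 + t)^2 + t = 1 + 3 t + t^2 at t = a e^x. *)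
set (q := 1 + 3 * a + a ^ 2).
set (L := 1 + Cmod l ^ 2).
assert (HL : 1 <= L) by (unfold L; generalize (pow2_ge_0 (Cmod l)); lra).
assert (Hq : 1 <= q) by (unfold q; nra).
exists (L * (a * (q * K))), e, d. split; [exact He|]. split; [exact Hd|].
intros s x Hs.
set (z := (RtoC x + RtoC s * l)%C).
assert (Hs0 := Rabs_pos s).
assert (HRez : Re z = x + s * Re l) by (unfold z; simpl; unfold Re; ring).
assert (HImz : Im z = s * Im l) by (unfold z; simpl; unfold Im; ring).
assert (Hsl : Rabs (s * Re l) <= Rabs (Re l) * (1 + d)).
{ rewrite Rabs_mult, Rmult_comm. apply Rmult_le_compat_l; [apply Rabs_pos | exact Hs]. }
apply Rabs_le_between in Hsl.
assert (He1 : exp (Re z) <= a * exp x).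
{ unfold a. rewrite HRez, <- exp_plus. apply exp_le_compat. lra. }
assert (He2 : exp x <= a * exp (Re z)).
{ unfold a. rewrite HRez, <- exp_plus. apply exp_le_compat. lra. }
assert (Hcos : c0 <= cos (Im z)).
{ rewrite HImz. unfold c0.
  replace (cos (s * Im l)) with (cos (Rabs (s * Im l))).
  2:{ unfold Rabs. destruct (Rcase_abs (s * Im l)); [apply cos_neg | reflexivity]. }
  assert (Hsi : Rabs (s * Im l) <= be * (1 + d)).
  { rewrite Rabs_mult, Rmult_comm. apply Rmult_le_compat_l; [exact Hbe | exact Hs]. }
  generalize PI_RGT_0 (Rabs_pos (s * Im l)). intros.
  apply cos_decr_1; nra. }
set (g := Cexp (z - Cexp z)).
assert (Hg : Cmod g <= a * exp x * exp (- m * exp x)).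
{ unfold g. rewrite Cmod_Cexp.
  replace (Re (z - Cexp z)) with (Re z + - (exp (Re z) * cos (Im z))) by (simpl; unfold Re; ring).
  rewrite exp_plus. apply Rmult_le_compat; [left; apply exp_pos | left; apply exp_pos | exact He1 |].
  apply exp_le_compat. 
  assert (Hx : 0 < exp x) by apply exp_pos. assert (Hz : 0 < exp (Re z)) by apply exp_pos.
  assert (E : m * a = c0) by (unfold m; field; lra).
  assert (m * exp x <= m * (a * exp (Re z))) by (apply Rmult_le_compat_l; lra).
  assert (c0 * exp (Re z) <= cos (Im z) * exp (Re z)) by (apply Rmult_le_compat_r; lra).
  nra. }
assert (Hrot : Cmod (rotated k l s x) <= Rabs x ^ k * (a * exp x * exp (- m * exp x))).
{ unfold rotated. fold z. fold g. rewrite Cmod_mult, Cmod_R, RPow_abs.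
  apply Rmult_le_compat_l; [apply Rabs_pos | exact Hg]. }
assert (HE : 0 < exp (- e * Rabs x)) by apply exp_pos.
assert (H1 := HD 1 x ltac:(lra)). assert (H2 := HD 2 x ltac:(lra)). assert (H3 := HD 3 x ltac:(lra)).
rewrite Rmult_1_l in H1.
replace (2 * x) with (x + x) in H2 by ring. replace (3 * x) with (x + x + x) in H3 by ring.
rewrite exp_plus in H2. rewrite (exp_plus (x + x)), exp_plus in H3.
set (X := exp x) in *. assert (HX : 0 < X) by apply exp_pos.
set (W := Rabs x ^ k) in *. assert (HW : 0 <= W) by (apply pow_le, Rabs_pos).
set (Y := exp (- m * X)) in *. assert (HY : 0 < Y) by apply exp_pos.
set (E := exp (- e * Rabs x)) in *.
assert (HKE : 0 < K * E) by nra.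
assert (Hrot' : Cmod (rotated k l s x) <= a * (K * E)).
{ apply Rle_trans with (1 := Hrot).
  replace (W * (a * X * Y)) with (a * (X * W * Y)) by ring.
  apply Rmult_le_compat_l; lra. }
split.
- apply Rle_trans with (1 := Hrot').
  replace (L * (a * (q * K)) * E) with ((a * (K * E)) * (L * q)) by ring.
  assert (1 <= L * q) by nra. assert (0 < a * (K * E)) by nra. nra.
- unfold rotated2. fold z. rewrite !Cmod_mult, Cmod_pow.
  assert (Hz : Cmod (Cexp z) <= a * X) by (rewrite Cmod_Cexp; exact He1).
  assert (Hpoly : Cmod ((1 - Cexp z) ^ 2 - Cexp z) <= 1 + 3 * (a * X) + (a * X) ^ 2).
  { apply Rle_trans with (1 := Cmod_triangle _ _). rewrite Cmod_opp, Cmod_pow.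
    assert (Ho : Cmod (1 - Cexp z) <= 1 + Cmod (Cexp z)).
    { apply Rle_trans with (1 := Cmod_triangle _ _). rewrite Cmod_opp, Cmod_1. lra. }
    generalize (Cmod_ge_0 (1 - Cexp z)) (Cmod_ge_0 (Cexp z)). intros. nra. }
  apply Rle_trans with (L * (1 + 3 * (a * X) + (a * X) ^ 2) * (W * (a * X * Y))).
  + apply Rmult_le_compat; [| apply Cmod_ge_0 | | exact Hrot].
    * apply Rmult_le_pos; [apply pow_le|]; apply Cmod_ge_0.
    * apply Rmult_le_compat; [apply pow_le, Cmod_ge_0 | apply Cmod_ge_0 | unfold L; lra | exact Hpoly].
  + replace (L * (1 + 3 * (a * X) + (a * X) ^ 2) * (W * (a * X * Y)))
      with (L * (a * (X * W * Y + 3 * a * (X * X * W * Y) + a ^ 2 * (X * X * X * W * Y)))) by ring.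
    replace (L * (a * (q * K)) * E) with (L * (a * (K * E + 3 * a * (K * E) + a ^ 2 * (K * E)))) by (unfold q; ring).
    apply Rmult_le_compat_l; [lra|]. apply Rmult_le_compat_l; [lra|].
    apply Rplus_le_compat; [apply Rplus_le_compat; [exact H1|]|].
    * apply Rmult_le_compat_l; [lra | exact H2].
    * apply Rmult_le_compat_l; [apply pow2_ge_0 | exact H3].
Qed.

Lemma is_lim_dominated (f : R -> R) (K e : R) :
  0 < e -> (forall x, Rabs (f x) <= K * exp (- e * Rabs x)) ->
  is_lim f p_infty 0 /\ is_lim f m_infty 0.
Proof.
intros He Hf.
assert (Hp : forall h : R -> R, (forall x, 0 <= x -> Rabs (h x) <= K * exp (- e * x)) -> is_lim h p_infty 0).
{ intros h Hh. apply (is_lim_le_le_loc (fun x => - (K * exp (- e * x))) (fun x => K * exp (- e * x))).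
  - exists 0. intros x Hx. apply Rabs_le_between, Hh. lra.
  - replace (Finite 0) with (Rbar_opp (Rbar_mult K 0)) by (simpl; f_equal; ring).
    apply is_lim_opp, is_lim_scal_l. now apply is_lim_exp_neg.
  - replace (Finite 0) with (Rbar_mult K 0) by (simpl; f_equal; ring).
    apply is_lim_scal_l. now apply is_lim_exp_neg. }
split.
- apply Hp. intros x Hx. specialize (Hf x). now rewrite (Rabs_pos_eq x Hx) in Hf.
- apply is_lim_reflect, Hp. intros x Hx. specialize (Hf (- x)). now rewrite (Rabs_Ropp x), (Rabs_pos_eq x Hx) in Hf.
Qed.

Lemma rotated_line (k : nat) (l : C) (s K e : R) : 0 < e ->
  (forall x, Cmod (rotated k l s x) <= K * exp (- e * Rabs x)) ->
  is_CInt_line (rotated k l s) (Rotated k l s).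
Proof.
intros He HD.
split; simpl.
- destruct (dominated_line_bound (fun x => Re (rotated k l s x)) K e He) as [L [HL _]].
  + intros x. exact (proj1 (rotated_continuous k l s x)).
  + intros x. apply Rle_trans with (1 := Re_le_Cmod _). now apply HD.
  + replace (RInt_gen _ _ _) with L; [exact HL|]. symmetry.
    apply (is_RInt_gen_unique (V := R_CompleteNormedModule)). exact HL.
- destruct (dominated_line_bound (fun x => Im (rotated k l s x)) K e He) as [L [HL _]].
  + intros x. exact (proj2 (rotated_continuous k l s x)).
  + intros x. apply Rle_trans with (1 := Im_le_Cmod _). now apply HD.
  + replace (RInt_gen _ _ _) with L; [exact HL|]. symmetry.
    apply (is_RInt_gen_unique (V := R_CompleteNormedModule)). exact HL.
Qed.

(* [pred 0 = 0], but then the factor [INR k] vanishes. *)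
Lemma cderive_Rotated (k : nat) (l : C) (s : R) :
  Rabs (Im l) < PI / 2 -> 0 <= s <= 1 ->
  cderive (Rotated k l) s (- (l * (RtoC (INR k) * Rotated (pred k) l s)))%C.
Proof.
intros Hl Hs.
destruct (rotated_domination k l Hl) as [K [e [d [He [Hd HD]]]]].
destruct (rotated_domination (pred k) l Hl) as [K' [e' [d' [He' [Hd' HD']]]]].
assert (Hs1 : Rabs s <= 1) by (apply Rabs_le_between; lra).
assert (Hnear : forall t, Rabs (t - s) <= d -> Rabs t <= 1 + d).
{ intros t Ht. replace t with (t - s + s) by ring. apply Rle_trans with (1 := Rabs_triang _ _). lra. }
assert (HI : forall t, Rabs (t - s) <= d -> is_CInt_line (rotated k l t) (Rotated k l t)).
{ intros t Ht. apply (rotated_line k l t K e He). intros. now apply HD, Hnear. }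
assert (HI' : is_CInt_line (rotated (pred k) l s) (Rotated (pred k) l s)).
{ apply (rotated_line (pred k) l s K' e' He'). intros. apply HD'. lra. }
(* This integrand is the x-derivative of [rotated k l s], which decays at both ends, so its integral
   is 0. *)
assert (HF : is_CInt_line (fun x => RtoC (INR k) * rotated (pred k) l s x
    + (1 - Cexp (RtoC x + RtoC s * l)) * rotated k l s x)%C 0).
{ assert (Hcont : forall x, ccontinuous (fun x => RtoC (INR k) * rotated (pred k) l s x
    + (1 - Cexp (RtoC x + RtoC s * l)) * rotated k l s x)%C x).
  { intros x. apply ccontinuous_plus.
    - apply ccontinuous_scal, rotated_continuous.
    - apply (ccontinuous_mult (fun x => 1 - Cexp (RtoC x + RtoC s * l))%C); [|apply rotated_continuous].
      apply ccontinuous_minus; [apply ccontinuous_const|].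
      apply (cderive_continuous _ _ (1 * Cexp (RtoC x + RtoC s * l))).
      apply cderive_Cexp. apply (cderive_eq _ _ (1 + 0)%C); [ring|].
      apply cderive_plus; [|apply cderive_const].
      apply (cderive_real (fun y => y)). apply (is_derive_id (K := R_AbsRing)). }
  assert (Hder : forall x, cderive (rotated k l s) x (RtoC (INR k) * rotated (pred k) l s x
    + (1 - Cexp (RtoC x + RtoC s * l)) * rotated k l s x)%C).
  { intros x. refine (cderive_eq _ _ _ _ _ (cderive_rotated_x k l s x)).
    unfold rotated at 2. rewrite RtoC_mult. ring. }
  assert (Hbd : forall x, Cmod (rotated k l s x) <= K * exp (- e * Rabs x)) by (intros; apply HD; lra).
  destruct (is_lim_dominated (fun x => Re (rotated k l s x)) K e He) as [R1 R2].
  { intros x. apply Rle_trans with (1 := Re_le_Cmod _). apply Hbd. }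
  destruct (is_lim_dominated (fun x => Im (rotated k l s x)) K e He) as [I1 I2].
  { intros x. apply Rle_trans with (1 := Im_le_Cmod _). apply Hbd. }
  split; change (Re 0) with 0; change (Im 0) with 0; rewrite <- (Rminus_diag 0).
  - apply (line_FTC (fun x => Re (rotated k l s x))); try assumption; intros x; [exact (proj1 (Hder x)) | exact (proj1 (Hcont x))].
  - apply (line_FTC (fun x => Im (rotated k l s x))); try assumption; intros x; [exact (proj2 (Hder x)) | exact (proj2 (Hcont x))]. }
(* The s-derivative is l times the x-derivative, minus l k times the lower power: up to that term,
   rotating the ray is a translation in x. This takes the role of Cauchy's theorem. *)
assert (HI1 : is_CInt_line (rotated1 k l s) (- (l * (RtoC (INR k) * Rotated (pred k) l s)))%C).
{ apply (cline_ext (fun x => l * ((RtoC (INR k) * rotated (pred k) l s x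
    + (1 - Cexp (RtoC x + RtoC s * l)) * rotated k l s x) - RtoC (INR k) * rotated (pred k) l s x))%C).
  { intros x. unfold rotated1. ring. }
  replace (- (l * (RtoC (INR k) * Rotated (pred k) l s)))%C
    with (l * (0 - RtoC (INR k) * Rotated (pred k) l s))%C by ring.
  apply cline_scal, cline_minus; [exact HF | apply cline_scal, HI']. }
split.
- apply (line_deriv (fun t x => Re (rotated k l t x)) (fun t x => Re (rotated1 k l t x))
    (fun t x => Re (rotated2 k l t x)) (fun t => Re (Rotated k l t)) s _ d K e Hd He).
  + intros t x _. exact (proj1 (cderive_rotated k l t x)).
  + intros t x _. exact (proj1 (cderive_rotated1 k l t x)).
  + intros t x Ht. apply Rle_trans with (1 := Re_le_Cmod _). apply HD. now apply Hnear.
  + intros t x. exact (proj1 (rotated_continuous k l t x)).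
  + intros x. exact (proj1 (rotated1_continuous k l s x)).
  + intros t Ht. exact (proj1 (HI t Ht)).
  + exact (proj1 HI1).
- apply (line_deriv (fun t x => Im (rotated k l t x)) (fun t x => Im (rotated1 k l t x))
    (fun t x => Im (rotated2 k l t x)) (fun t => Im (Rotated k l t)) s _ d K e Hd He).
  + intros t x _. exact (proj2 (cderive_rotated k l t x)).
  + intros t x _. exact (proj2 (cderive_rotated1 k l t x)).
  + intros t x Ht. apply Rle_trans with (1 := Im_le_Cmod _). apply HD. now apply Hnear.
  + intros t x. exact (proj2 (rotated_continuous k l t x)).
  + intros x. exact (proj2 (rotated1_continuous k l s x)).
  + intros t Ht. exact (proj2 (HI t Ht)).
  + exact (proj2 HI1).
Qed.

Lemma cderive_RtoC_mult (c : C) (s : R) : cderive (fun s => RtoC s * c)%C s c.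
Proof.
apply (cderive_eq _ _ (1 * c + RtoC s * 0)%C); [ring|].
apply (cderive_mult RtoC (fun _ => c)); [|apply cderive_const].
apply (cderive_real (fun y => y)). apply (is_derive_id (K := R_AbsRing)).
Qed.

Lemma Rotated_0 (l : C) (s : R) : Rabs (Im l) < PI / 2 -> 0 <= s <= 1 ->
  Rotated 0 l s = Rotated 0 l 0.
Proof.
intros Hl Hs. apply cderive_zero_const; [lra|]. intros t Ht.
refine (cderive_eq _ _ _ _ _ (cderive_Rotated 0 l t Hl ltac:(lra))). simpl INR. ring.
Qed.

Lemma Rotated_1 (l : C) (s : R) : Rabs (Im l) < PI / 2 -> 0 <= s <= 1 ->
  Rotated 1 l s = (Rotated 1 l 0 - RtoC s * (l * Rotated 0 l 0))%C.
Proof.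
intros Hl Hs.
assert (H : (Rotated 1 l s + RtoC s * (l * Rotated 0 l 0) = Rotated 1 l 0 + RtoC 0 * (l * Rotated 0 l 0))%C).
{ apply (cderive_zero_const (fun s => Rotated 1 l s + RtoC s * (l * Rotated 0 l 0))%C); [lra|].
  intros t Ht.
  refine (cderive_eq _ _ _ _ _ (cderive_plus _ _ _ _ _ (cderive_Rotated 1 l t Hl ltac:(lra))
    (cderive_RtoC_mult (l * Rotated 0 l 0)%C t))).
  simpl INR. simpl pred. rewrite (Rotated_0 l t) by (try assumption; lra). ring. }
replace (Rotated 1 l s) with ((Rotated 1 l s + RtoC s * (l * Rotated 0 l 0)) - RtoC s * (l * Rotated 0 l 0))%C by ring.
rewrite H. ring.
Qed.

(** The integrals I_k satisfy I_k' = - k l I_(k-1), a triangular system with I_0 constant, solved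
    here for k = 2 at s = 1. *)
Lemma Rotated_2 (l : C) : Rabs (Im l) < PI / 2 ->
  Rotated 2 l 1 = (Rotated 2 l 0 - 2 * l * Rotated 1 l 0 + l ^ 2 * Rotated 0 l 0)%C.
Proof.
intros Hl.
(* P' = 2 l I_1, so that I_2 + P is constant. *)
set (P := fun s => (RtoC s * (2 * l * Rotated 1 l 0) - RtoC s * (RtoC s * (l ^ 2 * Rotated 0 l 0)))%C).
assert (H : (Rotated 2 l 1 + P 1 = Rotated 2 l 0 + P 0)%C).
{ apply (cderive_zero_const (fun s => Rotated 2 l s + P s)%C); [lra|].
  intros t Ht.
  refine (cderive_eq _ _ _ _ _ (cderive_plus _ _ _ _ _ (cderive_Rotated 2 l t Hl ltac:(lra))
    (cderive_minus _ _ _ _ _ (cderive_RtoC_mult (2 * l * Rotated 1 l 0)%C t)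
      (cderive_mult RtoC (fun s => RtoC s * (l ^ 2 * Rotated 0 l 0))%C _ _ _
        (cderive_real (fun y => y) t 1 (is_derive_id (K := R_AbsRing) t))
        (cderive_RtoC_mult (l ^ 2 * Rotated 0 l 0)%C t))))).
  simpl pred. rewrite (Rotated_1 l t) by (try assumption; lra).
  replace (INR 2) with 2 by (simpl; ring). ring. }
replace (Rotated 2 l 1) with ((Rotated 2 l 1 + P 1) - P 1)%C by ring.
rewrite H. unfold P. ring.
Qed.

Lemma ctame_Cexp (w : C) : 0 < Re w -> ctame (fun y => Cexp (- (w * RtoC y))).
Proof.
intros Hw. apply (ctame_of_Cmod _ 1 (Re w) Hw).
- intros y. eapply cderive_continuous. apply cderive_Cexp, cderive_opp.
  apply cderive_scal. apply (cderive_real (fun y => y)). apply (is_derive_id (K := R_AbsRing)).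
- intros y _. rewrite Cmod_Cexp, Rmult_1_l. right. f_equal. simpl. unfold Re. ring.
Qed.

Lemma Rotated_start (k : nat) (l : C) : Rotated k l 0 = RtoC (GammaD k 1).
Proof.
assert (H : forall x, rotated k l 0 x = RtoC (moment (fun y => exp (- y)) k 1 x)).
{ intros x. unfold rotated, moment.
  replace (RtoC x + RtoC 0 * l)%C with (RtoC x) by ring.
  rewrite Cexp_real, <- RtoC_minus, Cexp_real, <- RtoC_mult. f_equal.
  rewrite Rmult_1_l. unfold Rminus. rewrite exp_plus. ring. }
assert (HM := moment_line _ k 1 tame_exp_neg Rlt_0_1).
assert (HR : is_RInt_line (fun x => Re (rotated k l 0 x)) (GammaD k 1)).
{ apply (line_ext (moment (fun y => exp (- y)) k 1)); [intros; now rewrite H | exact HM]. }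
assert (HI : is_RInt_line (fun x => Im (rotated k l 0 x)) 0).
{ apply (line_ext (fun x => 0 * moment (fun y => exp (- y)) k 1 x)).
  { intros x. rewrite H. simpl. ring. }
  generalize (line_scal 0 _ _ HM). now rewrite Rmult_0_l. }
apply C_ext.
- exact (is_RInt_gen_unique (V := R_CompleteNormedModule) _ _ HR).
- exact (is_RInt_gen_unique (V := R_CompleteNormedModule) _ _ HI).
Qed.

Lemma Rotated_end (k : nat) (l : C) : Rabs (Im l) < PI / 2 ->
  Rotated k l 1 = (Cexp l * CMoment (fun y => Cexp (- (Cexp l * RtoC y))) k 1)%C.
Proof.
intros Hl.
assert (Hre : 0 < Re (Cexp l)).
{ simpl. apply Rmult_lt_0_compat; [apply exp_pos|]. apply Rabs_lt_between in Hl. apply cos_gt_0; lra. }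
destruct (rotated_domination k l Hl) as [K [e [d [He [Hd HD]]]]].
apply (cline_unique (rotated k l 1)).
- apply (rotated_line k l 1 K e He). intros. apply HD. rewrite Rabs_R1. lra.
- apply (cline_ext (fun x => Cexp l * cmoment (fun y => Cexp (- (Cexp l * RtoC y))) k 1 x)%C).
  { intros x. unfold rotated, cmoment. rewrite Cmult_1_l.
    replace (RtoC x + l - Cexp (RtoC x + l))%C with (RtoC x + (l + - Cexp (RtoC x + l)))%C by ring.
    rewrite !Cexp_plus, !Cexp_real, Rmult_1_l, RtoC_mult.
    replace (- (RtoC (exp x) * Cexp l))%C with (- (Cexp l * RtoC (exp x)))%C by ring. ring. }
  apply cline_scal, cmoment_line; [now apply ctame_Cexp | lra].
Qed.

Lemma GammaD_0_1 : GammaD 0 1 = 1.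
Proof. unfold GammaD. rewrite <- Gamma_Moment by lra. apply Gamma_1. Qed.

(** The rotation legitimates the substitution u = w y: each left side is the integral of e^(-u) (log
    u - l)^k over u > 0, expanded by the binomial formula into derivatives of Gamma at 1. *)
Lemma CMoment_exp (l : C) : Rabs (Im l) < PI / 2 ->
  let w := Cexp l in let E := fun y => Cexp (- (w * RtoC y)) in
  (w * CMoment E 0 1 = 1 /\ w * CMoment E 1 1 = RtoC (GammaD 1 1) - l /\
   w * CMoment E 2 1 = RtoC (GammaD 2 1) - 2 * l * RtoC (GammaD 1 1) + l ^ 2)%C.
Proof.
intros Hl w E. unfold E, w. rewrite <- !Rotated_end by exact Hl.
rewrite Rotated_2, Rotated_1, Rotated_0 by (try exact Hl; lra).
rewrite !Rotated_start, GammaD_0_1. repeat split; ring.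
Qed.

(** Re w > 0 means that the cosine of the argument is positive, which places the argument in the
    open sector where the rotation is dominated. *)
Lemma Clog_spec (w : C) : 0 < Re w -> Cexp (Clog w) = w /\ Rabs (Im (Clog w)) < PI / 2.
Proof.
intros Hw.
assert (Hm : 0 < Cmod w).
{ apply Rlt_le_trans with (2 := Re_le_Cmod w). rewrite Rabs_pos_eq; lra. }
set (t := Re w / Cmod w).
assert (Ht : 0 < t <= 1).
{ split; [now apply Rdiv_lt_0_compat|]. apply Rmult_le_reg_r with (1 := Hm).
  unfold t, Rdiv. rewrite Rmult_assoc, Rinv_l, Rmult_1_r, Rmult_1_l by lra.
  apply Rle_trans with (2 := Re_le_Cmod w). apply Rle_abs. }
assert (Hcos : cos (acos t) = t) by (apply cos_acos; lra).
assert (Hsq : Cmod w ^ 2 = Re w ^ 2 + Im w ^ 2).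
{ unfold Cmod. rewrite pow2_sqrt; [reflexivity|]. generalize (pow2_ge_0 (fst w)) (pow2_ge_0 (snd w)). lra. }
assert (Hsin : sin (acos t) = Rabs (Im w) / Cmod w).
{ rewrite sin_acos by lra.
  replace (1 - t²) with ((Rabs (Im w) / Cmod w)²).
  - apply sqrt_Rsqr. apply Rdiv_le_0_compat; [apply Rabs_pos | exact Hm].
  - unfold t, Rsqr. apply Rmult_eq_reg_r with (Cmod w ^ 2); [|apply pow_nonzero; lra].
    replace (Rabs (Im w) / Cmod w * (Rabs (Im w) / Cmod w) * Cmod w ^ 2) with (Rabs (Im w) ^ 2) by (field; lra).
    replace ((1 - Re w / Cmod w * (Re w / Cmod w)) * Cmod w ^ 2) with (Cmod w ^ 2 - Re w ^ 2) by (field; lra).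
    rewrite pow2_abs. lra. }
assert (Hlt : 0 <= acos t < PI / 2).
{ split; [apply acos_bound|]. apply Rnot_le_lt. intros H.
  generalize (acos_bound t) (cos_le_0 (acos t) H). generalize PI_RGT_0. intros. lra. }
split.
- apply C_ext; simpl; unfold Carg; fold t; rewrite exp_ln by exact Hm.
  + destruct (Rle_dec 0 (Im w)); rewrite ?cos_neg, Hcos; unfold t; field; lra.
  + destruct (Rle_dec 0 (Im w)) as [H|H]; rewrite ?sin_neg, Hsin.
    * rewrite Rabs_pos_eq by exact H. field. lra.
    * rewrite Rabs_left1 by lra. field. lra.
- simpl. unfold Carg. fold t. destruct (Rle_dec 0 (Im w)); apply Rabs_lt_between; lra.
Qed.

(** * The integral of the theorem *)

Lemma poly_exp_bound (a m : R) : 0 < m ->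
  exists K, forall Y, 0 <= Y -> (1 + a * Y) ^ 2 <= K * exp (m * Y).
Proof.
(* From (1 + a Y)^2 <= 2 + 2 a^2 Y^2 and (m Y)^2 <= 2 e^(m Y). *)
intros Hm. exists (2 + 4 * a ^ 2 / m ^ 2). intros Y HY.
assert (H1 : 1 <= exp (m * Y)).
{ rewrite <- exp_0 at 1. apply exp_le_compat. nra. }
assert (H2 := pow_le_fact_exp (m * Y) 2 ltac:(nra)).
replace (INR (fact 2)) with 2 in H2 by (simpl; ring).
assert (H3 : a ^ 2 * Y ^ 2 <= 2 * a ^ 2 / m ^ 2 * exp (m * Y)).
{ replace (a ^ 2 * Y ^ 2) with (a ^ 2 / m ^ 2 * (m * Y) ^ 2) by (field; lra).
  replace (2 * a ^ 2 / m ^ 2 * exp (m * Y)) with (a ^ 2 / m ^ 2 * (2 * exp (m * Y))) by (field; lra).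
  apply Rmult_le_compat_l; [|exact H2]. apply Rdiv_le_0_compat; [apply pow2_ge_0 | apply pow_lt, Hm]. }
replace ((2 + 4 * a ^ 2 / m ^ 2) * exp (m * Y)) with
  (2 * exp (m * Y) + 2 * (2 * a ^ 2 / m ^ 2 * exp (m * Y))) by (field; lra).
generalize (pow2_ge_0 (1 - a * Y)). nra.
Qed.

Lemma is_lim_exp_half_ln : is_lim (fun r => exp (- (1 / 2) * ln r)) p_infty 0.
Proof.
apply (is_lim_comp (fun x => exp (- (1 / 2) * x)) ln p_infty 0 p_infty).
- apply is_lim_exp_neg. lra.
- apply is_lim_ln_p.
- exists 0. intros; discriminate.
Qed.

Lemma is_lim_of_exp_half_ln (f : R -> R) (l K : R) :
  (forall r, 1 < r -> Rabs (f r - l) <= K * exp (- (1 / 2) * ln r)) -> is_lim f p_infty l.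
Proof.
intros Hf.
apply (is_lim_ext (fun r => l + (f r - l))); [intros; ring|].
replace (Finite l) with (Finite (l + 0)) by (f_equal; ring).
apply is_lim_plus'; [apply is_lim_const|].
apply (is_lim_le_le_loc (fun r => - (K * exp (- (1 / 2) * ln r))) (fun r => K * exp (- (1 / 2) * ln r))).
- exists 1. intros r Hr. apply Rabs_le_between. now apply Hf.
- replace (Finite 0) with (Rbar_opp (Rbar_mult K 0)) by (simpl; f_equal; ring).
  apply is_lim_opp, is_lim_scal_l, is_lim_exp_half_ln.
- replace (Finite 0) with (Rbar_mult K 0) by (simpl; f_equal; ring).
  apply is_lim_scal_l, is_lim_exp_half_ln.
Qed.

(** The value - v^2 / (1 + v^2) is the integral over (0, oo), so the difference is the tail beyond Y
    up to sign. The primitive [P] makes it explicit, and 1 - cos t <= t^2 / 2 with |sin t| <= t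
    extract v^2 from it. *)
Lemma exp_cos_transform_bound (Y v : R) : 0 <= Y -> 0 <= v ->
  Rabs (RInt (fun y => exp (- y) * (cos (y * v) - 1)) 0 Y - - v ^ 2 / (1 + v ^ 2))
    <= v ^ 2 * (exp (- Y) * (1 + 1 * Y) ^ 2).
Proof.
intros HY Hv.
set (P := fun y => exp (- y) * ((- cos (y * v) + v * sin (y * v)) / (1 + v ^ 2) + 1)).
assert (Hv2 : 0 <= v ^ 2) by apply pow2_ge_0.
assert (H : is_RInt (fun y => exp (- y) * (cos (y * v) - 1)) 0 Y (minus (P Y) (P 0))).
{ apply (is_RInt_derive (V := R_CompleteNormedModule)).
  - intros y _. unfold P. auto_derive; [lra|]. field. lra.
  - intros y _. apply ex_derive_R_continuous. auto_derive. trivial. }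
rewrite (is_RInt_unique (V := R_CompleteNormedModule) _ _ _ _ H).
unfold minus, plus, opp; simpl.
replace (P Y + - P 0 - - (v * (v * 1)) / (1 + v * (v * 1)))
  with (exp (- Y) * ((v ^ 2 + (1 - cos (Y * v)) + v * sin (Y * v)) / (1 + v ^ 2))).
2:{ unfold P. rewrite Ropp_0, exp_0, Rmult_0_l, cos_0, sin_0. field. lra. }
rewrite Rabs_mult, Rabs_pos_eq by (left; apply exp_pos).
replace (v * (v * 1) * (exp (- Y) * ((1 + 1 * Y) * ((1 + 1 * Y) * 1))))
  with (exp (- Y) * (v ^ 2 * (1 + Y) ^ 2)) by ring.
apply Rmult_le_compat_l; [left; apply exp_pos|].
assert (Hc := Rabs_cos_minus_1_le (Y * v)). assert (Hs := Rabs_sin_le (Y * v)).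
rewrite (Rabs_pos_eq (Y * v)) in Hs by nra.
apply Rabs_le_between in Hc. apply Rabs_le_between in Hs.
set (N := v ^ 2 + (1 - cos (Y * v)) + v * sin (Y * v)).
assert (HN : Rabs N <= v ^ 2 * (1 + Y) ^ 2).
{ apply Rabs_le_between. unfold N. rewrite Rpow_mult_distr in Hc.
  assert (v * sin (Y * v) <= v * (Y * v)) by (apply Rmult_le_compat_l; lra).
  assert (- (v * (Y * v)) <= v * sin (Y * v)) by nra.
  assert (0 <= Y * v ^ 2) by nra. assert (0 <= Y ^ 2 * v ^ 2) by nra.
  split; nra. }
unfold Rdiv. rewrite Rabs_mult, (Rabs_pos_eq (/ (1 + v ^ 2))) by (left; apply Rinv_0_lt_compat; lra).
assert (Hi : 0 < / (1 + v ^ 2) <= 1).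
{ split; [apply Rinv_0_lt_compat; lra|]. rewrite <- Rinv_1. apply Rinv_le_contravar; lra. }
generalize (Rabs_pos N). nra.
Qed.

(* Integrating [exp (-y)] against the asymptotics of the cosine primitive identifies its constant with Euler's. *)
Lemma cos_prim_1_constant (g K : R) : cos_prim_1_asymptotic g K -> g = - GammaD 1 1.
Proof.
intros Hg.
destruct (cos_transform_1_limit g K (fun y => exp (- y)) Hg tame_exp_neg) as [K' HK'].
assert (Hlim : is_lim (fun r => - (/ 2 * ln (1 + r ^ 2)) + ln r) p_infty (- (GammaD 1 1 + g))).
{ apply (is_lim_of_exp_half_ln _ _ K'). intros r Hr.
  (* With weight 1 the truncated transform is elementary; comparison with its asymptotics determines
     g. *)
  assert (HI : RInt (fun v => - v ^ 2 / (1 + v ^ 2) / v * 1) 0 r = - (/ 2 * ln (1 + r ^ 2))).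
  { rewrite (RInt_ext (V := R_CompleteNormedModule) _ (fun v => - v / (1 + v ^ 2))).
    2:{ rewrite Rmin_left, Rmax_right by lra. intros v Hv.
        change ((- v ^ 2 / (1 + v ^ 2) / v * 1 : R) = - v / (1 + v ^ 2)). field. nra. }
    apply is_RInt_unique.
    replace (- (/ 2 * ln (1 + r ^ 2))) with (minus (- (/ 2 * ln (1 + r ^ 2))) (- (/ 2 * ln (1 + 0 ^ 2)))).
    - apply (is_RInt_derive (V := R_CompleteNormedModule) (fun v => - (/ 2 * ln (1 + v ^ 2)))).
      + intros v _. auto_derive; [nra|]. field. nra.
      + intros v _. apply ex_derive_R_continuous. auto_derive. nra.
    - unfold minus, plus, opp; simpl. rewrite Rmult_0_l, Rplus_0_r, ln_1. ring. }
  destruct (poly_exp_bound 1 (/ 2) ltac:(lra)) as [Kp HKp].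
  assert (HL := line_cos_transform (fun _ => 1) (fun y => exp (- y)) (fun v => - v ^ 2 / (1 + v ^ 2))
    (fun Y => Kp * exp (- (1 / 2) * Y)) r weight_1 ltac:(lra) (proj1 tame_exp_neg)).
  cbv beta in HL. rewrite HI in HL.
  replace (- (/ 2 * ln (1 + r ^ 2)) + ln r - - (GammaD 1 1 + g))
    with (- (/ 2 * ln (1 + r ^ 2)) - - (GammaD 1 1 + (ln r + g) * GammaD 0 1)) by (rewrite GammaD_0_1; ring).
  apply HK'; [lra|]. apply HL.
  - intros Y v HY Hv. apply Rle_trans with (1 := exp_cos_transform_bound Y v ltac:(lra) Hv).
    apply Rmult_le_compat_l; [apply pow2_ge_0|].
    specialize (HKp Y ltac:(lra)).
    apply Rmult_le_compat_l with (r := exp (- Y)) in HKp; [|left; apply exp_pos].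
    apply Rle_trans with (1 := HKp). right.
    replace (- (1 / 2) * Y) with (- Y + / 2 * Y) by field. rewrite exp_plus. ring.
  - replace (Finite 0) with (Rbar_mult Kp 0) by (simpl; f_equal; ring).
    apply is_lim_scal_l, is_lim_exp_neg. lra.
  - apply (ex_RInt_ext (fun v => - v / (1 + v ^ 2))).
    + rewrite Rmin_left, Rmax_right by lra. intros v Hv.
      change ((- v / (1 + v ^ 2) : R) = - v ^ 2 / (1 + v ^ 2) / v * 1). field. nra.
    + apply (ex_RInt_continuous (V := R_CompleteNormedModule)). intros v _.
      apply ex_derive_R_continuous. auto_derive. nra. }
assert (Hlim0 : is_lim (fun r => - (/ 2 * ln (1 + r ^ 2)) + ln r) p_infty 0).
{ apply (is_lim_ext_loc (fun r => - (/ 2 * ln (1 + / r * / r)))).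
  { exists 0. intros r Hr.
    replace (1 + r ^ 2) with ((1 + / r * / r) * (r * r)) by (field; lra).
    assert (0 < / r * / r) by (assert (0 < / r) by (now apply Rinv_0_lt_compat); nra).
    rewrite ln_mult, ln_mult by nra. field. }
  replace (Finite 0) with (Finite ((fun u => - (/ 2 * ln (1 + u * u))) 0)).
  2:{ simpl. rewrite Rmult_0_l, Rplus_0_r, ln_1. f_equal. ring. }
  apply (is_lim_comp_continuous Rinv (fun u => - (/ 2 * ln (1 + u * u))) p_infty 0 is_lim_inv_p).
  apply ex_derive_R_continuous. auto_derive. lra. }
assert (E : Finite (- (GammaD 1 1 + g)) = Finite 0).
{ rewrite <- (is_lim_unique _ _ _ Hlim). now apply is_lim_unique. }
injection E. lra.
Qed.

(** * Complex integrals over segments, and the denominator v^2 + w^2 *)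

Definition is_CInt (f : R -> C) (a b : R) (l : C) : Prop :=
  is_RInt (fun x => Re (f x)) a b (Re l) /\ is_RInt (fun x => Im (f x)) a b (Im l).

Lemma cRInt_FTC (F f : R -> C) (a b : R) : a <= b ->
  (forall x, a <= x <= b -> cderive F x (f x)) -> (forall x, ccontinuous f x) ->
  is_CInt f a b (F b - F a)%C.
Proof.
intros Hab HF Hf.
split; [apply (is_RInt_derive (V := R_CompleteNormedModule) (fun x => Re (F x)))
  | apply (is_RInt_derive (V := R_CompleteNormedModule) (fun x => Im (F x)))];
rewrite ?Rmin_left, ?Rmax_right by lra; intros x Hx;
[apply (proj1 (HF x Hx)) | apply (proj1 (Hf x)) | apply (proj2 (HF x Hx)) | apply (proj2 (Hf x))].
Qed.

Lemma cRInt_Chasles (f : R -> C) (a b c : R) (l m : C) :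
  is_CInt f a b l -> is_CInt f b c m -> is_CInt f a c (l + m)%C.
Proof.
intros [H1 H2] [H3 H4].
split; eapply (is_RInt_Chasles (V := R_NormedModule)); eassumption.
Qed.

(** v^2 + w^2 = (w + i v) (w - i v), and both factors have real part Re w. *)
Lemma Cmod_den (w : C) (v : R) : 0 < Re w -> Re w ^ 2 <= Cmod (RtoC v ^ 2 + w ^ 2).
Proof.
intros Hw.
replace (RtoC v ^ 2 + w ^ 2)%C with ((w + Ci * RtoC v) * (w - Ci * RtoC v))%C.
2:{ destruct w as [a b]. apply C_ext; simpl; ring. }
rewrite Cmod_mult. 
assert (H1 : Re w <= Cmod (w + Ci * RtoC v)).
{ apply Rle_trans with (2 := Re_le_Cmod _).
  replace (Re (w + Ci * RtoC v)) with (Re w) by (simpl; unfold Re; ring). apply Rle_abs. }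
assert (H2 : Re w <= Cmod (w - Ci * RtoC v)).
{ apply Rle_trans with (2 := Re_le_Cmod _).
  replace (Re (w - Ci * RtoC v)) with (Re w) by (simpl; unfold Re; ring). apply Rle_abs. }
nra.
Qed.

Lemma den_neq_0 (w : C) (v : R) : 0 < Re w -> (RtoC v ^ 2 + w ^ 2)%C <> 0.
Proof.
intros Hw E. generalize (Cmod_den w v Hw). rewrite E, Cmod_0. nra.
Qed.

Lemma ccontinuous_inv (f : R -> C) (x : R) :
  ccontinuous f x -> f x <> 0 -> ccontinuous (fun x => / f x)%C x.
Proof.
intros [H1 H2] Hf.
assert (Hn : Re (f x) ^ 2 + Im (f x) ^ 2 <> 0).
{ intros E. apply Hf. generalize (pow2_ge_0 (Re (f x))) (pow2_ge_0 (Im (f x))). intros.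
  apply C_ext; simpl; apply Rsqr_0_uniq; unfold Rsqr; nra. }
assert (Hi : continuous (fun x => / (Re (f x) ^ 2 + Im (f x) ^ 2)) x).
{ apply (continuous_comp (fun x => Re (f x) ^ 2 + Im (f x) ^ 2) Rinv); [|now apply continuous_Rinv].
  apply (continuous_plus (V := R_NormedModule) (fun x => Re (f x) ^ 2)).
  - apply (continuous_comp (fun x => Re (f x)) (fun u => u ^ 2)); [exact H1|].
    apply ex_derive_R_continuous. auto_derive. trivial.
  - apply (continuous_comp (fun x => Im (f x)) (fun u => u ^ 2)); [exact H2|].
    apply ex_derive_R_continuous. auto_derive. trivial. }
split.
- apply (continuous_mult (K := R_AbsRing) (fun x => Re (f x))); assumption.
- apply (continuous_mult (K := R_AbsRing) (fun x => - Im (f x))); [|exact Hi].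
  now apply (continuous_opp (V := R_NormedModule)).
Qed.

(** * The kernel kap and its cosine transform *)

Definition kappa (w : C) (y : R) : C :=
  (w * sinh_cut w y - Ccosh w * (w * Cexp (- (w * RtoC y))))%C.

Lemma kappa_continuous (w : C) (y : R) : ccontinuous (kappa w) y.
Proof.
apply ccontinuous_minus; [apply ccontinuous_scal, sinh_cut_continuous|].
do 2 apply ccontinuous_scal. eapply cderive_continuous. apply cderive_Cexp, cderive_opp, cderive_scal.
apply (cderive_real (fun y => y)). apply (is_derive_id (K := R_AbsRing)).
Qed.

Lemma ctame_kappa (w : C) : 0 < Re w -> ctame (kappa w).
Proof.
intros Hw.
apply (ctame_of_Cmod _ (Cmod w * exp (Rabs (Re w) + 1) + Cmod (Ccosh w) * Cmod w) (Rmin 1 (Re w))).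
- apply Rmin_pos; lra.
- apply kappa_continuous.
- intros y Hy. unfold kappa.
  apply Rle_trans with (1 := Cmod_triangle _ _). rewrite Cmod_opp, !Cmod_mult, Cmod_Cexp.
  rewrite Rmult_plus_distr_r. apply Rplus_le_compat.
  + rewrite Rmult_assoc. apply Rmult_le_compat_l; [apply Cmod_ge_0|].
    destruct (Rle_dec 1 y) as [H|H].
    * rewrite sinh_cut_ge_1, Cmod_0 by exact H. apply Rmult_le_pos; left; apply exp_pos.
    * rewrite sinh_cut_le_1 by lra. apply Rle_trans with (1 := Cmod_Csinh _).
      rewrite <- exp_plus. apply exp_le_compat.
      replace (Re (w * RtoC (1 - y))) with (Re w * (1 - y)) by (simpl; unfold Re; ring).
      rewrite Rabs_mult, (Rabs_pos_eq (1 - y)) by lra.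
      generalize (Rabs_pos (Re w)) (Rmin_l 1 (Re w)). nra.
  + rewrite <- Rmult_assoc. apply Rmult_le_compat_l.
    * apply Rmult_le_pos; apply Cmod_ge_0.
    * apply exp_le_compat.
      replace (Re (- (w * RtoC y))) with (- (Re w * y)) by (simpl; unfold Re; ring).
      generalize (Rmin_r 1 (Re w)). nra.
Qed.

Lemma CMoment_kappa (w : C) (k : nat) : 0 < Re w ->
  CMoment (kappa w) k 1 = (w * CMoment (sinh_cut w) k 1
    - Ccosh w * (w * CMoment (fun y => Cexp (- (w * RtoC y))) k 1))%C.
Proof.
intros Hw. apply (cline_unique (cmoment (kappa w) k 1)).
- apply cmoment_line; [now apply ctame_kappa | lra].
- apply (cline_ext (fun x => w * cmoment (sinh_cut w) k 1 x
    - Ccosh w * (w * cmoment (fun y => Cexp (- (w * RtoC y))) k 1 x))%C).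
  { intros x. unfold cmoment, kappa. ring. }
  apply cline_minus; [|apply cline_scal]; apply cline_scal, cmoment_line; try lra;
  [apply ctame_sinh_cut | now apply ctame_Cexp].
Qed.

Definition kappa_hat (w : C) (v : R) : C :=
  (1 - w ^ 2 * RtoC (cos v) / (RtoC v ^ 2 + w ^ 2))%C.

Lemma cderive_cos (v y : R) : cderive (fun y => RtoC (cos (y * v))) y (- (RtoC v * RtoC (sin (y * v))))%C.
Proof.
apply (cderive_eq _ _ (RtoC (- (v * sin (y * v))))).
{ now rewrite RtoC_opp, RtoC_mult. }
apply (cderive_real (fun y => cos (y * v))). auto_derive; [trivial|ring].
Qed.

Lemma cderive_sin (v y : R) : cderive (fun y => RtoC (sin (y * v))) y (RtoC v * RtoC (cos (y * v)))%C.
Proof.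
apply (cderive_eq _ _ (RtoC (v * cos (y * v)))).
{ now rewrite RtoC_mult. }
apply (cderive_real (fun y => sin (y * v))). auto_derive; [trivial|ring].
Qed.

(** For Y >= 1 the cut part is complete, so the correction is the tail beyond Y of the exponential
    part alone. The interval is split at y = 1, where the kernel has a corner. *)
Lemma cRInt_kappa (w : C) (Y v : R) : 0 < Re w -> 1 <= Y ->
  is_CInt (fun y => kappa w y * RtoC (cos (y * v) - 1))%C 0 Y
    (kappa_hat w v - Ccosh w * (Cexp (- (w * RtoC Y)) *
      ((RtoC v ^ 2 + w ^ 2 * (1 - RtoC (cos (Y * v))) + w * RtoC v * RtoC (sin (Y * v))) / (RtoC v ^ 2 + w ^ 2))))%C.
Proof.
intros Hw HY.
assert (HD := den_neq_0 w v Hw). set (D := (RtoC v ^ 2 + w ^ 2)%C) in *.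
(* Primitive of w sinh (w (1 - y)) (cos (y v) - 1), from two integrations by parts; [F2] is its
   counterpart for the exponential part. *)
set (F1 := fun y => (w * / D * (RtoC v * (Csinh (w * RtoC (1 - y)) * RtoC (sin (y * v)))
  - w * (Ccosh (w * RtoC (1 - y)) * RtoC (cos (y * v)))) + Ccosh (w * RtoC (1 - y)))%C).
set (F2 := fun y => (- Ccosh w * (Cexp (- (w * RtoC y)) *
  (/ D * (w * RtoC v * RtoC (sin (y * v)) - w ^ 2 * RtoC (cos (y * v))) + 1)))%C).
assert (H1 : forall y, cderive F1 y (w * Csinh (w * RtoC (1 - y)) * (RtoC (cos (y * v)) - 1))%C).
{ intros y.
  refine (cderive_eq _ _ _ _ _ (cderive_plus _ _ _ _ _ (cderive_scal (w * / D)%C _ _ _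
    (cderive_minus _ _ _ _ _
      (cderive_scal (RtoC v) _ _ _ (cderive_mult _ _ _ _ _ (cderive_Csinh _ _ _ (cderive_affine w y)) (cderive_sin v y)))
      (cderive_scal w _ _ _ (cderive_mult _ _ _ _ _ (cderive_Ccosh _ _ _ (cderive_affine w y)) (cderive_cos v y)))))
    (cderive_Ccosh _ _ _ (cderive_affine w y)))).
  unfold D in *. field. exact HD. }
assert (H2 : forall y, cderive F2 y (- (Ccosh w * (w * Cexp (- (w * RtoC y)))) * (RtoC (cos (y * v)) - 1))%C).
{ intros y.
  assert (He : cderive (fun y => - (w * RtoC y))%C y (- (w * 1))%C).
  { apply cderive_opp, cderive_scal, (cderive_real (fun y => y)). apply (is_derive_id (K := R_AbsRing)). }
  refine (cderive_eq _ _ _ _ _ (cderive_scal (- Ccosh w)%C _ _ _ (cderive_mult _ _ _ _ _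
    (cderive_Cexp _ _ _ He)
    (cderive_plus _ _ _ _ _ (cderive_scal (/ D)%C _ _ _ (cderive_minus _ _ _ _ _
      (cderive_scal (w * RtoC v)%C _ _ _ (cderive_sin v y))
      (cderive_scal (w ^ 2)%C _ _ _ (cderive_cos v y)))) (cderive_const 1 y))))).
  unfold D in *. field. exact HD. }
assert (Hcont : forall y, ccontinuous (fun y => kappa w y * RtoC (cos (y * v) - 1))%C y).
{ intros y. apply ccontinuous_mult; [apply kappa_continuous|].
  apply (ccontinuous_real (fun y => cos (y * v) - 1)). apply ex_derive_R_continuous. auto_derive. trivial. }
assert (I1 : is_CInt (fun y => kappa w y * RtoC (cos (y * v) - 1))%C 0 1 ((F1 1 + F2 1) - (F1 0 + F2 0))%C).
{ apply (cRInt_FTC (fun y => F1 y + F2 y)%C); [lra | | exact Hcont].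
  intros y Hy. refine (cderive_eq _ _ _ _ _ (cderive_plus _ _ _ _ _ (H1 y) (H2 y))).
  unfold kappa. rewrite sinh_cut_le_1, (RtoC_minus (cos (y * v))) by lra. ring. }
assert (I2 : is_CInt (fun y => kappa w y * RtoC (cos (y * v) - 1))%C 1 Y (F2 Y - F2 1)%C).
{ apply (cRInt_FTC F2); [exact HY | | exact Hcont].
  intros y Hy. refine (cderive_eq _ _ _ _ _ (H2 y)).
  unfold kappa. rewrite sinh_cut_ge_1, (RtoC_minus (cos (y * v))) by lra. ring. }
refine (eq_rect _ (is_CInt _ 0 Y) (cRInt_Chasles _ _ _ _ _ _ I1 I2) _ _).
unfold F1, F2, kappa_hat. fold D.
rewrite !Rmult_0_l, !Rmult_1_l, sin_0, cos_0, Rminus_diag, Rminus_0_r.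
rewrite !Cmult_0_r, !Cmult_1_r, Csinh_0, Ccosh_0.
replace (- 0)%C with (RtoC 0) by ring. rewrite Cexp_0.
unfold D in *. field. exact HD.
Qed.

(** Extracts the factor v^2 required by [line_cos_transform], again from 1 - cos t <= t^2 / 2 and
    |sin t| <= t. *)
Lemma kappa_hat_error (w : C) (Y v : R) : 0 < Re w -> 0 <= Y -> 0 <= v ->
  Cmod (Ccosh w * (Cexp (- (w * RtoC Y)) *
      ((RtoC v ^ 2 + w ^ 2 * (1 - RtoC (cos (Y * v))) + w * RtoC v * RtoC (sin (Y * v))) / (RtoC v ^ 2 + w ^ 2))))
  <= v ^ 2 * (Cmod (Ccosh w) / Re w ^ 2 * (exp (- Re w * Y) * (1 + Cmod w * Y) ^ 2)).
Proof.
intros Hw HY Hv.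
rewrite !Cmod_mult, Cmod_div, Cmod_Cexp by (now apply den_neq_0).
replace (Re (- (w * RtoC Y))) with (- Re w * Y) by (simpl; unfold Re; ring).
assert (HD := Cmod_den w v Hw). assert (Hw2 : 0 < Re w ^ 2) by (apply pow_lt, Hw).
set (D := Cmod (RtoC v ^ 2 + w ^ 2)) in *.
set (N := (RtoC v ^ 2 + w ^ 2 * (1 - RtoC (cos (Y * v))) + w * RtoC v * RtoC (sin (Y * v)))%C).
assert (Hm := Cmod_ge_0 w). set (a := Cmod w) in *.
assert (HN : Cmod N <= v ^ 2 * (1 + a * Y) ^ 2).
{ unfold N. apply Rle_trans with (1 := Cmod_triangle _ _).
  assert (H1 : Cmod (RtoC v ^ 2 + w ^ 2 * (1 - RtoC (cos (Y * v)))) <= v ^ 2 + a ^ 2 * ((Y * v) ^ 2 / 2)).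
  { apply Rle_trans with (1 := Cmod_triangle _ _).
    rewrite Cmod_mult, !Cmod_pow, Cmod_R, (Rabs_pos_eq v Hv), <- RtoC_minus, Cmod_R. fold a.
    apply Rplus_le_compat_l, Rmult_le_compat_l; [apply pow2_ge_0|].
    rewrite Rabs_minus_sym. apply Rabs_cos_minus_1_le. }
  assert (H2 : Cmod (w * RtoC v * RtoC (sin (Y * v))) <= a * v * (Y * v)).
  { rewrite !Cmod_mult, !Cmod_R, (Rabs_pos_eq v Hv). fold a.
    apply Rmult_le_compat_l; [nra|]. apply Rle_trans with (1 := Rabs_sin_le _).
    rewrite Rabs_pos_eq; nra. }
  assert (0 <= a * Y) by nra. assert (0 <= v ^ 2) by apply pow2_ge_0.
  replace (a ^ 2 * ((Y * v) ^ 2 / 2)) with (v ^ 2 * ((a * Y) ^ 2 / 2)) in H1 by field.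
  replace (a * v * (Y * v)) with (v ^ 2 * (a * Y)) in H2 by ring.
  assert (0 <= v ^ 2 * (a * Y)) by nra. assert (0 <= v ^ 2 * (a * Y) ^ 2) by (apply Rmult_le_pos; [lra | apply pow2_ge_0]).
  lra. }
assert (Hq : Cmod N / D <= v ^ 2 * (1 + a * Y) ^ 2 / Re w ^ 2).
{ unfold Rdiv. apply Rmult_le_compat; [apply Cmod_ge_0 | left; apply Rinv_0_lt_compat; lra | exact HN |].
  apply Rinv_le_contravar; lra. }
replace (v ^ 2 * (Cmod (Ccosh w) / Re w ^ 2 * (exp (- Re w * Y) * (1 + a * Y) ^ 2)))
  with (Cmod (Ccosh w) * (exp (- Re w * Y) * (v ^ 2 * (1 + a * Y) ^ 2 / Re w ^ 2))) by (field; lra).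
apply Rmult_le_compat_l; [apply Cmod_ge_0|].
apply Rmult_le_compat_l; [left; apply exp_pos | exact Hq].
Qed.

(** * The limit of the truncated integral *)

Definition J_integrand (w : C) (u : R) : C :=
  (RtoC (u * cos u * ln u) / (RtoC u ^ 2 + w ^ 2))%C.

Lemma J_integrand_continuous (w : C) (u : R) : 0 < Re w -> ccontinuous (J_integrand w) u.
Proof.
intros Hw. apply (ccontinuous_mult (fun u => RtoC (u * cos u * ln u)) (fun u => / (RtoC u ^ 2 + w ^ 2))%C).
- apply (ccontinuous_real (fun u => u * cos u * ln u)).
  apply (continuous_ext (fun u => cos u * (u * ln u))); [intros z; change ((cos z * (z * ln z) : R) = z * cos z * ln z); ring|].
  apply (continuous_mult (K := R_AbsRing) cos (fun u => u * ln u)); [apply continuous_cos|].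
  apply continuous_weight_mult, weight_ln.
- apply ccontinuous_inv; [|now apply den_neq_0].
  apply ccontinuous_plus; [|apply ccontinuous_const].
  apply (ccontinuous_mult RtoC); [|apply (ccontinuous_mult RtoC); [|apply ccontinuous_const]];
  apply (ccontinuous_real (fun u => u)), continuous_id.
Qed.

(** Partial fractions: w^2 / (v (v^2 + w^2)) = 1 / v - v / (v^2 + w^2). *)
Lemma kappa_hat_integrand (w : C) (v : R) : 0 < Re w -> 0 < v ->
  (kappa_hat w v * RtoC (/ v * ln v) = J_integrand w v - RtoC (cos_kernel ln 1 v))%C.
Proof.
intros Hw Hv. unfold kappa_hat, J_integrand, cos_kernel.
assert (HD := den_neq_0 w v Hw).
assert (Hv' : RtoC v <> 0) by (intros E; apply RtoC_inj in E; lra).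
rewrite Rmult_1_l. unfold Rdiv. rewrite !RtoC_mult, RtoC_minus, RtoC_inv by lra.
field. split; assumption.
Qed.

(** With [p] for either part both are handled at once. The truncated integral is the transform of
    kap plus p(1) times [cos_prim ln r]. The former contains (c - (log r)^2 / 2) times - p(1), the
    latter the same with the opposite sign, so c and the divergent term disappear together. *)
Lemma J_part_limit (w : C) (p : C -> R) : 0 < Re w -> p = Re \/ p = Im ->
  is_lim (fun r => RInt (fun u => p (J_integrand w u)) 0 r) p_infty
    (p (RtoC (- GammaD 1 1) * CMoment (kappa w) 1 1 + / 2 * CMoment (kappa w) 2 1)%C).
Proof.
intros Hw Hp.
destruct ex_cos_prim_1_asymptotic as [g [Kg Hg]].
destruct ex_cos_prim_ln_asymptotic as [c [Kc Hc]].
assert (Eg := cos_prim_1_constant g Kg Hg). subst g.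
set (phi := fun y => p (kappa w y)).
assert (Hphi : tame phi).
{ destruct (ctame_kappa w Hw) as [HkR HkI]. unfold phi. destruct Hp; subst p; assumption. }
assert (Hcont : forall f x, ccontinuous f x -> continuous (fun x => p (f x)) x).
{ intros f x [H1 H2]. destruct Hp; subst p; assumption. }
assert (Hadd : forall a b, p (a - b)%C = p a - p b) by (intros; destruct Hp; subst p; reflexivity).
assert (Hmul : forall z a, p (z * RtoC a)%C = p z * a).
{ intros z a. destruct Hp; subst p; simpl; unfold Re, Im; ring. }
assert (Hle : forall z, Rabs (p z) <= Cmod z).
{ intros z. destruct Hp; subst p; [apply Re_le_Cmod | apply Im_le_Cmod]. }
assert (HRI : forall f a b l, is_CInt f a b l -> is_RInt (fun x => p (f x)) a b (p l)).
{ intros f a b l [H1 H2]. destruct Hp; subst p; assumption. }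
assert (HM : forall k, p (CMoment (kappa w) k 1) = Moment phi k 1).
{ intros k. unfold phi. destruct Hp; subst p; reflexivity. }
destruct (Clog_spec w Hw) as [Elog Hlog].
(* The total mass of kap: (cosh w - 1) - cosh w = -1. *)
assert (HM0 : Moment phi 0 1 = - p 1).
{ rewrite <- HM, CMoment_kappa by exact Hw.
  rewrite CMoment_sinh_cut_1. generalize (proj1 (CMoment_exp (Clog w) Hlog)). rewrite Elog. intros ->.
  replace (Ccosh w - 1 - Ccosh w * 1)%C with (- (1))%C by ring.
  destruct Hp; subst p; reflexivity. }
replace (p (RtoC (- GammaD 1 1) * CMoment (kappa w) 1 1 + / 2 * CMoment (kappa w) 2 1)%C)
  with (- GammaD 1 1 * Moment phi 1 1 + / 2 * Moment phi 2 1).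
2:{ rewrite <- !HM. replace (/ 2)%C with (RtoC (/ 2)) by (rewrite RtoC_inv; [reflexivity | lra]).
    destruct Hp; subst p; simpl; unfold Re, Im; ring. }
destruct (cos_transform_ln_limit (- GammaD 1 1) c Kg Kc phi Hg Hc Hphi) as [K HK].
assert (Hp1 : Rabs (p 1) <= 1) by (generalize (Hle 1); now rewrite Cmod_1).
(* Half of the decay rate Re w is given up to the polynomial (1 + |w| Y)^2. *)
destruct (poly_exp_bound (Cmod w) (Re w / 2) ltac:(lra)) as [Kp HKp].
apply (is_lim_of_exp_half_ln _ _ (K + Kc)). intros r Hr.
assert (HJ : RInt (fun u => p (J_integrand w u)) 0 r
  = RInt (fun v => p (kappa_hat w v) / v * ln v) 0 r + p 1 * cos_prim ln r
  /\ ex_RInt (fun v => p (kappa_hat w v) / v * ln v) 0 r).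
{ assert (HexJ : ex_RInt (fun u => p (J_integrand w u)) 0 r).
  { apply (ex_RInt_continuous (V := R_CompleteNormedModule)). intros u _.
    apply Hcont. now apply J_integrand_continuous. }
  assert (Hexk : ex_RInt (fun v => p 1 * cos_kernel ln 1 v) 0 r).
  { apply (ex_RInt_scal (V := R_CompleteNormedModule)), ex_RInt_cos_kernel, weight_ln. }
  assert (Heq : forall v, 0 < v -> minus (p (J_integrand w v)) (p 1 * cos_kernel ln 1 v) = p (kappa_hat w v) / v * ln v).
  { intros v Hv. unfold minus, plus, opp; simpl.
    transitivity (p (J_integrand w v) - p (RtoC (cos_kernel ln 1 v))).
    - rewrite <- (Cmult_1_l (RtoC (cos_kernel ln 1 v))), Hmul. ring.
    - rewrite <- Hadd, <- kappa_hat_integrand, Hmul by assumption. unfold Rdiv. ring. }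
  assert (Hsub : is_RInt (fun v => p (kappa_hat w v) / v * ln v) 0 r
    (minus (RInt (fun u => p (J_integrand w u)) 0 r) (RInt (fun v => p 1 * cos_kernel ln 1 v) 0 r))).
  { apply (is_RInt_ext (fun v => minus (p (J_integrand w v)) (p 1 * cos_kernel ln 1 v))).
    - rewrite Rmin_left, Rmax_right by lra. intros v Hv. apply Heq. lra.
    - apply (is_RInt_minus (V := R_NormedModule)); now apply (RInt_correct (V := R_CompleteNormedModule)). }
  split; [|eexists; exact Hsub].
  rewrite (is_RInt_unique (V := R_CompleteNormedModule) _ _ _ _ Hsub).
  assert (Hsc : RInt (fun v => p 1 * cos_kernel ln 1 v) 0 r = p 1 * cos_prim ln r).
  { apply (RInt_scal (V := R_CompleteNormedModule)), ex_RInt_cos_kernel, weight_ln. }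
  rewrite Hsc. assert (Hab : forall a b : R, a = a + - b + b) by (intros; ring). apply Hab. }
destruct HJ as [HJ Hex]. rewrite HJ.
assert (HL := line_cos_transform ln phi (fun v => p (kappa_hat w v))
  (fun Y => Cmod (Ccosh w) / Re w ^ 2 * Kp * exp (- (Re w / 2) * Y)) r weight_ln ltac:(lra) (proj1 Hphi)).
assert (HL' : is_RInt_line (fun x => exp x * (phi (exp x) * cos_transform ln r (exp x)))
   (RInt (fun v => p (kappa_hat w v) / v * ln v) 0 r)).
{ apply HL; [| | exact Hex].
  - intros Y v HY Hv.
    assert (HI := HRI _ _ _ _ (cRInt_kappa w Y v Hw HY)).
    apply (is_RInt_ext _ (fun y => phi y * (cos (y * v) - 1))) in HI.
    2:{ intros y _. apply Hmul. }
    rewrite (is_RInt_unique (V := R_CompleteNormedModule) _ _ _ _ HI), Hadd.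
    match goal with |- Rabs (?a - ?b - ?a) <= _ => replace (a - b - a) with (- b) by ring end.
    rewrite Rabs_Ropp. apply Rle_trans with (1 := Hle _).
    apply Rle_trans with (1 := kappa_hat_error w Y v Hw ltac:(lra) Hv).
    apply Rmult_le_compat_l; [apply pow2_ge_0|].
    rewrite Rmult_assoc. apply Rmult_le_compat_l.
    { apply Rdiv_le_0_compat; [apply Cmod_ge_0 | apply pow_lt, Hw]. }
    specialize (HKp Y ltac:(lra)).
    apply Rmult_le_compat_l with (r := exp (- Re w * Y)) in HKp; [|left; apply exp_pos].
    apply Rle_trans with (1 := HKp). right.
    replace (- (Re w / 2) * Y) with (- Re w * Y + Re w / 2 * Y) by field. rewrite exp_plus. ring.
  - set (q := Cmod (Ccosh w) / Re w ^ 2 * Kp).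
    replace (Finite 0) with (Rbar_mult q 0) by (simpl; f_equal; ring).
    apply is_lim_scal_l, is_lim_exp_neg. lra. }
assert (H1 := HK r _ ltac:(lra) HL'). assert (H2 := Hc r ltac:(lra)).
rewrite HM0 in H1.
set (L := RInt (fun v => p (kappa_hat w v) / v * ln v) 0 r) in *.
replace (L + p 1 * cos_prim ln r - (- GammaD 1 1 * Moment phi 1 1 + / 2 * Moment phi 2 1))
  with ((L - (- GammaD 1 1 * Moment phi 1 1 + / 2 * Moment phi 2 1 + (c - ln r ^ 2 / 2) * - p 1))
    + p 1 * (cos_prim ln r + ln r ^ 2 / 2 - c)) by field.
apply Rle_trans with (1 := Rabs_triang _ _). rewrite Rabs_mult.
generalize (Rabs_pos (cos_prim ln r + ln r ^ 2 / 2 - c)). nra.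
Qed.

Theorem theorem4p3 :
  forall w : C, 0 < Re w ->
    exists J : C,
      is_RInt_gen (V := C_R_NormedModule)
        (fun u : R => (RtoC (u * cos u * ln u) / (RtoC u ^ 2 + w ^ 2))%C)
        (at_point 0) (Rbar_locally p_infty) J /\
      is_derive2 (fun b : R => mittag_leffler 2 b (w ^ 2)%C) 1
        (Clog w ^ 2 * Ccosh w + 2 * J)%C.
Proof.
intros w Hw.
set (J := (RtoC (- GammaD 1 1) * CMoment (kappa w) 1 1 + / 2 * CMoment (kappa w) 2 1)%C).
exists J. split.
- change (is_RInt_gen (V := C_R_NormedModule) (J_integrand w) (at_point 0) (Rbar_locally p_infty) J).
  set (Jr := fun r => ((RInt (fun u => Re (J_integrand w u)) 0 r, RInt (fun u => Im (J_integrand w u)) 0 r) : C)).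
  assert (Hlim : filterlim Jr (Rbar_locally p_infty) (locally (T := C_R_NormedModule) J)).
  { apply (filterlim_C (Rbar_locally p_infty)).
    - apply (J_part_limit w Re Hw). now left.
    - apply (J_part_limit w Im Hw). now right. }
  (* The lower filter is principal at 0, so only the limit of the proper integrals from 0
     matters. *)
  intros P HP. exists (fun a => a = 0) (fun b => P (Jr b)).
  + reflexivity.
  + exact (Hlim P HP).
  + intros a b -> Hb. exists (Jr b). split; [|exact Hb].
    apply (is_RInt_fct_extend_pair (U := R_NormedModule) (V := R_NormedModule) (J_integrand w) 0 b).
    * apply (RInt_correct (V := R_CompleteNormedModule) (fun u => Re (J_integrand w u))).
      apply (ex_RInt_continuous (V := R_CompleteNormedModule)). intros u _.
      apply (proj1 (J_integrand_continuous w u Hw)).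
    * apply (RInt_correct (V := R_CompleteNormedModule) (fun u => Im (J_integrand w u))).
      apply (ex_RInt_continuous (V := R_CompleteNormedModule)). intros u _.
      apply (proj2 (J_integrand_continuous w u Hw)).
- assert (E : (RtoC (2 * GammaD 1 1 ^ 2 - GammaD 2 1) * Ccosh w
     - RtoC (2 * GammaD 1 1) * (w * CMoment (sinh_cut w) 1 1)
     + w * CMoment (sinh_cut w) 2 1 = Clog w ^ 2 * Ccosh w + 2 * J)%C).
  (* In 2 J the moments of w e^(-w y) enter with the factor - cosh w: the terms 2 Gamma'(1) log w
     cancel, and the remaining - log^2 w cosh w is offset by the first summand on the right. *)
  { unfold J. rewrite !CMoment_kappa by exact Hw.
    destruct (Clog_spec w Hw) as [Elog Hlog].
    destruct (CMoment_exp (Clog w) Hlog) as [_ [E1 E2]]. rewrite Elog in E1, E2. rewrite E1, E2.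
    rewrite !RtoC_opp, RtoC_minus, !RtoC_mult, RtoC_pow. field. }
  rewrite <- E. apply is_derive2_mittag_leffler.
Qed.
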